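(* Let $(M,\langle\cdot,\cdot\rangle)$ be a complete Riemannian manifold, let $\mathcal{V}$ be a concircular vector field globally defined on $M$, and let $N$ be a non-trivial concircular hypersurface in $M$ with axis $\mathcal{V}$. Then $N$ is locally a ruled hypersurface.
   Context: Let $\nabla^0$ be the Levi-Civita connection of $(M,\langle\cdot,\cdot\rangle)$. A vector field $\mathcal{V}$ on $M$ is concircular if there is a smooth function $f$ on $M$ (the conformal scalar) with $\nabla^0_X\mathcal{V}=fX$ for all vector fields $X$ on $M$. Let $N$ be an orientable immersed hypersurface of $M$ with unit normal vector field $U$. $N$ is a non-trivial concircular hypersurface with axis $\mathcal{V}$ if the tangential projection $\mathcal{V}^\top$ of $\mathcal{V}$ on $N$ is nonzero (at every point) and $\langle U,\mathcal{V}\rangle=\vartheta$ on $N$ for a constant $\vartheta\in\mathbb{R}$. A hypersurface $N$ is called ruled if it is foliated by curves that are geodesics of the ambient space $M$. *)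

(* Defs.v *)
From HB Require Import structures.
From mathcomp Require Import all_boot all_order all_algebra.
From mathcomp Require Import all_classical all_reals all_analysis.
From mathcomp Require Import lra.

Set Implicit Arguments.
Unset Strict Implicit.
Unset Printing Implicit Defensive.

Import Order.TTheory GRing.Theory Num.Theory.
Import numFieldNormedType.Exports.

Local Open Scope classical_set_scope.
Local Open Scope ring_scope.

(* Vectors are row vectors; objects on a manifold are given by their          *)
(* components in every chart, subject to the usual transformation law, and    *)
(* the values of the components outside the domain of the chart are           *)
(* irrelevant.                                                                *)

Definition iter_derive {R : realType} {V W : normedModType R} (s : seq V)
    (f : V -> W) : V -> W :=
  foldr (fun v (h : V -> W) => fun x => 'D_v h x) f s.

(* For an open set A and a finite-dimensional V, this is being C^oo on A.     *)
Definition smooth_on {R : realType} {V W : normedModType R} (A : set V)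
    (f : V -> W) : Prop :=
  forall (s : seq V) (x : V), A x -> differentiable (iter_derive s f) x.

Record chart (R : realType) (T : topologicalType) (n : nat) := Chart {
  cdom : set T;
  cmap :> T -> 'rV[R]_n;
  cinv : 'rV[R]_n -> T;
  cdom_open : open cdom;
  cimg_open : open (cmap @` cdom);
  cmapK : forall p, cdom p -> cinv (cmap p) = p;
  cmap_continuous : forall p, cdom p -> {for p, continuous cmap};
  cinv_continuous : forall x, (cmap @` cdom) x -> {for x, continuous cinv} }.

(* The expression of F in the charts b (source) and c (target), and the       *)
(* subset of R^m on which it is meaningful.                                   *)
Definition loc {R : realType} {S T : topologicalType} {m n : nat} (F : S -> T)
    (b : chart R S m) (c : chart R T n) : 'rV[R]_m -> 'rV[R]_n :=
  fun x => c (F (cinv b x)).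

Definition locdom {R : realType} {S T : topologicalType} {m n : nat}
    (F : S -> T) (b : chart R S m) (c : chart R T n) : set 'rV[R]_m :=
  b @` (cdom b `&` F @^-1` cdom c).

Definition compatible {R : realType} {T : topologicalType} {n : nat}
    (b c : chart R T n) : Prop :=
  smooth_on (locdom id b c) (loc id b c) /\
  smooth_on (locdom id c b) (loc id c b).

Record manifold (R : realType) (n : nat) := Manifold {
  mspace :> topologicalType;
  atlas : set (chart R mspace n);
  mspace_hausdorff : hausdorff_space mspace;
  mspace_countable : @second_countable mspace;
  atlas_cover : forall p : mspace, exists2 c, atlas c & cdom c p;
  atlas_compatible : forall b c, atlas b -> atlas c -> compatible b c;
  atlas_maximal : forall b, (forall c, atlas c -> compatible b c) -> atlas b }.

Definition mchart {R : realType} {n : nat} (M : manifold R n) : Type :=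
  chart R M n.

Definition chart_at {R : realType} {n : nat} {M : manifold R n} (p : M)
    (c : mchart M) : Prop :=
  atlas c /\ cdom c p.

Definition smooth_fun {R : realType} {n : nat} {M : manifold R n}
    (f : M -> R) : Prop :=
  forall c : mchart M, atlas c -> smooth_on (c @` cdom c) (f \o cinv c).

(* Continuity is what makes the sets locdom F b c open.                       *)
Definition smooth_map {R : realType} {m n : nat} {N : manifold R m}
    {M : manifold R n} (F : N -> M) : Prop :=
  continuous F /\
  forall (b : mchart N) (c : mchart M), atlas b -> atlas c ->
    smooth_on (locdom F b c) (loc F b c).

Definition immersion {R : realType} {m n : nat} {N : manifold R m}
    {M : manifold R n} (F : N -> M) : Prop :=
  smooth_map F /\
  forall (q : N) (b : mchart N) (c : mchart M),
    chart_at q b -> chart_at (F q) c ->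
    forall w : 'rV[R]_m, 'd (loc F b c) (b q) w = 0 -> w = 0.

Definition tangent {R : realType} {n : nat} {M : manifold R n} (p : M)
    (v : mchart M -> 'rV[R]_n) : Prop :=
  forall b c : mchart M, chart_at p b -> chart_at p c ->
    v c = 'd (loc id b c) (b p) (v b).

Record vfield_along (R : realType) (m n : nat) (N : manifold R m)
    (M : manifold R n) (F : N -> M) := VFieldAlong {
  vf :> N -> mchart M -> 'rV[R]_n;
  vf_tangent : forall q, tangent (F q) (vf q);
  vf_smooth : forall (b : mchart N) (c : mchart M), atlas b -> atlas c ->
    smooth_on (locdom F b c) (fun x => vf (cinv b x) c) }.

Definition vfield {R : realType} {n : nat} (M : manifold R n) : Type :=
  vfield_along (fun p : M => p).

Definition bilin {R : realType} {n : nat} (G : 'M[R]_n) (u v : 'rV[R]_n) : R :=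
  (u *m G *m v^T) 0 0.

Record metric (R : realType) (n : nat) (M : manifold R n) := Metric {
  gmx :> M -> mchart M -> 'M[R]_n;
  gmx_tensor : forall (p : M) (b c : mchart M),
    chart_at p b -> chart_at p c -> forall u v : 'rV[R]_n,
    bilin (gmx p b) u v =
    bilin (gmx p c) ('d (loc id b c) (b p) u) ('d (loc id b c) (b p) v);
  gmx_smooth : forall c : mchart M, atlas c ->
    smooth_on (c @` cdom c) (fun x => gmx (cinv c x) c);
  gmx_sym : forall (p : M) (c : mchart M), chart_at p c ->
    (gmx p c)^T = gmx p c;
  gmx_pos : forall (p : M) (c : mchart M), chart_at p c ->
    forall v : 'rV[R]_n, v != 0 -> 0 < bilin (gmx p c) v v }.

(* dmetric g p c k i j is the partial derivative d_k g_ij at p.               *)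
Definition dmetric {R : realType} {n : nat} {M : manifold R n} (g : metric M)
    (p : M) (c : mchart M) (k i j : 'I_n) : R :=
  'D_(delta_mx 0 k) (fun x => g (cinv c x) c i j) (c p).

(* christoffel g p c k i j is Gamma^k_ij.                                     *)
Definition christoffel {R : realType} {n : nat} {M : manifold R n}
    (g : metric M) (p : M) (c : mchart M) (k i j : 'I_n) : R :=
  2^-1 * \sum_l invmx (g p c) k l *
    (dmetric g p c i j l + dmetric g p c j i l - dmetric g p c l i j).

Definition christoffel_form {R : realType} {n : nat} {M : manifold R n}
    (g : metric M) (p : M) (c : mchart M) (u v : 'rV[R]_n) : 'rV[R]_n :=
  \row_k \sum_i \sum_j christoffel g p c k i j * u 0 i * v 0 j.

(* The components in the chart c of the covariant derivative of Y along X.    *)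
Definition nabla {R : realType} {n : nat} {M : manifold R n} (g : metric M)
    (X Y : vfield M) (p : M) (c : mchart M) : 'rV[R]_n :=
  'd (fun x => Y (cinv c x) c) (c p) (X p c)
  + christoffel_form g p c (X p c) (Y p c).

Definition open_interval {R : realType} (I : set R) : Prop :=
  [/\ open I, is_interval I & I !=set0].

Definition smooth_curve {R : realType} {n : nat} {M : manifold R n}
    (I : set R) (gam : R -> M) : Prop :=
  (forall t, I t -> {for t, continuous gam}) /\
  forall c : mchart M, atlas c ->
    smooth_on (I `&` gam @^-1` cdom c) (fun t => c (gam t)).

Definition velocity {R : realType} {n : nat} {M : manifold R n}
    (gam : R -> M) (t : R) (c : mchart M) : 'rV[R]_n :=
  derive1 (fun s => c (gam s)) t.

(* The covariant derivative of the velocity of gam along gam.                 *)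
Definition acceleration {R : realType} {n : nat} {M : manifold R n}
    (g : metric M) (gam : R -> M) (t : R) (c : mchart M) : 'rV[R]_n :=
  derive1 (fun s => velocity gam s c) t
  + christoffel_form g (gam t) c (velocity gam t c) (velocity gam t c).

Definition geodesic {R : realType} {n : nat} {M : manifold R n} (g : metric M)
    (I : set R) (gam : R -> M) : Prop :=
  smooth_curve I gam /\
  forall (t : R) (c : mchart M), I t -> chart_at (gam t) c ->
    acceleration g gam t c = 0.

Definition regular_curve {R : realType} {n : nat} {M : manifold R n}
    (I : set R) (gam : R -> M) : Prop :=
  [/\ open_interval I, smooth_curve I gam &
      forall (t : R) (c : mchart M), I t -> chart_at (gam t) c ->
        velocity gam t c != 0].

(* Geodesic completeness: geodesics with arbitrary initial data are defined   *)
(* for all times.                                                             *)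
Definition complete_metric {R : realType} {n : nat} {M : manifold R n}
    (g : metric M) : Prop :=
  forall (p : M) (v : mchart M -> 'rV[R]_n), tangent p v ->
    exists gam : R -> M,
      [/\ geodesic g setT gam, gam 0 = p &
          forall c : mchart M, chart_at p c -> velocity gam 0 c = v c].

Definition concircular {R : realType} {n : nat} {M : manifold R n}
    (g : metric M) (V : vfield M) : Prop :=
  exists2 f : M -> R, smooth_fun f &
    forall (X : vfield M) (p : M) (c : mchart M), chart_at p c ->
      nabla g X V p c = f p *: X p c.

Definition unit_normal {R : realType} {n : nat} {M : manifold R n.+1}
    (g : metric M) {N : manifold R n} (i : N -> M) (U : vfield_along i) : Prop :=
  forall (q : N) (b : mchart N) (c : mchart M),
    chart_at q b -> chart_at (i q) c ->
    bilin (g (i q) c) (U q c) (U q c) = 1 /\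
    forall w : 'rV[R]_n,
      bilin (g (i q) c) (U q c) ('d (loc i b c) (b q) w) = 0.

(* As di(T_q N) is the orthogonal complement of U q, the tangential           *)
(* projection of V at i q is V - <U, V> U.                                    *)
Definition tangential {R : realType} {n : nat} {M : manifold R n.+1}
    (g : metric M) (V : vfield M) {N : manifold R n} (i : N -> M)
    (U : vfield_along i) (q : N) (c : mchart M) : 'rV[R]_n.+1 :=
  V (i q) c - bilin (g (i q) c) (U q c) (V (i q) c) *: U q c.

Definition nontrivial_concircular_hypersurface {R : realType} {n : nat}
    {M : manifold R n.+1} (g : metric M) (V : vfield M) {N : manifold R n}
    (i : N -> M) (U : vfield_along i) : Prop :=
  [/\ immersion i,
      unit_normal g U,
      forall (q : N) (c : mchart M), chart_at (i q) c ->
        tangential g V U q c != 0 &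
      exists theta : R, forall (q : N) (c : mchart M), chart_at (i q) c ->
        bilin (g (i q) c) (U q c) (V (i q) c) = theta].

Definition box {R : realType} {n : nat} (a b : 'rV[R]_n) : set 'rV[R]_n :=
  [set x | forall k, a 0 k < x 0 k < b 0 k].

(* The curve in cdom c on which all coordinates but the first are constant.   *)
Definition slice {R : realType} {n : nat} {N : manifold R n} (c : mchart N)
    (a : 'rV[R]_n) : set N :=
  [set p | cdom c p /\ forall k : 'I_n, (k : nat) != 0%N -> c p 0 k = a 0 k].

(* F is a one-dimensional foliation of the open subset W of N: a partition    *)
(* of W into immersed curves (a closed leaf is parametrised non-injectively   *)
(* by R), with a flat chart around each point.                                *)
Definition foliation_by_curves {R : realType} {n : nat} {N : manifold R n}
    (W : set N) (F : set (set N)) : Prop :=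
  [/\ partition F id W,
      forall L, F L -> exists (I : set R) (gam : R -> N),
        regular_curve I gam /\ gam @` I = L &
      forall p, W p -> exists c : mchart N,
        [/\ chart_at p c,
            cdom c `<=` W,
            exists a b : 'rV[R]_n, c @` cdom c = box a b &
            forall L, F L -> exists2 A : set 'rV[R]_n, countable A &
              L `&` cdom c = \bigcup_(a in A) slice c a]].

Definition ruled {R : realType} {n : nat} {M : manifold R n.+1} (g : metric M)
    {N : manifold R n} (i : N -> M) (W : set N) : Prop :=
  exists2 F : set (set N), foliation_by_curves W F &
    forall L, F L -> exists (I : set R) (gam : R -> N),
      [/\ regular_curve I gam, gam @` I = L & geodesic g I (i \o gam)].

Definition locally_ruled {R : realType} {n : nat} {M : manifold R n.+1}
    (g : metric M) {N : manifold R n} (i : N -> M) : Prop :=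
  forall q : N, exists W : set N, [/\ open W, W q & ruled g i W].

(* The explicit Christoffel symbols are those of the Levi-Civita connection:   *)
(* by christoffel_sym and christoffel_metric they are torsion-free and metric. *)

Lemma dmetric_sym (R : realType) (n : nat) (M : manifold R n) (g : metric M)
    (p : M) (c : mchart M) (k i j : 'I_n) :
  chart_at p c -> dmetric g p c k i j = dmetric g p c k j i.
Proof.
move=> [ac cp]; rewrite /dmetric; apply: near_eq_derive.
have : nbhs (c p) (c @` cdom c).
  by apply: open_nbhs_nbhs; split; [exact: cimg_open | exists p].
apply: filterS => x [q cq <-]; rewrite cmapK //.
by rewrite -[in LHS](@gmx_sym _ _ _ g q c) ?mxE.
Qed.

Lemma christoffel_sym (R : realType) (n : nat) (M : manifold R n)
    (g : metric M) (p : M) (c : mchart M) (k i j : 'I_n) :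
  chart_at p c -> christoffel g p c k i j = christoffel g p c k j i.
Proof.
move=> pc; rewrite /christoffel; congr (_ * _); apply: eq_bigr => l _.
by rewrite (dmetric_sym g l i j pc) (addrC (dmetric _ _ _ i j l)).
Qed.

Lemma gmx_unit (R : realType) (n : nat) (M : manifold R n) (g : metric M)
    (p : M) (c : mchart M) : chart_at p c -> g p c \in unitmx.
Proof.
move=> pc; rewrite -row_free_unit -kermx_eq0; apply/eqP/row_matrixP => i.
rewrite row0; apply/eqP/negPn/negP => /(@gmx_pos _ _ _ g _ _ pc).
by rewrite /bilin -row_mul mulmx_ker row0 mul0mx mxE ltxx.
Qed.

Lemma christoffel_metric (R : realType) (n : nat) (M : manifold R n)
    (g : metric M) (p : M) (c : mchart M) (k i j : 'I_n) :
  chart_at p c ->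
  dmetric g p c k i j = \sum_l (christoffel g p c l k i * g p c l j
                                + christoffel g p c l k j * g p c i l).
Proof.
move=> pc.
have gS a b : g p c a b = g p c b a by rewrite -[in LHS](gmx_sym g pc) mxE.
have low a b e : \sum_l christoffel g p c l a b * g p c l e =
    2^-1 * (dmetric g p c a b e + dmetric g p c b a e - dmetric g p c e a b).
  under eq_bigr do rewrite /christoffel -mulrA mulr_suml.
  rewrite -mulr_sumr exchange_big /=; congr (_ * _).
  transitivity (\sum_m (g p c *m invmx (g p c)) e m *
      (dmetric g p c a b m + dmetric g p c b a m - dmetric g p c m a b)).
    apply: eq_bigr => m _; rewrite mxE mulr_suml; apply: eq_bigr => l _.
    by rewrite (gS l e) mulrAC (mulrC (invmx _ _ _)).
  rewrite mulmxV ?gmx_unit // (bigD1 e) //= big1 => [|m me].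
    by rewrite !mxE eqxx mul1r addr0.
  by rewrite !mxE eq_sym (negPf me) mul0r.
rewrite big_split /= low; under [X in _ + X]eq_bigr do rewrite gS.
by rewrite low (dmetric_sym g k j i pc); lra.
Qed.

(* Main.v *)
Require Import Defs.
From HB Require Import structures.
From mathcomp Require Import all_boot all_order all_algebra.
From mathcomp Require Import all_classical all_reals all_analysis.
From mathcomp Require Import perm.
From mathcomp Require Import ring lra.

(** Let theta = <U, V>, let T = V - theta U be the tangential part of the axis
along N, and f the conformal scalar of V.

The shape operator of N annihilates T. Indeed, for a tangent vector Z, derive the
constant <U, V> along Z: as the derivative of V along Z is the multiple f Z,
which is orthogonal to U, the derivative of U along Z is orthogonal to V. It
is also orthogonal to U, because <U, U> is constant, hence to T. So the
second fundamental form of (Z, T) vanishes for every Z, and by symmetry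
[shape_symmetric] the derivative of U along T is orthogonal to all tangent
vectors Z, and to U, hence zero [covariant_normal_axis]. Deriving
T = V - theta U along T therefore gives f T [covariant_tangential], and a
field without zeros whose derivative along itself is a multiple of itself
becomes geodesic after normalisation: the unit field T / |T| has geodesic
integral curves in M [geodesic_axis_tangent]. These curves foliate N.

Turning this into a foliation takes the theory of ordinary differential
equations: existence of solutions [picard_lindelof], smooth dependence on the
initial values [flow_Cinf] and straightening of a field without zeros
[flow_box]. Smoothness is organised around the tangent map (x, w) |-> (f x, df_x w)
of f: the tangent map of a flow is the flow of the tangent map of
its field [is_flow_tmap], so that a flow is differentiable arbitrarily often
as soon as all flows are differentiable once [flow_diff].

The straightening gives a chart of N onto a cube whose first coordinate lines
are integral curves of the direction of T [cube_chart], and the leaves are its slices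
[slices_foliation]. The identity for the derivative of V is assumed for global
vector fields; it holds for each tangent vector because bump functions extend it
to a global field [vfield_through]. *)

Set Implicit Arguments.
Unset Strict Implicit.
Unset Printing Implicit Defensive.

Import Order.TTheory GRing.Theory Num.Theory.
Import numFieldNormedType.Exports.

Local Open Scope classical_set_scope.
Local Open Scope ring_scope.

(** * Functions of class C^k between normed spaces *)

Section DifferentialCalculus.
Context {R : realType}.
Implicit Types V W Z : normedModType R.

(** An epsilon form of the little-o definition, convenient both for
    establishing and for using differentiability. *)
Lemma is_diff_epsilon V W (f : V -> W) (x : V) (df : {linear V -> W}) :
  continuous df ->
  (forall e : R, 0 < e ->
     \forall h \near 0, `|f (x + h) - f x - df h| <= e * `|h|) ->
  differentiable f x /\ 'd f x = df :> (V -> W).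
Proof.
move=> dfc H.
have E : f \o shift x = cst (f x) + df +o_ 0 id.
  apply/eqaddoP => e e0; have := H e e0.
  by apply: filterS => h /=; rewrite !fctE /= (addrC h) opprD addrA.
have D := diff_unique dfc E.
split=> //; apply/diff_locallyP; rewrite D; split=> //.
Qed.

Lemma diff_epsilon V W (f : V -> W) (x : V) : differentiable f x ->
  forall e : R, 0 < e ->
    \forall h \near 0, `|f (x + h) - f x - 'd f x h| <= e * `|h|.
Proof.
move=> /diff_locallyP[_ /eqaddoP H] e e0; have := H e e0.
by apply: filterS => h /=; rewrite !fctE /= (addrC h) opprD addrA.
Qed.

Lemma near_eq_diff V W (f g : V -> W) (x : V) :
  (\near x, f x = g x) -> differentiable f x ->
  differentiable g x /\ 'd g x = 'd f x :> (V -> W).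
Proof.
move=> fg df; apply: is_diff_epsilon; first exact: diff_continuous.
move=> e e0; have /= H := diff_epsilon df e0.
have fgx := nbhs_singleton fg.
have /= fg0 : \forall h \near 0, f (x + h) = g (x + h).
  by have := fg; rewrite -{1}(addr0 x) (near_shift 0) subr0; apply: filterS => h /=; rewrite addr0 addrC.
near=> h; rewrite -fgx -(near fg0 h)//; exact: (near H h).
Unshelve. all: by end_near. Qed.

Lemma diff_is_derive V W (f : V -> W) (x v : V) : differentiable f x ->
  is_derive x v f ('d f x v).
Proof. by move=> df; rewrite -deriveE//; apply/derivableP/diff_derivable. Qed.

Lemma is_derive_diff V (f : R -> V) (t : R) (d : V) : is_derive t 1 f d ->
  differentiable f t /\ forall h : R, 'd f t h = h *: d.
Proof.
move=> [/derivable1_diffP df E]; split=> // h.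
by rewrite diff1E//= derive1E E.
Qed.

(** The tangent map. Iterating it replaces higher derivatives, which spares
    multilinear maps. *)
Definition tmap V W (f : V -> W) (p : V * V) : W * W := (f p.1, 'd f (p.1) p.2).

Fixpoint Ck (k : nat) : forall V W : normedModType R, set V -> (V -> W) -> Prop :=
  match k with
  | 0 => fun V W A f => forall x, A x -> {for x, continuous f}
  | k'.+1 => fun V W A f =>
      (forall x, A x -> differentiable f x) /\ Ck k' (fst @^-1` A) (tmap f)
  end.

Arguments Ck : simpl never.

Lemma CkSP k V W (A : set V) (f : V -> W) : Ck k.+1 A f <->
  (forall x, A x -> differentiable f x) /\ Ck k (fst @^-1` A) (tmap f).
Proof. by []. Qed.

Definition Cinf V W (A : set V) (f : V -> W) : Prop := forall k, Ck k A f.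

Lemma open_fst V W (A : set V) : open A -> open ((fst : V * W -> V) @^-1` A).
Proof. by move=> oA; apply: open_comp => // p _; exact: cvg_fst. Qed.

(** Being of class C^k is local, although the recursion quantifies over a
    fixed set. *)
Lemma Ck_local k V W (A : set V) (f : V -> W) : open A ->
  (forall x, A x -> exists B, [/\ open B, B x & Ck k B f]) -> Ck k A f.
Proof.
elim: k V W A f => [|k IH] V W A f oA H.
  by move=> x /H [B [oB Bx]]; apply.
apply/CkSP; split=> [x /H [B [oB Bx /CkSP[Hd _]]]|]; first exact: Hd.
apply: IH; first exact: open_fst.
move=> [x w] /= /H [B [oB Bx /CkSP[_ Ht]]]; exists (fst @^-1` B).
by split=> //; exact: open_fst.
Qed.

Lemma Ck_sub k V W (A B : set V) (f : V -> W) : A `<=` B -> Ck k B f -> Ck k A f.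
Proof.
elim: k V W A B f => [|k IH] V W A B f AB; first by move=> H x /AB/H.
by move=> /CkSP[Hd Ht]; apply/CkSP; split=> [x /AB/Hd//|]; apply: IH Ht => p /AB.
Qed.

Lemma eq_Ck k V W (A : set V) (f g : V -> W) : open A ->
  (forall x, A x -> f x = g x) -> Ck k A f -> Ck k A g.
Proof.
elim: k V W A f g => [|k IH] V W A f g oA fg.
  move=> H x Ax; have nA : \near x, f x = g x.
    by apply: filterS (open_nbhs_nbhs (conj oA Ax)) => y; exact: fg.
  have := H x Ax; rewrite /prop_for /continuous_at -(fg _ Ax) => Hx.
  by apply: cvg_trans Hx; apply: near_eq_cvg; apply: filterS nA => y ->.
move=> /CkSP[Hd Ht].
have nA x : A x -> \near x, f x = g x.
  by move=> Ax; apply: filterS (open_nbhs_nbhs (conj oA Ax)) => y; exact: fg.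
apply/CkSP; split=> [x Ax|]; first by have [] := near_eq_diff (nA x Ax) (Hd x Ax).
apply: IH Ht; first exact: open_fst.
move=> [x w] Ax; congr pair; first exact: fg.
by have [_ E] := near_eq_diff (nA x Ax) (Hd x Ax); exact/esym/(congr1 (@^~ w) E).
Qed.

Lemma Ck_continuous k V W (A : set V) (f : V -> W) : Ck k A f ->
  forall x, A x -> {for x, continuous f}.
Proof.
case: k => [//|k] /CkSP[Hd _] x Ax.
by apply: differentiable_continuous; exact: Hd.
Qed.

Lemma Ck_pred k V W (A : set V) (f : V -> W) : Ck k.+1 A f -> Ck k A f.
Proof.
elim: k V W A f => [|k IH] V W A f; first exact: Ck_continuous.
by move=> /CkSP[Hd Ht]; apply/CkSP; split=> //; exact: IH.
Qed.

Lemma Ck_cst k V W (A : set V) (c : W) : Ck k A (cst c).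
Proof.
elim: k V W A c => [|k IH] V W A c; first by move=> x _; exact: cst_continuous.
apply/CkSP; split=> [x _|]; first exact: differentiable_cst.
rewrite (_ : tmap _ = cst (c, 0)); first exact: IH.
by apply/funext => p; rewrite /tmap diff_cst.
Qed.

Lemma Ck_linear k V W (A : set V) (f : {linear V -> W}) :
  continuous f -> Ck k A f.
Proof.
elim: k V W A f => [|k IH] V W A f fc; first by move=> x _; exact: fc.
apply/CkSP; split=> [x _|]; first exact: linear_differentiable.
pose g p : W * W := (f p.1, f p.2).
have lg : linear g by move=> a [u1 u2] [v1 v2]; rewrite /g /= !linearP.
pose gM := GRing.isLinear.Build _ _ _ _ _ lg.
pose gL : {linear _ -> _} := HB.pack g gM.
rewrite (_ : tmap f = gL).
  apply: IH => p; apply: cvg_pair; apply: continuous_comp; try exact: fc.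
    exact: cvg_fst.
  exact: cvg_snd.
by apply/funext => p; rewrite /tmap diff_lin.
Qed.

Lemma tmap_comp V W Z (f : V -> W) (g : W -> Z) (p : V * V) :
  differentiable f p.1 -> differentiable g (f p.1) ->
  tmap (g \o f) p = tmap g (tmap f p).
Proof. by move=> df dg; rewrite /tmap diff_comp. Qed.

(** By functoriality of the tangent map, the case of order k + 1 for f and g
    is that of order k for their tangent maps. *)
Lemma Ck_comp k V W Z (A : set V) (B : set W) (f : V -> W) (g : W -> Z) :
  open A -> open B -> A `<=` f @^-1` B -> Ck k A f -> Ck k B g ->
  Ck k A (g \o f).
Proof.
elim: k V W Z A B f g => [|k IH] V W Z A B f g oA oB fAB.
  move=> Hf Hg x Ax; apply: continuous_comp; first exact: Hf.
  by apply: Hg; exact: fAB.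
move=> /CkSP[df Tf] /CkSP[dg Tg]; apply/CkSP; split.
  by move=> x Ax; apply: differentiable_comp; [exact: df|apply: dg; exact: fAB].
have := IH _ _ _ _ _ _ _ (open_fst oA) (open_fst oB) _ Tf Tg.
move=> /(_ (fun p (Ap : A p.1) => fAB _ Ap)).
apply: eq_Ck; first exact: open_fst.
by move=> p /= Ap; rewrite tmap_comp//; [exact: df|apply: dg; exact: fAB].
Qed.

Lemma Ck_fst_op k V W (A : set (V * W)) : Ck k A fst.
Proof.
have l : linear (fst : V * W -> V) by [].
pose gM := GRing.isLinear.Build _ _ _ _ _ l.
pose gL : {linear _ -> _} := HB.pack (fst : V * W -> V) gM.
by rewrite (_ : fst = gL)//; apply: Ck_linear => p; exact: cvg_fst.
Qed.

Lemma Ck_snd_op k V W (A : set (V * W)) : Ck k A snd.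
Proof.
have l : linear (snd : V * W -> W) by [].
pose gM := GRing.isLinear.Build _ _ _ _ _ l.
pose gL : {linear _ -> _} := HB.pack (snd : V * W -> W) gM.
by rewrite (_ : snd = gL)//; apply: Ck_linear => p; exact: cvg_snd.
Qed.

Lemma Ck_id k V (A : set V) : Ck k A id.
Proof. by apply: (@Ck_linear _ _ _ _ idfun) => x; exact: cvg_id. Qed.

(** The tangent map of a pair is the pair of the tangent maps, up to a linear
    exchange of the two middle factors. *)
Lemma Ck_pair k V W Z (A : set V) (f : V -> W) (g : V -> Z) : open A ->
  Ck k A f -> Ck k A g -> Ck k A (fun x => (f x, g x)).
Proof.
elim: k V W Z A f g => [|k IH] V W Z A f g oA.
  by move=> Hf Hg x Ax; apply: cvg_pair; [exact: Hf|exact: Hg].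
move=> /CkSP[df Tf] /CkSP[dg Tg]; apply/CkSP; split.
  by move=> x Ax; apply: differentiable_pair; [exact: df|exact: dg].
pose s (q : (W * W) * (Z * Z)) := ((q.1.1, q.2.1), (q.1.2, q.2.2)).
have ls : linear s by [].
pose sM := GRing.isLinear.Build _ _ _ _ _ ls.
pose sL : {linear _ -> _} := HB.pack s sM.
have cs : continuous sL.
  have c1 (A1 B1 A2 B2 : normedModType R) (f1 : A1 -> B1) (f2 : A2 -> B2) :
      continuous f1 -> continuous f2 ->
      continuous (fun q : A1 * A2 => (f1 q.1, f2 q.2)).
    move=> c1 c2 q; apply: cvg_pair; apply: continuous_comp.
    - exact: cvg_fst.
    - exact: c1.
    - exact: cvg_snd.
    - exact: c2.
  have c2 (A1 B1 B2 : normedModType R) (f1 : A1 -> B1) (f2 : A1 -> B2) :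
      continuous f1 -> continuous f2 ->
      continuous (fun q : A1 => (f1 q, f2 q)).
    by move=> c3 c4 q; apply: cvg_pair; [exact: c3|exact: c4].
  change (continuous s); apply: c2; apply: c1 => x;
    by [exact: cvg_fst|exact: cvg_snd].
have /= := @Ck_comp k _ _ _ (fst @^-1` A) setT _ sL (open_fst oA) openT (fun=> fun=> I)
  (IH _ _ _ _ _ _ (open_fst oA) Tf Tg) (@Ck_linear k _ _ setT sL cs).
apply: eq_Ck; first exact: open_fst.
by move=> p /= Ap; rewrite /s /tmap/= diff_pair//; [exact: df|exact: dg].
Qed.

Lemma Ck_on_fst k V W Z (A : set V) (f : V -> W) : open A ->
  Ck k A f -> Ck k (fst @^-1` A) (fun p : V * Z => f p.1).
Proof.
move=> oA Cf.
by have := Ck_comp (open_fst oA) oA (fun=> id) (@Ck_fst_op k V Z _) Cf.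
Qed.

Lemma Ck_fst k V W Z (A : set V) (f : V -> W * Z) : open A ->
  Ck k A f -> Ck k A (fun x => (f x).1).
Proof.
move=> oA Cf.
by have := Ck_comp oA openT (fun=> fun=> I) Cf (@Ck_fst_op k W Z _).
Qed.

Lemma Ck_snd k V W Z (A : set V) (f : V -> W * Z) : open A ->
  Ck k A f -> Ck k A (fun x => (f x).2).
Proof.
move=> oA Cf.
by have := Ck_comp oA openT (fun=> fun=> I) Cf (@Ck_snd_op k W Z _).
Qed.

End DifferentialCalculus.

Arguments Ck : simpl never.

Section CinfCalculus.
Context {R : realType}.
Implicit Types V W Z : normedModType R.

Lemma Ck_add_op k W : Ck k setT (fun p : W * W => p.1 + p.2).
Proof.
pose s (p : W * W) := p.1 + p.2.
have ls : linear s.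
  by move=> a [u1 u2] [v1 v2]; rewrite /s /= scalerDr addrACA.
pose sM := GRing.isLinear.Build _ _ _ _ _ ls.
pose sL : {linear _ -> _} := HB.pack s sM.
rewrite (_ : (fun _ => _) = sL)//; apply: Ck_linear.
by move=> p; apply: cvgD; [exact: cvg_fst|exact: cvg_snd].
Qed.

Lemma Ck_add k V W (A : set V) (f g : V -> W) : open A ->
  Ck k A f -> Ck k A g -> Ck k A (fun x => f x + g x).
Proof.
move=> oA Cf Cg.
exact: (@Ck_comp _ k _ _ _ A setT _ _ oA openT (fun=> fun=> I)
  (Ck_pair oA Cf Cg) (@Ck_add_op k W)).
Qed.

Lemma scale_is_bilinear W :
  bilinear_for
    (GRing.Scale.Law.clone _ _ *:%R _) (GRing.Scale.Law.clone _ _ *:%R _)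
    (@GRing.scale R W).
Proof.
by split=> [u'|u] a x y /=; rewrite ?scalerDl ?scalerDr ?scalerA // mulrC.
Qed.

Lemma diff_scale W (p : R * W) :
  differentiable (fun q : R * W => q.1 *: q.2) p /\
  forall q, 'd (fun q : R * W => q.1 *: q.2) p q = p.1 *: q.2 + q.1 *: p.2.
Proof.
pose bM := bilinear_isBilinear.Build _ _ _ _ _ _ _ (@scale_is_bilinear W).
pose b : {bilinear _ -> _ -> _} := HB.pack (@GRing.scale R W) bM.
have bc : continuous (fun q : R * W => b q.1 q.2).
  by move=> q; apply: cvgZ; [exact: cvg_fst|exact: cvg_snd].
split; first exact: (@differentiable_bilin _ _ _ _ b).
by move=> q; rewrite (@diff_bilin _ _ _ _ b).
Qed.

(** The product rule expresses the tangent map of a product by products of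
    components of tangent maps, to which the induction hypothesis applies. *)
Lemma Ck_scale k V W (A : set V) (a : V -> R) (f : V -> W) : open A ->
  Ck k A a -> Ck k A f -> Ck k A (fun x => a x *: f x).
Proof.
elim: k V W A a f => [|k IH] V W A a f oA.
  by move=> Ca Cf x Ax; apply: cvgZ; [exact: Ca|exact: Cf].
move=> /CkSP[da Ta] /CkSP[df Tf]; have oA1 := @open_fst _ _ V _ oA.
have D x : A x -> differentiable (fun x => a x *: f x) x /\
    forall w, 'd (fun x => a x *: f x) x w = a x *: 'd f x w + 'd a x w *: f x.
  move=> Ax; have dp := differentiable_pair (da _ Ax) (df _ Ax).
  have [ds Es] := diff_scale (a x, f x); split.
    exact: (differentiable_comp dp ds).
  move=> w; have := diff_comp dp ds => /(congr1 (@^~ w)) /= ->.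
  by rewrite Es /= diff_pair//; [exact: da|exact: df].
apply/CkSP; split; first by move=> x /D[].
have C1 := Ck_fst oA1 Tf; have C2 := Ck_snd oA1 Tf.
have D1 := Ck_fst oA1 Ta; have D2 := Ck_snd oA1 Ta.
have := Ck_pair oA1 (IH _ _ _ _ _ oA1 D1 C1)
  (Ck_add oA1 (IH _ _ _ _ _ oA1 D1 C2) (IH _ _ _ _ _ oA1 D2 C1)).
apply: eq_Ck => // p Ap; congr pair.
by have [_ ->] := D _ Ap.
Qed.

Lemma Ck_mul k V (A : set V) (a b : V -> R) : open A ->
  Ck k A a -> Ck k A b -> Ck k A (fun x => a x * b x).
Proof. exact: Ck_scale. Qed.

Lemma Ck_opp k V W (A : set V) (f : V -> W) : open A ->
  Ck k A f -> Ck k A (fun x => - f x).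
Proof.
move=> oA Cf; have c1 : Ck k A (fun=> -1 : R) by exact: Ck_cst.
have := Ck_scale oA c1 Cf.
by apply: eq_Ck => // x _; rewrite scaleN1r.
Qed.

Lemma Ck_sub_fun k V W (A : set V) (f g : V -> W) : open A ->
  Ck k A f -> Ck k A g -> Ck k A (fun x => f x - g x).
Proof. by move=> oA Cf Cg; apply: Ck_add => //; exact: Ck_opp. Qed.

Lemma Ck_sum k V W (A : set V) I (r : seq I) (P : pred I) (f : I -> V -> W) :
  open A -> (forall i, Ck k A (f i)) ->
  Ck k A (fun x => \sum_(i <- r | P i) f i x).
Proof.
move=> oA Cf; elim: r => [|i r IH].
  by apply: eq_Ck (@Ck_cst _ k _ _ A 0) => // x _; rewrite big_nil.
have : Ck k A (fun x => (if P i then f i x else 0) +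
   \sum_(j <- r | P j) f j x).
  by apply: Ck_add => //; case: (P i); [exact: Cf|exact: Ck_cst].
by apply: eq_Ck => // x _; rewrite big_cons; case: (P i); rewrite ?add0r.
Qed.

Lemma Ck_prod k V (A : set V) I (r : seq I) (P : pred I) (f : I -> V -> R) :
  open A -> (forall i, Ck k A (f i)) ->
  Ck k A (fun x => \prod_(i <- r | P i) f i x).
Proof.
move=> oA Cf; elim: r => [|i r IH].
  have c1 : Ck k A (fun=> 1 : R) by exact: Ck_cst.
  by apply: eq_Ck c1 => // x _; rewrite big_nil.
have : Ck k A (fun x => (if P i then f i x else 1) *
   \prod_(j <- r | P j) f j x).
  by apply: Ck_mul => //; case: (P i); [exact: Cf|exact: Ck_cst].
by apply: eq_Ck => // x _; rewrite big_cons; case: (P i); rewrite ?mul1r.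
Qed.

Lemma Ck_coord k V m n (A : set V) (f : V -> 'M[R]_(m, n)) i j : open A ->
  Ck k A f -> Ck k A (fun x => f x i j).
Proof.
move=> oA Cf; pose s (N : 'M[R]_(m, n)) : R := N i j.
have ls : linear s by move=> a u v; rewrite /s !mxE.
pose sM := GRing.isLinear.Build _ _ _ _ _ ls.
pose sL : {linear _ -> _} := HB.pack s sM.
apply: (Ck_comp oA openT (fun=> fun=> I) Cf (@Ck_linear _ k _ _ setT sL _)).
exact: coord_continuous.
Qed.

Lemma Ck_mx k V m n (A : set V) (f : V -> 'M[R]_(m, n)) : open A ->
  (forall i j, Ck k A (fun x => f x i j)) -> Ck k A f.
Proof.
move=> oA Cf.
have : Ck k A (fun x => \sum_i \sum_j f x i j *: delta_mx i j).
  apply: Ck_sum => // i; apply: Ck_sum => // j.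
  by apply: Ck_scale => //; exact: Ck_cst.
by apply: eq_Ck => // x _; rewrite [RHS]matrix_sum_delta.
Qed.

(** If the differential of f is a smooth expression of the point, the
    direction and the value of f, then f gains one order of differentiability
    from each order it already has. This settles inverses, square roots and
    solutions of autonomous equations on the line. *)
Lemma Cinf_bootstrap V W (A : set V) (f : V -> W) (B : set ((V * V) * W))
    (H : (V * V) * W -> W) : open A -> open B -> Cinf B H ->
  (forall x, A x -> differentiable f x /\ forall w,
     B ((x, w), f x) /\ 'd f x w = H ((x, w), f x)) -> Cinf A f.
Proof.
move=> oA oB CH Hf; elim=> [|k IH].
  by move=> x /Hf[df _]; exact: differentiable_continuous.
apply/CkSP; split; first by move=> x /Hf[].
have oA1 := @open_fst _ _ V _ oA; have C1 := Ck_on_fst V oA IH.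
have AB : fst @^-1` A `<=` (fun p : V * V => (id p, f p.1)) @^-1` B.
  by move=> [x w] /= /Hf [_ /(_ w) []].
have := Ck_pair oA1 C1 (Ck_comp oA1 oB AB
  (Ck_pair oA1 (@Ck_id _ k _ _) C1) (CH k)).
apply: eq_Ck => // -[x w] /= /Hf [_ /(_ w)[_ e]]; congr pair.
by rewrite -e.
Qed.

Lemma open_neq0 : open [set x : R | x != 0].
Proof. exact: open_neq. Qed.

Lemma Cinf_inv : Cinf [set x : R | x != 0] (fun x => x^-1).
Proof.
apply: (@Cinf_bootstrap R R _ _ setT (fun q => - (q.2 * q.2 * q.1.2))).
- exact: open_neq0.
- exact: openT.
- move=> k; apply: Ck_opp; first exact: openT.
  apply: Ck_mul; first exact: openT.
    by apply: Ck_mul; [exact: openT| |]; exact: Ck_snd_op.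
  by apply: Ck_snd; [exact: openT|exact: Ck_fst_op].
- move=> x x0; split; first exact: differentiable_Rinv.
  move=> w; split=> //.
  rewrite diff_Rinv//=.
  by rewrite -expr2 exprVn /GRing.scale /=; ring.
Qed.

Lemma Ck_inv k V (A : set V) (f : V -> R) : open A ->
  (forall x, A x -> f x != 0) -> Ck k A f -> Ck k A (fun x => (f x)^-1).
Proof.
move=> oA f0 Cf.
exact: (Ck_comp oA open_neq0 f0 Cf (Cinf_inv k)).
Qed.

Lemma Cinf_sqrt : Cinf [set x : R | 0 < x] Num.sqrt.
Proof.
pose B := (fun q : (R * R) * R => q.2) @^-1` [set x : R | x != 0].
have oB : open B.
  by apply: open_comp; [move=> q _; exact: cvg_snd|exact: open_neq0].
apply: (@Cinf_bootstrap R R _ _ B (fun q => q.1.2 * (2 * q.2)^-1)).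
- exact: open_gt.
- exact: oB.
- move=> k; apply: Ck_mul => //.
    by apply: Ck_snd => //; exact: Ck_fst_op.
  apply: Ck_inv => //; first by move=> q /= q0; rewrite mulf_neq0.
  by apply: Ck_mul => //; [exact: Ck_cst|exact: Ck_snd_op].
- move=> x x0; have [d e] := is_derive_diff (is_derive1_sqrt x0).
  split=> // w; split; last by rewrite e.
  by rewrite /B /= sqrtr_eq0 -ltNge.
Qed.

Lemma Ck_sqrt k V (A : set V) (f : V -> R) : open A ->
  (forall x, A x -> 0 < f x) -> Ck k A f -> Ck k A (fun x => Num.sqrt (f x)).
Proof.
move=> oA f0 Cf.
exact: (Ck_comp oA (@open_gt _ 0) f0 Cf (Cinf_sqrt k)).
Qed.

Lemma Ck_det k V n (A : set V) (f : V -> 'M[R]_n) : open A ->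
  Ck k A f -> Ck k A (fun x => \det (f x)).
Proof.
move=> oA Cf; rewrite /determinant; apply: Ck_sum => // s.
apply: Ck_mul => //; first exact: Ck_cst.
by apply: Ck_prod => // i; exact: Ck_coord.
Qed.

Lemma Ck_mulmx k V m n p (A : set V) (f : V -> 'M[R]_(m, n))
    (g : V -> 'M[R]_(n, p)) : open A ->
  Ck k A f -> Ck k A g -> Ck k A (fun x => f x *m g x).
Proof.
move=> oA Cf Cg; apply: Ck_mx => // i j.
have : Ck k A (fun x => \sum_l f x i l * g x l j).
  by apply: Ck_sum => // l; apply: Ck_mul => //; exact: Ck_coord.
by apply: eq_Ck => // x _; rewrite mxE.
Qed.

(** Cramer's rule. *)
Lemma Ck_invmx k V n (A : set V) (f : V -> 'M[R]_n) : open A ->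
  (forall x, A x -> f x \in unitmx) ->
  Ck k A f -> Ck k A (fun x => invmx (f x)).
Proof.
move=> oA fu Cf; apply: Ck_mx => // i j.
have : Ck k A (fun x => (\det (f x))^-1 *
    ((-1) ^+ (j + i) * \det (row' j (col' i (f x))))).
  apply: Ck_mul => //.
    apply: Ck_inv => //; last exact: Ck_det.
    by move=> x /fu; rewrite unitmxE unitfE.
  apply: Ck_mul => //; first exact: Ck_cst.
  apply: Ck_det => //; apply: Ck_mx => // a b.
  have := Ck_coord (lift j a) (lift i b) oA Cf.
  by apply: eq_Ck => // x _; rewrite !mxE.
by apply: eq_Ck => // x /fu fx; rewrite /invmx fx !mxE.
Qed.

Lemma Cinf_iter_derive V W (A : set V) (f : V -> W) s : open A ->
  Cinf A f -> Cinf A (iter_derive s f).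
Proof.
move=> oA Cf; elim: s => [//|v s IH] k /=.
have /CkSP[dh Th] := IH k.+1.
have : Ck k A (fun x => (tmap (iter_derive s f) (x, v)).2).
  apply: Ck_snd => //.
  have Cv : Ck k A (fun x => (x, v)).
    by apply: Ck_pair => //; [exact: Ck_id|exact: Ck_cst].
  have AB : A `<=` (fun x => (x, v)) @^-1` (fst @^-1` A) by [].
  by have := Ck_comp oA (open_fst oA) AB Cv Th.
by apply: eq_Ck => // x Ax /=; rewrite deriveE//; exact: dh.
Qed.

Lemma Cinf_smooth_on V W (A : set V) (f : V -> W) : open A ->
  Cinf A f -> smooth_on A f.
Proof.
by move=> oA Cf s x Ax; have /CkSP[+ _] := Cinf_iter_derive s oA Cf 1%N; exact.
Qed.

Lemma diff_delta n W (f : 'rV[R]_n -> W) x w :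
  'd f x w = \sum_i w 0 i *: 'd f x (delta_mx 0 i).
Proof.
by rewrite [in LHS](row_sum_delta w) linear_sum; under eq_bigr do rewrite linearZ.
Qed.

(** In finite dimension the tangent map is determined by the partial
    derivatives, so iterated directional derivatives suffice. *)
Lemma smooth_on_Cinf n W (A : set 'rV[R]_n) (f : 'rV[R]_n -> W) : open A ->
  smooth_on A f -> Cinf A f.
Proof.
move=> oA Sf k; elim: k f Sf => [|k IH] f Sf.
  by move=> x Ax; apply: differentiable_continuous; exact: (Sf [::]).
have df x : A x -> differentiable f x by exact: (Sf [::]).
apply/CkSP; split=> //.
have oA1 := @open_fst _ _ 'rV[R]_n _ oA.
have := Ck_pair oA1 (Ck_on_fst _ oA (IH _ Sf))
  (@Ck_sum k _ _ _ _ (index_enum 'I_n) xpredT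
  (fun i (p : 'rV[R]_n * 'rV[R]_n) =>
    p.2 0 i *: 'D_(delta_mx 0 i) f p.1) oA1 _).
move=> /(_ _)/wrap[].
  move=> i; apply: Ck_scale => //; first by apply: Ck_coord => //; exact: Ck_snd_op.
  apply: (@Ck_on_fst _ k _ _ _ A ('D_(delta_mx 0 i) f)) => //; apply: IH => s; have := Sf (rcons s (delta_mx 0 i)).
  by rewrite /iter_derive -cats1 foldr_cat.
apply: eq_Ck => // -[x w] /= Ax; congr pair.
by rewrite [RHS]diff_delta; apply: eq_bigr => i _; rewrite deriveE//; exact: df.
Qed.

End CinfCalculus.

(** * Mean value inequalities *)

Section MeanValue.
Context {R : realType}.
Implicit Types V W : normedModType R.

Lemma nearP V (x : V) (P : set V) :
  (\forall y \near x, P y) <->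
  exists2 r : R, 0 < r & forall y, `|y - x| < r -> P y.
Proof.
split=> [/nbhs_normP[r /= r0 H]|[r r0 H]].
  by exists r => // y yx; apply: H; rewrite /= distrC.
by apply/nbhs_normP; exists r => // y /=; rewrite distrC => /H.
Qed.

Lemma is_derive_near V (d : R -> V) (t : R) (D : V) : is_derive t 1 d D ->
  forall e : R, 0 < e -> exists2 r : R, 0 < r & forall s, `|s - t| < r ->
    `|d s - d t - (s - t) *: D| <= e * `|s - t|.
Proof.
move=> /is_derive_diff[dd E] e e0.
have /nearP[r r0 H] := diff_epsilon dd e0.
exists r => // s st; have := H (s - t); rewrite subr0 E (addrC t) subrK.
exact.
Qed.

Lemma near_is_derive V (d : R -> V) (t : R) (D : V) :
  (forall e : R, 0 < e -> exists2 r : R, 0 < r & forall s, `|s - t| < r ->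
    `|d s - d t - (s - t) *: D| <= e * `|s - t|) -> is_derive t 1 d D.
Proof.
move=> H; pose l (h : R) := h *: D.
have ll : linear l by move=> a u v; rewrite /l scalerDl scalerA.
pose lM := GRing.isLinear.Build _ _ _ _ _ ll.
pose L : {linear _ -> _} := HB.pack l lM.
have [|e e0|dd E] := @is_diff_epsilon _ _ _ d t L.
- exact: scalel_continuous.
- have [r r0 {}H] := H e e0; apply/nearP; exists r => // h.
  by rewrite subr0 => hr; have := H (t + h); rewrite (addrC t) addrK; exact.
- by have := @diff_is_derive R R V d t (1 : R) dd; rewrite E /= /l scale1r.
Qed.

Lemma is_derive_line V W (f : V -> W) (x v : V) (s : R) :
  differentiable f (x + s *: v) ->
  is_derive s 1 (fun s => f (x + s *: v)) ('d f (x + s *: v) v).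
Proof.
move=> df; apply: near_is_derive => e e0.
have e1 : 0 < e / (`|v| + 1) by rewrite divr_gt0// ltr_wpDl.
have /nearP[r r0 H] := diff_epsilon df e1.
exists (r / (`|v| + 1)); first by rewrite divr_gt0// ltr_wpDl.
move=> u us; have := H ((u - s) *: v).
have -> : x + s *: v + (u - s) *: v = x + u *: v.
  by rewrite -addrA -scalerDl (addrC s) subrK.
rewrite subr0 linearZ normrZ.
have v1 : 0 < `|v| + 1 by rewrite ltr_wpDl.
move=> {}H; apply: le_trans (H _) _.
  apply: le_lt_trans (_ : `|u - s| * (`|v| + 1) < r).
    by rewrite ler_wpM2l// lerDl.
  by rewrite -ltr_pdivlMr.
rewrite mulrAC -mulrA ler_wpM2l ?(ltW e0)// [leLHS]mulrC [leLHS]mulrCA.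
rewrite ler_piMr// ler_pdivrMl// mulr1 lerDl//.
Qed.

Lemma is_derive_cont V (d : R -> V) (t : R) D :
  is_derive t 1 d D -> {for t, continuous d}.
Proof. by move=> /is_derive_diff[dd _]; exact: differentiable_continuous. Qed.

(** A barrier argument playing the role of Gronwall's inequality: at the first
    time where the norm of d meets u, it would have to grow at least as fast
    as u. *)
Lemma norm_barrier V (d d' : R -> V) (u u' : R -> R) (T : R) :
  (forall t : R, 0 <= t <= T -> is_derive t 1 d (d' t)) ->
  (forall t : R, 0 <= t <= T -> is_derive t 1 u (u' t)) ->
  `|d 0| < u 0 ->
  (forall t : R, 0 <= t <= T -> `|d t| = u t -> `|d' t| < u' t) ->
  forall t : R, 0 <= t <= T -> `|d t| < u t.
Proof.
move=> Dd Du d0 H t1 t1T; rewrite ltNge; apply/negP => ut1.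
(* s is the first time of contact. *)
pose S := [set t | 0 <= t <= T /\ u t <= `|d t|].
have hS : has_inf S.
  by split; [exists t1|exists 0 => t [/andP[]]].
set s := inf S.
have lbS t : S t -> s <= t by move=> St; apply: ge_inf => //; case: hS.
have s0 : 0 <= s by apply: lb_le_inf; [case: hS|move=> t [/andP[]]].
have sT : 0 <= s <= T.
  by rewrite s0/= (le_trans (lbS t1 _))//; case/andP: t1T.
have cd : {for s, continuous (fun t => u t - `|d t|)}.
  apply: cvgB; first exact: is_derive_cont (Du _ sT).
  apply: cvg_norm; exact: is_derive_cont (Dd _ sT).
have us : u s <= `|d s|.
  rewrite leNgt; apply/negP => ds.
  have : \forall t \near s, 0 < u t - `|d t|.
    by apply: (cvgr_gt _ cd); rewrite subr_gt0.
  move=> /nearP[r r0 Hr].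
  have [t St ts] := inf_adherent r0 hS.
  have /Hr : `|t - s| < r.
    by rewrite ger0_norm ?subr_ge0 ?lbS// ltrBlDl.
  by rewrite subr_gt0 ltNge; case: St => _ ->.
have s1 : 0 < s.
  rewrite lt_neqAle s0 andbT; apply/eqP => s00; move: us; rewrite -s00 leNgt.
  by rewrite d0.
have lt t : 0 <= t -> t < s -> `|d t| < u t.
  move=> t0 ts; rewrite ltNge; apply/negP => h.
  suff /lbS : S t by rewrite leNgt ts.
  split=> //; rewrite t0/= (ltW (lt_le_trans ts _))//.
  by case/andP: sT.
have eqs : `|d s| = u s.
  apply/eqP; rewrite eq_le us andbT leNgt; apply/negP => ds.
  have : \forall t \near s, u t - `|d t| < 0.
    by apply: (cvgr_lt _ cd); rewrite subr_lt0.
  move=> /nearP[r r0 Hr].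
  pose h := Num.min (r / 2) s.
  have h0 : 0 < h by rewrite lt_min s1 divr_gt0.
  have hs : h <= s by rewrite ge_min lexx orbT.
  have hr : h < r by rewrite gt_min ltr_pdivrMr// mulr_natr mulr2n ltrDl r0.
  have := Hr (s - h); rewrite addrAC subrr sub0r normrN gtr0_norm// => /(_ hr).
  apply/negP; rewrite -leNgt subr_ge0 ltW// lt ?subr_ge0//.
  by rewrite ltrBlDr ltrDl.
have Hs := H s sT eqs.
(* With derivatives at s known up to e, going back from s by h changes u by
   more than |d| can change; hence contact occurred earlier. *)
pose e := (u' s - `|d' s|) / 3.
have e0 : 0 < e by rewrite divr_gt0// subr_gt0.
have [r1 r10 H1] := is_derive_near (Dd s sT) e0.
have [r2 r20 H2] := is_derive_near (Du s sT) e0.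
pose h := Num.min (Num.min (r1 / 2) (r2 / 2)) s.
have h0 : 0 < h by rewrite !lt_min s1 !divr_gt0.
have hs : h <= s by rewrite ge_min lexx orbT.
have hr1 : h < r1.
  apply: le_lt_trans (_ : r1 / 2 < r1); first by rewrite !ge_min lexx.
  by rewrite ltr_pdivrMr// mulr_natr mulr2n ltrDl.
have hr2 : h < r2.
  apply: le_lt_trans (_ : r2 / 2 < r2); first by rewrite !ge_min lexx orbT.
  by rewrite ltr_pdivrMr// mulr_natr mulr2n ltrDl.
have E : s - h - s = - h by rewrite addrAC subrr sub0r.
have := H1 (s - h); rewrite E normrN gtr0_norm// => /(_ hr1) {}H1.
have := H2 (s - h); rewrite E normrN gtr0_norm// => /(_ hr2) {}H2.
have := lt (s - h); rewrite subr_ge0 => /(_ hs); rewrite ltrBlDr ltrDl => /(_ h0).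
have A1 : `|d s| <= `|d (s - h)| + h * `|d' s| + e * h.
  have -> : d s = d (s - h) - (d (s - h) - d s - - h *: d' s) + h *: d' s.
    rewrite scaleNr opprK opprD addrA addrNK opprB.
    by rewrite addrC subrK.
  rewrite [leRHS]addrAC.
  apply: le_trans (ler_normD _ _) _; rewrite normrZ gtr0_norm// lerD2r.
  by apply: le_trans (ler_normB _ _) _; rewrite lerD2l.
have A2 : u (s - h) <= u s - h * u' s + e * h.
  have := ler_norml (u (s - h) - u s - - h *: u' s) (e * h).
  rewrite H2 => /esym/andP[_]; rewrite /GRing.scale/=; lra.
rewrite ltNge => /negP; apply.
have : u' s - `|d' s| = 3 * e by rewrite /e; field.
move: A1 A2; rewrite eqs => A1 A2 E3.
have E4 : u' s = `|d' s| + 3 * e by lra.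
have eh : 0 < e * h by rewrite mulr_gt0.
by move: A1 A2; rewrite E4; lra.
Qed.

Lemma is_derive_affine (a k t : R) : is_derive t 1 (fun t => a + k * t) k.
Proof.
apply: near_is_derive => e e0; exists 1 => // s _.
rewrite (_ : _ - _ - _ = 0) ?normr0 ?mulr_ge0 ?(ltW e0)//.
by rewrite /GRing.scale /=; ring.
Qed.

(** The barrier is the affine function of slope K + eta starting at eta, for
    arbitrarily small eta. *)
Lemma mean_value_le V (d d' : R -> V) (T K : R) :
  (forall t : R, 0 <= t <= T -> is_derive t 1 d (d' t)) ->
  (forall t : R, 0 <= t <= T -> `|d' t| <= K) ->
  forall t : R, 0 <= t <= T -> `|d t - d 0| <= K * t.
Proof.
move=> Dd dK t tT; apply/ler_addgt0Pr => e e0.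
have T0 : 0 <= T by case/andP: tT => /le_trans; exact.
pose eta := e / (T + 1).
have eta0 : 0 < eta by rewrite divr_gt0// ltr_wpDl.
have := @norm_barrier V (fun t => d t - d 0) d' (fun t => eta + (K + eta) * t)
  (fun=> K + eta) T _ _ _ _ t tT.
move=> /(_ _ _ _ _)/wrap[||||].
- by move=> s sT; have := Dd s sT; move=> ?; rewrite -[d' s]subr0; apply: is_deriveB.
- by move=> s _; exact: is_derive_affine.
- by rewrite subrr normr0 mulr0 addr0.
- by move=> s sT _; apply: le_lt_trans (dK s sT) _; rewrite ltrDl.
move=> /ltW/le_trans; apply.
rewrite mulrDl addrCA lerD2l.
case/andP: tT => t0 tT; rewrite -[X in X + _]mulr1 -mulrDr /eta mulrAC.
by rewrite ler_pdivrMr ?ltr_wpDl// ler_pM2l// addrC lerD2r.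
Qed.

Lemma segment_mean_value_le V W (f : V -> W) (x v : V) (K : R) :
  (forall s : R, 0 <= s <= 1 -> differentiable f (x + s *: v)) ->
  (forall s : R, 0 <= s <= 1 -> `|'d f (x + s *: v) v| <= K) ->
  `|f (x + v) - f x| <= K.
Proof.
move=> df dK.
have := @mean_value_le W (fun s => f (x + s *: v))
  (fun s => 'd f (x + s *: v) v) 1 K.
move=> /(_ (fun s sT => is_derive_line (df s sT)) dK 1).
by rewrite ler01 lexx /= mulr1 scale1r scale0r addr0 => /(_ isT).
Qed.

Lemma ball_segment V (p x v : V) (r s : R) : `|x - p| < r -> `|x + v - p| < r ->
  0 <= s <= 1 -> `|x + s *: v - p| < r.
Proof.
move=> h1 h2 /andP[s0 s1].
have -> : x + s *: v - p = (1 - s) *: (x - p) + s *: (x + v - p).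
  by rewrite scalerBl scale1r (addrAC x v) (scalerDr s (x - p)) addrA subrK addrAC.
apply: le_lt_trans (ler_normD _ _) _; rewrite !normrZ ger0_norm ?subr_ge0//.
rewrite (ger0_norm s0); have [->|sn0] := eqVneq s 0.
  by rewrite subr0 mul1r mul0r addr0.
have : s * `|x + v - p| < s * r by rewrite ltr_pM2l// lt_neqAle eq_sym sn0.
have : (1 - s) * `|x - p| <= (1 - s) * r by rewrite ler_wpM2l ?subr_ge0// ltW.
by lra.
Qed.

(** Continuity of the tangent map at (p, 0) bounds the differential uniformly
    near p, which requires no operator norm; the mean value inequality does
    the rest. *)
Lemma C1_locally_lipschitz V W (A : set V) (f : V -> W) (p : V) :
  open A -> Ck 1 A f -> A p -> exists r L : R, [/\ 0 < r, 0 < L,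
    (forall z, `|z - p| < r -> A z /\ forall w, `|'d f z w| <= L * `|w|) &
    forall y z, `|y - p| < r -> `|z - p| < r -> `|f y - f z| <= L * `|y - z|].
Proof.
move=> oA /CkSP[df Tf] Ap.
have /nearP[r1 r10 H1] := open_nbhs_nbhs (conj oA Ap).
have /(@cvgrPdist_lt _ _ _ _ _)/(_ 1 ltr01) := Tf (p, 0) Ap.
move=> /nearP[r2 r20 H2].
pose r := Num.min r1 r2; have r0 : 0 < r by rewrite lt_min r10.
have rr1 z : z < r -> z < r1 by rewrite lt_min => /andP[].
have rr2 z : z < r -> z < r2 by rewrite lt_min => /andP[].
have L0 : 0 < 2 / r2 by rewrite divr_gt0.
have Hd z : `|z - p| < r -> forall w, `|'d f z w| <= 2 / r2 * `|w|.
  move=> zp w; have [->|w0] := eqVneq w 0; first by rewrite linear0 !normr0 mulr0.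
  have nw : 0 < `|w| by rewrite normr_gt0.
  have := H2 (z, (r2 / 2 / `|w|) *: w).
  have -> : `|(z, (r2 / 2 / `|w|) *: w) - (p, 0)| =
      Num.max `|z - p| `|(r2 / 2 / `|w|) *: w| by rewrite -[in RHS](subr0 (_ *: w)).
  rewrite normrZ gtr0_norm ?divr_gt0// divfK ?gt_eqF// gt_max rr2//=.
  rewrite ltr_pdivrMr// mulr_natr mulr2n ltrDl r20 => /(_ isT).
  rewrite distrC.
  have -> : tmap f (z, (r2 / 2 / `|w|) *: w) - tmap f (p, 0) =
     (f z - f p, (r2 / 2 / `|w|) *: 'd f z w).
    by rewrite /tmap /= linearZ linear0 /=; congr pair; rewrite subr0.
  rewrite prod_normE /= gt_max => /andP[_].
  rewrite normrZ gtr0_norm ?divr_gt0// => /ltW.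
  by rewrite mulrAC ler_pdivrMr// mul1r -ler_pdivlMl ?divr_gt0// invf_div.
exists r, (2 / r2); split=> //; first by move=> z zp; split; [exact/H1/rr1|exact: Hd].
move=> y z yp zp; have := @segment_mean_value_le V W f z (y - z) (2 / r2 * `|y - z|).
rewrite (addrC z) subrK; apply=> s s01.
  by apply/df/H1/rr1; apply: ball_segment => //; rewrite (addrC z) subrK.
by apply: Hd; apply: ball_segment => //; rewrite (addrC z) subrK.
Qed.

(** The tangent map is locally Lipschitz, hence so is the differential, and
    the mean value inequality applies to f minus its linear part at z. *)
Lemma C2_locally_quadratic V W (A : set V) (f : V -> W) (p : V) :
  open A -> Ck 2 A f -> A p -> exists r L : R, [/\ 0 < r, 0 < L,
    (forall z, `|z - p| < r -> A z /\ forall w, `|'d f z w| <= L * `|w|) &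
    forall y z, `|y - p| < r -> `|z - p| < r ->
      `|f y - f z - 'd f z (y - z)| <= L * `|y - z| ^+ 2].
Proof.
move=> oA C2f Ap; have [r1 [L1 [r10 L10 H1 _]]] := C1_locally_lipschitz oA (Ck_pred C2f) Ap.
have /CkSP[df Tf] := C2f.
have [r2 [L2 [r20 L20 _ H2]]] := C1_locally_lipschitz (@open_fst _ _ V _ oA) Tf (Ap : (fst @^-1` A) (p, 0)).
pose r := Num.min r1 r2; have r0 : 0 < r by rewrite lt_min r10.
have rr1 z : z < r -> z < r1 by rewrite lt_min => /andP[].
have rr2 z : z < r -> z < r2 by rewrite lt_min => /andP[].
have L3 : 0 < 2 * L2 / r2 by rewrite divr_gt0// mulr_gt0.
have Hd z z' : `|z - p| < r -> `|z' - p| < r -> forall w,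
    `|'d f z w - 'd f z' w| <= 2 * L2 / r2 * `|z - z'| * `|w|.
  move=> zp zp' w; have [->|w0] := eqVneq w 0.
    have -> : 'd f z 0 - 'd f z' 0 = 0 by rewrite !linear0 addr0.
    by rewrite !normr0 mulr0.
  have nw : 0 < `|w| by rewrite normr_gt0.
  pose a := r2 / 2 / `|w|; have a0 : 0 < a by rewrite !divr_gt0.
  have aw : `|a *: w| < r2.
    rewrite normrZ gtr0_norm// /a divfK ?gt_eqF//.
    by rewrite ltr_pdivrMr// mulr_natr mulr2n ltrDl r20.
  have N u : `|u - p| < r -> `|(u, a *: w) - (p, 0)| < r2.
    move=> up; have -> : `|(u, a *: w) - (p, 0)| = Num.max `|u - p| `|a *: w|.
      by rewrite -[in RHS](subr0 (a *: w)).
    by rewrite gt_max aw rr2.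
  have := H2 _ _ (N z zp) (N z' zp').
  have -> : tmap f (z, a *: w) - tmap f (z', a *: w) =
     (f z - f z', a *: ('d f z w - 'd f z' w)).
    by rewrite /tmap /= !linearZ /= scalerBr.
  have -> : (z, a *: w) - (z', a *: w) = (z - z', 0).
    by congr pair; rewrite subrr.
  rewrite !prod_normE /= normr0 (max_l (normr_ge0 _)) ge_max => /andP[_].
  rewrite normrZ gtr0_norm// -ler_pdivlMl// /a invf_div => /le_trans; apply.
  rewrite le_eqVlt; apply/orP; left; apply/eqP; rewrite invf_div; field.
  by rewrite gt_eqF.
exists r, (Num.max L1 (2 * L2 / r2)); split=> //.
- by rewrite lt_max L10.
- move=> z zp; have [Az Hz] := H1 z (rr1 _ zp); split=> // w.
  by apply: le_trans (Hz w) _; rewrite ler_wpM2r// le_max lexx.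
move=> y z yp zp.
pose g u := f u - 'd f z u.
have dg u : `|u - p| < r -> differentiable g u /\ forall w, 'd g u w = 'd f u w - 'd f z w.
  move=> up; have [Au _] := H1 u (rr1 _ up); have [Az _] := H1 z (rr1 _ zp).
  have fz : continuous ('d f z) by apply: diff_continuous; exact: df.
  have dl : differentiable ('d f z) u by exact: linear_differentiable.
  split; first exact: (differentiableB (df u Au) dl).
  move=> w; have E : 'd g u = 'd f u \- 'd ('d f z) u :> (V -> W).
    exact: (diffB (df u Au) dl).
  apply: etrans (congr1 (@^~ w) E) _; congr (_ - _).
  exact: (congr1 (@^~ w) (diff_lin u fz)).
have := @segment_mean_value_le V W g z (y - z) (Num.max L1 (2 * L2 / r2) * `|y - z| ^+ 2).
rewrite (addrC z) subrK => Hmv.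
have -> : f y - f z - 'd f z (y - z) = g y - g z.
  by rewrite /g linearB !opprD !opprK addrACA.
have seg s : 0 <= s <= 1 -> `|z + s *: (y - z) - p| < r.
  by move=> s01; apply: ball_segment => //; rewrite (addrC z) subrK.
apply: Hmv => s s01; first by have [] := dg _ (seg s s01).
have [_ ->] := dg _ (seg s s01).
apply: le_trans (Hd _ _ (seg s s01) zp _) _.
rewrite addrAC subrr add0r normrZ; case/andP: s01 => s0 s1.
rewrite (ger0_norm s0) expr2 !mulrA ler_wpM2r// ler_wpM2r//.
apply: (@le_trans _ _ (2 * L2 / r2)); last by rewrite le_max lexx orbT.
by rewrite ler_piMr// ltW.
Qed.

End MeanValue.

(** * Differentiability of approximately linear maps *)

Section ApproximateLinearity.
Context {R : realType}.

Lemma le0_small (x Q del : R) : 0 < del -> 0 <= Q ->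
  (forall h, 0 < h -> h < del -> x <= h * Q) -> x <= 0.
Proof.
move=> del0 Q0 H; apply/ler_addgt0Pr => e e0; rewrite add0r.
pose h := Num.min (del / 2) (e / (Q + 1)).
have Q1 : 0 < Q + 1 by rewrite ltr_wpDl.
have h0 : 0 < h by rewrite lt_min !divr_gt0.
have h1 : h < del.
  apply: le_lt_trans (_ : del / 2 < _); first by rewrite ge_min lexx.
  by rewrite ltr_pdivrMr// mulr_natr mulr2n ltrDl.
apply: le_trans (H h h0 h1) _.
apply: (@le_trans _ _ (e / (Q + 1) * Q)).
  by rewrite ler_wpM2r// ge_min lexx orbT.
by rewrite mulrAC ler_pdivrMr// ler_pM2l// lerDl.
Qed.

(** Linear up to a quadratic error, stated for three vectors in linear
    dependence: this covers additivity and homogeneity at once, and a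
    difference of flow lines satisfies it without any candidate for the
    differential. *)
Definition approx_linear (V W : normedModType R) (d : V -> W) (eta C : R) :=
  forall (a b c : R) (u v w : V), `|u| < eta -> `|v| < eta -> `|w| < eta ->
    a *: u + b *: v + c *: w = 0 ->
    `|a *: d u + b *: d v + c *: d w| <=
      C * (`|a| * `|u| ^+ 2 + `|b| * `|v| ^+ 2 + `|c| * `|w| ^+ 2).

(** A predicate rather than a structure: the induction on the order of
    differentiability replaces V by V * V and has to carry completeness along.
    *)
Definition complete_space (V : normedModType R) : Prop :=
  forall F : set_system V, ProperFilter F -> cauchy F -> cvg F.

Section Limit.
Context {V W : normedModType R}.
Variables (d : V -> W) (eta C K : R).
Hypotheses (eta0 : 0 < eta) (C0 : 0 <= C).
Hypothesis Wcomplete : complete_space W.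
Hypothesis dlin : approx_linear d eta C.
Hypothesis dK : forall u, `|u| < eta -> `|d u| <= K * `|u|.

Let quot_dist (v : V) (h k : R) : 0 < h -> 0 < k -> `|h *: v| < eta -> `|k *: v| < eta ->
  `|h^-1 *: d (h *: v) - k^-1 *: d (k *: v)| <= C * (h + k) * `|v| ^+ 2.
Proof.
move=> h0 k0 hv kv.
have := @dlin h^-1 (- k^-1) 0 (h *: v) (k *: v) 0 hv kv.
rewrite [`|0 : V|]normr0 => /(_ eta0); rewrite !scale0r !addr0 scaleNr !scalerA !mulVf ?gt_eqF//.
rewrite scaleNr scale1r subrr => /(_ erefl) /le_trans; apply.
rewrite normrN !normrZ expr0n /= mulr0 addr0 !exprMn.
rewrite (gtr0_norm h0) (gtr0_norm k0) !gtr0_norm ?invr_gt0//.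
rewrite le_eqVlt; apply/orP; left; apply/eqP; field.
by rewrite !gt_eqF.
Qed.

Let small (v : V) : \forall h \near 0^'+, `|h *: v| < eta.
Proof.
have v1 : 0 < `|v| + 1 by rewrite ltr_wpDl.
near=> h.
have h0 : 0 < h by near: h; exact: nbhs_right_gt.
rewrite normrZ gtr0_norm//.
apply: (@le_lt_trans _ _ (h * (`|v| + 1))); first by rewrite ler_pM2l// lerDl.
rewrite -ltr_pdivlMr//; near: h; apply: nbhs_right_lt.
by rewrite divr_gt0.
Unshelve. all: by end_near. Qed.

Let smallM (Q e : R) : 0 <= Q -> 0 < e -> \forall h \near 0^'+, h * Q <= e.
Proof.
move=> Q0 e0; have Q1 : 0 < Q + 1 by rewrite ltr_wpDl.
near=> h.
have h0 : 0 < h by near: h; exact: nbhs_right_gt.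
apply: (@le_trans _ _ (h * (Q + 1))); first by rewrite ler_pM2l// lerDl.
rewrite -ler_pdivlMr//; apply/ltW; near: h; apply: nbhs_right_lt.
by rewrite divr_gt0.
Unshelve. all: by end_near. Qed.

Let quot_lim (v : V) : exists l : W, forall h : R, 0 < h -> `|h *: v| < eta ->
  `|h^-1 *: d (h *: v) - l| <= h * (C * `|v| ^+ 2).
Proof.
pose g h := h^-1 *: d (h *: v).
have Q0 : 0 <= C * `|v| ^+ 2 by rewrite mulr_ge0// exprn_ge0.
have gcvg : cvg (g h @[h --> 0^'+]).
  apply: Wcomplete; apply: cauchy_exP => e e0.
  have e40 : 0 < e / 4 by rewrite divr_gt0.
  have [k [[k0 kv] kQ]] := filter_ex (filterI
    (filterI (nbhs_right_gt 0) (small v)) (smallM Q0 e40)).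
  exists (g k); rewrite /nbhs/=.
  near=> h; rewrite -ball_normE /=.
  apply: le_lt_trans (quot_dist k0 _ kv _) _.
  - by near: h; exact: nbhs_right_gt.
  - by near: h; exact: small.
  rewrite mulrAC mulrDr.
  have : h * (C * `|v| ^+ 2) <= e / 4 by near: h; exact: smallM.
  by move: kQ; rewrite !(mulrC (C * _)); lra.
exists (lim (g h @[h --> 0^'+])) => h h0 hv.
apply/ler_addgt0Pr => e e0; have e20 : 0 < e / 2 by rewrite divr_gt0.
have /cvgrPdist_le/(_ (e / 2) e20) gl := gcvg.
have [k [[[k0 kv] kQ] gk]] := filter_ex (filterI (filterI
    (filterI (nbhs_right_gt 0) (small v)) (smallM Q0 e20)) gl).
have := quot_dist h0 k0 hv kv; rewrite -/(g h) -/(g k) => D.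
have -> : g h - lim (g h @[h --> 0^'+]) = (g h - g k) - (lim (g h @[h --> 0^'+]) - g k).
  by rewrite opprB addrA subrK.
apply: le_trans (ler_normB _ _) _.
by move: D gk kQ => /=; rewrite [C * _ * _]mulrAC mulrDr !(mulrC (C * _)); lra.
Unshelve. all: by end_near. Qed.

(** The quotients d (h v) / h converge as h tends to 0 by approximate
    homogeneity and completeness, and approximate additivity makes the limit
    linear in v. *)
Lemma approx_linear_diff : exists L : {linear V -> W},
  continuous L /\ forall v, `|v| < eta -> `|d v - L v| <= C * `|v| ^+ 2.
Proof.
have [L HL] := choice quot_lim.
have Q0 v : 0 <= C * `|v| ^+ 2 by rewrite mulr_ge0// exprn_ge0.
have lin : linear L.
  move=> a u v; apply/eqP; rewrite -subr_eq0 -normr_le0; apply/eqP.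
  pose w := a *: u + v.
  pose Q := C * `|w| ^+ 2 + `|a| * (C * `|u| ^+ 2) + C * `|v| ^+ 2.
  have QQ : 0 <= Q + Q by rewrite !addr_ge0// mulr_ge0.
  suff : \forall h \near 0^'+, `|L w - (a *: L u + L v)| <= h * (Q + Q).
    move=> H; apply/eqP; apply/ler_addgt0Pr => e e0; rewrite add0r.
    have [h [h1 h2]] := filter_ex (filterI H (smallM QQ e0)).
    exact: le_trans h1 h2.
  near=> h.
  have h0 : 0 < h by near: h; exact: nbhs_right_gt.
  have hu : `|h *: u| < eta by near: h; exact: small.
  have hv : `|h *: v| < eta by near: h; exact: small.
  have hw : `|h *: w| < eta by near: h; exact: small.
  have := HL w h h0 hw; have := HL u h h0 hu; have := HL v h h0 hv.
  set gu := h^-1 *: d (h *: u); set gv := h^-1 *: d (h *: v).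
  set gw := h^-1 *: d (h *: w) => Hv Hu Hw.
  have D : `|gw - (a *: gu + gv)| <= h * Q.
    have := @dlin h^-1 (- (a * h^-1)) (- h^-1) (h *: w) (h *: u) (h *: v) hw hu hv.
    rewrite !scaleNr !scalerA mulVf ?gt_eqF// mulfVK ?gt_eqF// !scale1r.
    rewrite /w addrAC addrK subrr => /(_ erefl).
    rewrite -addrA -opprD -scalerA -/gw -/gu -/gv => /le_trans; apply.
    have hi : `|h^-1| = h^-1 by rewrite gtr0_norm ?invr_gt0.
    rewrite !normrN !normrM hi -/w !normrZ (gtr0_norm h0).
    rewrite le_eqVlt; apply/orP; left; apply/eqP; rewrite /Q; field.
    by rewrite gt_eqF.
  have -> : L w - (a *: L u + L v) = (gw - (a *: gu + gv)) - (gw - L w)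
     + (a *: (gu - L u) + (gv - L v)).
    rewrite scalerBr (addrACA (a *: gu)) -opprD.
    set X := a *: L u + L v; set Y := a *: gu + gv.
    by rewrite opprB (addrC (L w) (- gw)) (addrACA gw) subrr add0r
      (addrC (- Y)) subrKA.
  apply: le_trans (ler_normD _ _) _.
  apply: le_trans (lerD (ler_normB _ _) (ler_normD _ _)) _.
  rewrite normrZ.
  have : `|a| * `|gu - L u| <= `|a| * (h * (C * `|u| ^+ 2)) by rewrite ler_wpM2l.
  by move: D; rewrite /Q; lra.
pose lM := GRing.isLinear.Build _ _ _ _ _ lin.
pose Ll : {linear _ -> _} := HB.pack L lM.
exists Ll; split; last first.
  move=> v v1; have := HL v 1 ltr01.
  by rewrite invr1 !scale1r mul1r; exact.
have LK v : `|L v| <= K * `|v|.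
  apply/ler_addgt0Pr => e e0.
  have [h [[h0 hv] hQ]] := filter_ex (filterI
    (filterI (nbhs_right_gt 0) (small v)) (smallM (Q0 V v) e0)).
  have -> : L v = h^-1 *: d (h *: v) - (h^-1 *: d (h *: v) - L v).
    by rewrite opprB addrC subrK.
  apply: le_trans (ler_normB _ _) _; apply: lerD; last first.
    exact: le_trans (HL v h h0 hv) hQ.
  rewrite normrZ gtr0_norm ?invr_gt0// ler_pdivrMl//.
  by apply: le_trans (dK hv) _; rewrite normrZ gtr0_norm// mulrCA.
apply: bounded_linear_continuous; apply/linear_boundedP.
near=> r => v; apply: le_trans (LK v) _; rewrite ler_wpM2r//.
Unshelve. all: by end_near. Qed.

End Limit.

Lemma complete_prod (V W : normedModType R) :
  complete_space V -> complete_space W -> complete_space (V * W)%type.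
Proof.
move=> cV cW F FF Fc.
have Fex : cauchy_ex F by apply/cauchyP.
have /cvg_ex[l1 Fl1] : cvg (fst @ F).
  apply: cV; apply: cauchy_exP => e /Fex[[a b] /= H].
  exists a; apply: filterS H => -[x y] [/= ]; exact.
have /cvg_ex[l2 Fl2] : cvg (snd @ F).
  apply: cW; apply: cauchy_exP => e /Fex[[a b] /= H].
  exists b; apply: filterS H => -[x y] [/= ]; done.
apply/cvg_ex; exists (l1, l2).
have Fl : (fun p => (p.1, p.2)) @ F --> (l1, l2) by exact: cvg_pair.
move=> P lP; apply: (@filterS _ F _ ((fun p => (p.1, p.2)) @^-1` P)).
  by move=> [x y].
exact: Fl.
Qed.

Lemma complete_rV n : complete_space 'rV[R]_n.
Proof. by move=> F FF; exact: cauchy_cvg. Qed.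

Lemma complete_R : complete_space R.
Proof. by move=> F FF; exact: cauchy_cvg. Qed.

End ApproximateLinearity.

(** * Ordinary differential equations: stability and uniqueness *)

Section UniformLimits.
Context {R : realType}.
Implicit Types V W : normedModType R.

Lemma subrBB (V : zmodType) (a b c d : V) : a - b - (c - d) = a - c - (b - d).
Proof. by rewrite !opprD !opprK addrACA. Qed.

Lemma mean_value_ball V (f f' : R -> V) (t0 r K : R) :
  (forall s, `|s - t0| < r -> is_derive s 1 f (f' s)) ->
  (forall s, `|s - t0| < r -> `|f' s| <= K) ->
  forall h, `|h| < r -> `|f (t0 + h) - f t0| <= K * `|h|.
Proof.
move=> Df fK h hr.
have seg (s : R) : 0 <= s <= 1 -> `|t0 + s *: h - t0| < r.
  move=> /andP[s0 s1]; rewrite addrAC subrr add0r normrZ ger0_norm//.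
  by apply: le_lt_trans hr; rewrite ler_piMl.
apply: segment_mean_value_le => s s01.
  by have [] := is_derive_diff (Df _ (seg s s01)).
have [_ ->] := is_derive_diff (Df _ (seg s s01)).
by rewrite normrZ mulrC ler_wpM2r// fK// seg.
Qed.

Lemma uniform_limit_continuous V (q : R -> V) (t0 r : R) : 0 < r ->
  (forall e : R, 0 < e -> exists g : R -> V, {for t0, continuous g} /\
    forall s, `|s - t0| < r -> `|g s - q s| <= e) ->
  {for t0, continuous q}.
Proof.
move=> r0 H; apply/cvgrPdist_le => e e0.
have e30 : 0 < e / 3 by rewrite divr_gt0.
have [g [/cvgrPdist_le/(_ (e / 3) e30) cg gq]] := H (e / 3) e30.
have rs : \forall s \near t0, `|s - t0| < r by apply/nearP; exists r.
near=> s.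
have -> : q t0 - q s = (g s - q s) - (g t0 - q t0) + (g t0 - g s).
  by rewrite opprB -addrA subrKA addrC subrKA.
apply: le_trans (ler_normD _ _) _.
have h1 : `|g t0 - g s| <= e / 3 by near: s; exact: cg.
have h2 : `|g s - q s| <= e / 3 by apply: gq; near: s.
have h3 : `|g t0 - q t0| <= e / 3 by apply: gq; rewrite subrr normr0.
by have := ler_normB (g s - q s) (g t0 - q t0); lra.
Unshelve. all: by end_near. Qed.

(** The mean value inequality controls the difference quotients of g - q
    uniformly in the precision of the approximation g. *)
Lemma uniform_limit_derive V (q p : R -> V) (t0 r : R) : 0 < r ->
  (forall e : R, 0 < e -> exists g g' : R -> V, forall s, `|s - t0| < r ->
    [/\ is_derive s 1 g (g' s), `|g s - q s| <= e & `|g' s - p s| <= e]) ->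
  {for t0, continuous p} -> is_derive t0 1 q (p t0).
Proof.
move=> r0 H cp; apply: near_is_derive => e e0.
have e20 : 0 < e / 2 by rewrite divr_gt0.
have /cvgrPdist_le/(_ (e / 2) e20)/nearP[r1 r10 H1] := cp.
pose r2 := Num.min r r1.
have r20 : 0 < r2 by rewrite lt_min r0.
have rr s : s < r2 -> s < r by rewrite lt_min => /andP[].
have rr1 s : s < r2 -> s < r1 by rewrite lt_min => /andP[].
exists r2 => // s st; apply/ler_addgt0Pr => e1 e10.
have [->|sn] := eqVneq s t0.
  by rewrite !subrr scale0r !normr0 mulr0 subrr normr0 add0r ltW.
have st0 : 0 < `|s - t0| by rewrite normr_gt0 subr_eq0.
pose e2 := Num.min (e / 2) (e1 / 2).
have e2_0 : 0 < e2 by rewrite lt_min e20 divr_gt0.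
have [g [g' G]] := H e2 e2_0.
have := @mean_value_ball V (fun u => g u - u *: p t0) (fun u => g' u - p t0) t0 r2 e.
move=> /(_ _ _ (s - t0) st)/wrap[||].
- move=> u /rr/G[Dg _ _].
  apply: near_is_derive => a a0; have [b b0 Hb] := is_derive_near Dg a0.
  by exists b => // v /Hb; rewrite subrBB -scalerBl scalerBr opprB subrKA.
- move=> u /[dup] /rr/G[_ _ Gp] /rr1 /H1 pp.
  have -> : g' u - p t0 = (g' u - p u) - (p t0 - p u) by rewrite opprB addrA subrK.
  apply: le_trans (ler_normB _ _) _.
  have : e2 <= e / 2 by rewrite ge_min lexx.
  by move: Gp pp; lra.
rewrite (addrC t0) subrK => mv.
have [_ G1 _] := G s (rr _ st).
have t0r : `|t0 - t0| < r by rewrite subrr normr0.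
have [_ G2 _] := G t0 t0r.
have -> : q s - q t0 - (s - t0) *: p t0 =
    (g s - s *: p t0 - (g t0 - t0 *: p t0)) - ((g s - q s) - (g t0 - q t0)).
  have key (a b c : V) : c - b = a - b - (a - c) by rewrite subrBB subrr sub0r opprB.
  by rewrite (subrBB (g s) (s *: _)) (subrBB (g s) (q s)) -scalerBl -key.
apply: le_trans (ler_normB _ _) _; apply: lerD => //.
apply: le_trans (ler_normB _ _) _.
have : e2 <= e1 / 2 by rewrite ge_min lexx orbT.
by move: G1 G2; lra.
Qed.

End UniformLimits.

Section Tube.
Context {R : realType} {V : normedModType R}.
Variables (D : set V) (X : V -> V).
Hypotheses (oD : open D) (C2X : Ck 2 D X).

(** Quantitative C^2 control of X around z. One constant M serves as bound and
    as inverse radius, so that enlarging M weakens the condition and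
    compactness yields a common M along a curve. *)
Definition tame (M : R) (z : V) : Prop :=
  (forall w, `|'d X z w| <= M * `|w|) /\
  forall y, `|y - z| < M^-1 ->
    D y /\ `|X y - X z - 'd X z (y - z)| <= M * `|y - z| ^+ 2.

Lemma tame_near p : D p -> \forall z \near p & M \near +oo, tame M z.
Proof.
move=> Dp; have [r [L [r0 L0 H1 H2]]] := C2_locally_quadratic oD C2X Dp.
exists ([set z | `|z - p| < r / 2], [set M | Num.max L (2 / r) < M]) => /=.
  split; first by apply/nearP; exists (r / 2); rewrite ?divr_gt0.
  by apply: nbhs_pinfty_gt; rewrite num_real.
move=> [z M] [/= zp]; rewrite gt_max => /andP[LM rM].
have M0 : 0 < M by apply: lt_trans LM.
have zr : `|z - p| < r.
  by apply: lt_trans zp _; rewrite ltr_pdivrMr// mulr_natr mulr2n ltrDl.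
split=> [w|y yz].
  by apply: le_trans ((H1 z zr).2 w) _; rewrite ler_wpM2r// ltW.
have yp : `|y - p| < r.
  rewrite -(subrKA z); apply: le_lt_trans (ler_normD _ _) _.
  have Mr : M^-1 < r / 2 by rewrite -[r / 2]invf_div ltf_pV2 ?posrE ?divr_gt0.
  by move: (lt_trans yz Mr) zp; lra.
split; first exact: (H1 y yp).1.
by apply: le_trans (H2 y z yp zr) _; rewrite ler_wpM2r ?exprn_ge0// ltW.
Qed.

Definition solves (T : R) (gam : R -> V) : Prop :=
  forall t, 0 <= t <= T -> D (gam t) /\ is_derive t 1 gam (X (gam t)).

Lemma tame_tube (T : R) (gam : R -> V) : solves T gam ->
  exists2 M : R, 1 <= M & forall t, 0 <= t <= T -> tame M (gam t).
Proof.
move=> sg.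
have /compact_near_coveringP cT := @segment_compact R 0 T.
have := cT R +oo (fun M t => tame M (gam t)) _.
move=> /(_ _ _)/wrap[|].
  move=> t /=; rewrite in_itv /= => tT; have [Dt Dd] := sg t tT.
  have [[A B] /= [nA nB] AB] := tame_near Dt.
  have cg := is_derive_cont Dd.
  exists (gam @^-1` A, B) => /=; first by split => //; exact: cg.
  by move=> [u M] /= [Au BM]; apply: (AB (gam u, M)).
move=> H.
have [M [M1 M2]] := filter_ex (filterI H (nbhs_pinfty_ge (num_real 1))).
exists M => // t tT; apply: M1; rewrite /= in_itv/=; exact: tT.
Qed.

Lemma is_derive_exp (a k t : R) :
  is_derive t 1 (fun t => a * expR (k * t)) (k * (a * expR (k * t))).
Proof.
have D1 : is_derive t 1 (fun t => k * t) k.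
  have := is_derive_affine 0 k t.
  by rewrite (_ : (fun t => 0 + k * t) = (fun t => k * t))//; apply/funext => s; rewrite add0r.
have D2 := @is_derive1_comp R expR (fun t => k * t) t _ _ (is_derive_expR _) D1.
have := @is_deriveZ _ _ _ _ a _ _ _ D2.
by rewrite /GRing.scale /= (_ : a * (_ * k) = k * (a * expR (k * t)))//; ring.
Qed.

(** Apply the barrier argument to psi - gam with the barrier e exp ((M + 2)
    t). As long as it stays below 1 / M, the difference of the values of X is
    bounded by (M + 1) |psi - gam|. *)
Lemma ode_stability (T : R) (gam : R -> V) : 0 <= T -> solves T gam ->
  exists M K : R, [/\ 1 <= M, 1 <= K,
    forall t, 0 <= t <= T -> tame M (gam t) &
    forall (psi : R -> V) (e : R), solves T psi -> 0 < e -> K * e < M^-1 ->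
      `|psi 0 - gam 0| < e -> forall t, 0 <= t <= T -> `|psi t - gam t| < K * e].
Proof.
move=> T0 sg; have [M M1 HM] := tame_tube sg.
have M0 : 0 < M by apply: lt_le_trans M1.
exists M, (expR ((M + 2) * T)); split=> //.
  by rewrite -expR0 ler_expR mulr_ge0// addr_ge0// ltW.
move=> psi e sp e0 eM pg.
have uK t : 0 <= t <= T -> e * expR ((M + 2) * t) <= expR ((M + 2) * T) * e.
  move=> /andP[t0 tT]; rewrite mulrC ler_wpM2r ?(ltW e0)// ler_expR ler_wpM2l//.
  by rewrite addr_ge0// ltW.
have := @norm_barrier R V (fun t => psi t - gam t) (fun t => X (psi t) - X (gam t))
  (fun t => e * expR ((M + 2) * t)) (fun t => (M + 2) * (e * expR ((M + 2) * t))) T.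
move=> /(_ _ _ _ _)/wrap[||||H t tT].
- by move=> t tT; have [_ ?] := sp t tT; have [_ ?] := sg t tT; apply: is_deriveB.
- by move=> t _; exact: is_derive_exp.
- by rewrite mulr0 expR0 mulr1.
- move=> t tT E; have [Ha Hb] := HM t tT.
  have u0 : 0 < e * expR ((M + 2) * t) by rewrite mulr_gt0// expR_gt0.
  have dM : `|psi t - gam t| < M^-1 by rewrite E; apply: le_lt_trans (uK t tT) eM.
  have [_ Hq] := Hb _ dM.
  have -> : X (psi t) - X (gam t) =
     (X (psi t) - X (gam t) - 'd X (gam t) (psi t - gam t)) + 'd X (gam t) (psi t - gam t).
    by rewrite subrK.
  apply: le_lt_trans (ler_normD _ _) _.
  apply: le_lt_trans (lerD Hq (Ha _)) _.
  have : M * `|psi t - gam t| ^+ 2 <= `|psi t - gam t|.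
    by rewrite expr2 mulrA ler_piMl// -ler_pdivlMl// mulr1 ltW.
  by rewrite E; nra.
exact: lt_le_trans (H t tT) (uK t tT).
Qed.

Lemma ode_unique (T : R) (gam psi : R -> V) : solves T gam -> solves T psi ->
  psi 0 = gam 0 -> forall t, 0 <= t <= T -> psi t = gam t.
Proof.
move=> sg sp E t tT.
have T0 : 0 <= T by case/andP: tT => /le_trans; exact.
have [M [K [M1 K1 _ H]]] := ode_stability T0 sg.
have M0 : 0 < M by apply: lt_le_trans M1.
have K0 : 0 < K by apply: lt_le_trans K1.
apply/eqP; rewrite -subr_eq0 -normr_le0.
apply: (@le0_small _ _ K (M^-1 / K)); rewrite ?divr_gt0 ?invr_gt0//; first exact: ltW.
move=> e e0 eM; rewrite mulrC; apply: ltW; apply: H => //.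
  by rewrite mulrC -ltr_pdivlMr.
by rewrite E subrr normr0.
Qed.

End Tube.

(** * Smooth dependence on initial values *)

Section FlowDifferentiability.
Context {R : realType}.

Definition is_flow (V : normedModType R) (D B : set V) (X : V -> V) (del : R)
    (phi : R -> V -> V) : Prop :=
  forall x, B x -> phi 0 x = x /\
    forall t, `|t| < del -> D (phi t x) /\ is_derive t 1 (phi^~ x) (X (phi t x)).

Section Flow.
Context {V : normedModType R}.
Implicit Types (D B : set V) (X : V -> V).

Lemma is_flow_solves D B X del phi (x : V) (T : R) : is_flow D B X del phi ->
  B x -> T < del -> solves D X T (phi^~ x).
Proof.
move=> F Bx Td t /andP[t0 tT]; have [_ H] := F x Bx; apply: H.
by rewrite ger0_norm//; exact: le_lt_trans Td.
Qed.

(** The estimates at time t on increments d of the flow from which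
    differentiability follows, all with one constant so that it can be chosen
    uniformly in t. *)
Definition flow_control X phi (x : V) (t M : R) : Prop :=
  let d v := phi t (x + v) - phi t x in
  [/\ approx_linear d M^-1 M,
      forall v, `|v| < M^-1 -> `|d v| <= M * `|v|,
      forall w, `|'d X (phi t x) w| <= M * `|w| &
      forall v, `|v| < M^-1 ->
        `|X (phi t (x + v)) - X (phi t x) - 'd X (phi t x) (d v)| <= M * `|d v| ^+ 2].

Lemma flow_control_le X phi (x : V) t M M' : 0 < M -> M <= M' ->
  flow_control X phi x t M -> flow_control X phi x t M'.
Proof.
move=> M0 MM [H1 H2 H3 H4].
have M'0 : 0 < M' by apply: lt_le_trans MM.
have MV v : v < M'^-1 -> v < M^-1.
  by move=> h; apply: lt_le_trans h _; rewrite lef_pV2 ?posrE.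
split.
- move=> a b c u v w hu hv hw E; apply: le_trans (H1 _ _ _ _ _ _ _ _ _ E) _; rewrite ?MV//.
  by rewrite ler_wpM2r// !addr_ge0// mulr_ge0// exprn_ge0.
- by move=> v /MV hv; apply: le_trans (H2 _ hv) _; rewrite ler_wpM2r.
- by move=> w; apply: le_trans (H3 w) _; rewrite ler_wpM2r.
- by move=> v /MV hv; apply: le_trans (H4 _ hv) _; rewrite ler_wpM2r// exprn_ge0.
Qed.

(** Increments of the flow solve the linearised equation up to a quadratic
    error. A linear combination of three increments therefore does so as well,
    and if it vanishes at time 0 the barrier argument keeps it quadratically
    small. *)
Lemma flow_control_forward D B X del phi (x : V) (T : R) :
  open D -> open B -> Ck 2 D X -> is_flow D B X del phi -> B x ->
  0 <= T -> T < del ->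
  exists2 M, 0 < M & forall t, 0 <= t <= T -> flow_control X phi x t M.
Proof.
move=> oD oB C2X F Bx T0 Td.
have sx := is_flow_solves F Bx Td.
have [M [K [M1 K1 HM HK]]] := ode_stability oD C2X T0 sx.
have M0 : 0 < M by apply: lt_le_trans M1.
have K0 : 0 < K by apply: lt_le_trans K1.
have /nearP[r r0 Hr] := open_nbhs_nbhs (conj oB Bx).
pose d t v := phi t (x + v) - phi t x.
pose eta := Num.min r (M^-1 / (2 * K)).
have eta0 : 0 < eta by rewrite lt_min r0 divr_gt0 ?invr_gt0 ?mulr_gt0.
have Bv v : `|v| < eta -> B (x + v).
  by rewrite lt_min => /andP[vr _]; apply: Hr; rewrite addrAC subrr add0r.
have dK v t : `|v| < eta -> 0 <= t <= T -> `|d t v| <= 2 * K * `|v| /\ `|d t v| < M^-1.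
  move=> hv tT; have [->|v0] := eqVneq v 0.
    by rewrite /d addr0 subrr !normr0 mulr0 invr_gt0.
  have v1 : 0 < `|v| by rewrite normr_gt0.
  have KM : K * (2 * `|v|) < M^-1.
    rewrite (_ : K * _ = `|v| * (2 * K)); last by ring.
    rewrite -ltr_pdivlMr ?mulr_gt0//.
    by move: hv; rewrite lt_min => /andP[].
  have := HK (phi^~ (x + v)) (2 * `|v|) (is_flow_solves F (Bv v hv) Td) _ KM _ t tT.
  have [-> _] := F _ (Bv v hv); have [-> _] := F _ Bx.
  rewrite addrAC subrr add0r mulr_gt0// mulr_natl mulr2n ltrDl => /(_ isT v1) h.
  split; last by apply: lt_trans h _; rewrite -mulr2n -mulr_natl.
  by rewrite (_ : 2 * K * _ = K * (`|v| + `|v|)) ?(ltW h)//; ring.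
have rem v t : `|v| < eta -> 0 <= t <= T ->
    `|X (phi t (x + v)) - X (phi t x) - 'd X (phi t x) (d t v)| <= M * `|d t v| ^+ 2.
  by move=> hv tT; have [_ h] := dK v t hv tT; have [_ /(_ _ h)[]] := HM t tT.
pose C := M * (2 * K) ^+ 2.
have C0 : 0 < C by rewrite mulr_gt0// exprn_gt0// mulr_gt0.
pose E := expR ((M + 1) * T).
have E0 : 0 < E by exact: expR_gt0.
have al t : 0 <= t <= T -> approx_linear (d t) eta (C * E).
  move=> tT a b c u v w hu hv hw E1.
  set S := (X in _ <= _ * X).
  have S0 : 0 <= S by rewrite !addr_ge0// mulr_ge0// exprn_ge0.
  apply: (@le_trans _ _ (E * (C * S))); last by rewrite mulrA (mulrC E).
  apply/ler_addgt0Pr => e e0.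
  pose e1 := e / E; have e10 : 0 < e1 by rewrite divr_gt0.
  have CS : 0 <= C * S by rewrite mulr_ge0// ltW.
  have := @norm_barrier R V (fun t => a *: d t u + b *: d t v + c *: d t w)
    (fun t => a *: (X (phi t (x + u)) - X (phi t x))
            + b *: (X (phi t (x + v)) - X (phi t x))
            + c *: (X (phi t (x + w)) - X (phi t x)))
    (fun t => (C * S + e1) * expR ((M + 1) * t))
    (fun t => (M + 1) * ((C * S + e1) * expR ((M + 1) * t))) T.
  have Dd y s : `|y| < eta -> 0 <= s <= T ->
      is_derive s 1 (d ^~ y) (X (phi s (x + y)) - X (phi s x)).
    move=> hy sT; have [_ D1] := is_flow_solves F (Bv y hy) Td sT.
    by have [_ D2] := sx s sT; exact: is_deriveB.
  move=> /(_ _ _ _ _ t tT)/wrap[||||].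
  - move=> s sT; have D1 := Dd u s hu sT; have D2 := Dd v s hv sT.
    have D3 := Dd w s hw sT.
    exact: is_deriveD.
  - by move=> s _; exact: is_derive_exp.
  - have d0 y : `|y| < eta -> d 0 y = y.
      move=> hy; have [E2 _] := F _ (Bv y hy); have [E3 _] := F _ Bx.
      by rewrite /d E2 E3 addrAC subrr add0r.
    by rewrite !d0// E1 normr0 mulr0 expR0 mulr1 ltr_wpDl.
  - move=> s sT Es; have [Ha _] := HM s sT.
    (* rr is the remainder in the linearised equation. *)
    have [rr [rrE rrb]] : exists rr : V -> V,
        (forall y, X (phi s (x + y)) - X (phi s x) = rr y + 'd X (phi s x) (d s y))
        /\ forall y, `|y| < eta -> `|rr y| <= C * `|y| ^+ 2.
      exists (fun y => X (phi s (x + y)) - X (phi s x) - 'd X (phi s x) (d s y)).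
      split=> y; first by rewrite subrK.
      move=> hy; apply: le_trans (rem y s hy sT) _.
      rewrite /C -mulrA ler_wpM2l ?(ltW M0)// -exprMn.
      have [h _] := dK y s hy sT.
      by rewrite ler_pXn2r ?nnegrE ?mulr_ge0 ?(ltW K0).
    rewrite 3!rrE.
    have -> : a *: (rr u + 'd X (phi s x) (d s u)) + b *: (rr v + 'd X (phi s x) (d s v))
         + c *: (rr w + 'd X (phi s x) (d s w)) =
         (a *: rr u + b *: rr v + c *: rr w) +
         'd X (phi s x) (a *: d s u + b *: d s v + c *: d s w).
      have dX3 : 'd X (phi s x) (a *: d s u + b *: d s v + c *: d s w) =
          a *: 'd X (phi s x) (d s u) + b *: 'd X (phi s x) (d s v)
          + c *: 'd X (phi s x) (d s w).
        by rewrite 2!linearD 3!linearZ.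
      have add6 (x1 x2 x3 x4 x5 x6 : V) : x1 + x2 + (x3 + x4) + (x5 + x6) =
          x1 + x3 + x5 + (x2 + x4 + x6) by rewrite (addrACA x1 x2 x3 x4) (addrACA (x1 + x3)).
      by rewrite dX3 -add6 3!scalerDr.
    have bnd : `|a *: rr u + b *: rr v + c *: rr w| <= C * S.
      have b1 k y : `|y| < eta -> `|k *: rr y| <= `|k| * (C * `|y| ^+ 2).
        by move=> hy; rewrite normrZ ler_wpM2l// rrb.
      apply: le_trans (ler_normD _ _) _.
      apply: le_trans (lerD (ler_normD _ _) (lexx _)) _.
      apply: le_trans (lerD (lerD (b1 _ _ hu) (b1 _ _ hv)) (b1 _ _ hw)) _.
      by rewrite le_eqVlt; apply/orP; left; apply/eqP; rewrite /S; ring.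
    apply: le_lt_trans (ler_normD _ _) _.
    apply: le_lt_trans (lerD bnd (Ha _)) _.
    rewrite Es.
    have : C * S + e1 <= (C * S + e1) * expR ((M + 1) * s).
      rewrite ler_peMr//; first by rewrite addr_ge0// ltW.
      rewrite -expR0 ler_expR mulr_ge0//; first by rewrite addr_ge0// ltW.
      by case/andP: sT.
    by move: e10; lra.
  move=> /ltW/le_trans; apply.
  apply: (@le_trans _ _ ((C * S + e1) * E)).
    rewrite ler_wpM2l//; first by rewrite addr_ge0// ltW.
    rewrite ler_expR ler_wpM2l//; first by rewrite addr_ge0// ltW.
    by case/andP: tT.
  by rewrite mulrDl (mulrC (C * S)) /e1 divfK ?gt_eqF.
pose M' := Num.max (Num.max eta^-1 (C * E)) (Num.max M (2 * K)).
have M'0 : 0 < M' by rewrite !lt_max M0 orbT.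
have etaM : M'^-1 <= eta.
  by rewrite -[leRHS]invrK lef_pV2 ?posrE ?invr_gt0// !le_max lexx.
exists M' => // t tT; split.
- move=> a b c u v w hu hv hw E1.
  apply: le_trans (al t tT a b c u v w _ _ _ E1) _; try exact: lt_le_trans etaM.
  by rewrite ler_wpM2r ?le_max ?lexx ?orbT// !addr_ge0// mulr_ge0// exprn_ge0.
- move=> v hv; have [h _] := dK v t (lt_le_trans hv etaM) tT.
  by apply: le_trans h _; rewrite ler_wpM2r// !le_max lexx !orbT.
- move=> w; have [Ha _] := HM t tT; apply: le_trans (Ha w) _.
  by rewrite ler_wpM2r// !le_max lexx !orbT.
- move=> v hv; apply: le_trans (rem v t (lt_le_trans hv etaM) tT) _.
  by rewrite ler_wpM2r ?exprn_ge0// !le_max lexx !orbT.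
Qed.

(** Reversing time reduces negative times to positive ones. *)
Lemma is_flow_opp D B X del phi : is_flow D B X del phi ->
  is_flow D B (fun y => - X y) del (fun t => phi (- t)).
Proof.
move=> F x Bx; have [F0 Ft] := F x Bx; split; first by rewrite oppr0.
move=> t td; have [|Dt Dd] := Ft (- t); first by rewrite normrN.
split=> //; apply: near_is_derive => e e0.
have [r r0 H] := is_derive_near Dd e0; exists r => // s st.
have st' : `|- s - - t| < r by rewrite opprK addrC distrC.
have := H (- s) st'.
by rewrite scalerN -scaleNr opprB opprK (addrC (- s)) (distrC t).
Qed.

Lemma flow_control_two_sided D B X del phi (x : V) (T : R) :
  open D -> open B -> Ck 2 D X -> is_flow D B X del phi -> B x ->
  0 <= T -> T < del ->
  exists2 M, 0 < M & forall t, `|t| <= T -> flow_control X phi x t M.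
Proof.
move=> oD oB C2X F Bx T0 Td.
have [M1 M10 H1] := flow_control_forward oD oB C2X F Bx T0 Td.
have C2N : Ck 2 D (fun y => - X y) by exact: Ck_opp.
have [M2 M20 H2] := flow_control_forward oD oB C2N (is_flow_opp F) Bx T0 Td.
exists (Num.max M1 M2); first by rewrite lt_max M10.
move=> t tT; have [t0|t0] := leP 0 t.
  apply: (flow_control_le M10); first by rewrite le_max lexx.
  by apply: H1; rewrite t0 -(ger0_norm t0).
apply: (flow_control_le M20); first by rewrite le_max lexx orbT.
have tT' : 0 <= - t <= T by rewrite oppr_ge0 (ltW t0) -(ltr0_norm t0).
have := H2 (- t) tT'.
rewrite /flow_control (opprK t) => -[h1 h2 h3 h4]; have [_ Ft] := F x Bx.
have [Dt _] := Ft t (le_lt_trans tT Td).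
have dX : differentiable X (phi t x) by have /CkSP[+ _] := C2X; apply.
have dN w : 'd (fun y => - X y) (phi t x) w = - 'd X (phi t x) w.
  exact: (congr1 (@^~ w) (diffN dX)).
have key (a b c : V) : `|- a - - b - - c| = `|a - b - c|.
  by rewrite -[RHS]normrN (opprD (a - b)) (opprD a).
split; [exact: h1|exact: h2| |].
  by move=> w; have := h3 w; rewrite dN normrN.
by move=> v hv; have := h4 v hv; rewrite dN key.
Qed.

(** The differential at x exists since increments are approximately linear. In
    time, the difference quotients h^-1 (phi s (x + h w) - phi s x) converge
    uniformly together with their derivatives, so the limit solves the
    linearised equation. *)
Lemma flow_diff D B X del phi (x : V) (t : R) : complete_space V ->
  open D -> open B -> Ck 2 D X -> is_flow D B X del phi -> B x -> `|t| < del ->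
  differentiable (phi t) x /\
  forall w, is_derive t 1 (fun s => 'd (phi s) x w)
                      ('d X (phi t x) ('d (phi t) x w)).
Proof.
move=> cV oD oB C2X F Bx td.
pose T := (`|t| + del) / 2.
have tT : `|t| < T by rewrite /T; move: td; lra.
have Td : T < del by rewrite /T; move: td; lra.
have T0 : 0 <= T by apply: ltW; apply: le_lt_trans tT.
have [M M0 HM] := flow_control_two_sided oD oB C2X F Bx T0 Td.
have dphi s : `|s| <= T -> differentiable (phi s) x /\ forall v, `|v| < M^-1 ->
    `|phi s (x + v) - phi s x - 'd (phi s) x v| <= M * `|v| ^+ 2.
  move=> sT; have [al dK _ _] := HM s sT.
  have Mi : 0 < M^-1 by rewrite invr_gt0.
  have [L [cL HL]] := approx_linear_diff Mi (ltW M0) cV al dK.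
  have [|dp E] := @is_diff_epsilon _ _ _ (phi s) x L cL.
    move=> e e0; apply/nearP; exists (Num.min M^-1 (e / M)).
      by rewrite lt_min Mi divr_gt0.
    move=> h; rewrite subr0 lt_min => /andP[h1 h2].
    apply: le_trans (HL h h1) _; rewrite expr2 mulrA ler_wpM2r//.
    by rewrite mulrC -ler_pdivlMr// ltW.
  by split=> // v hv; rewrite E; exact: HL.
split; first by have [] := dphi t (ltW tT).
move=> w.
pose r := T - `|t|; have r0 : 0 < r by rewrite subr_gt0.
have rT s : `|s - t| < r -> `|s| < T.
  move=> st; have : `|s| <= `|s - t| + `|t| by rewrite -{1}(subrK t s) ler_normD.
  by move: st; rewrite /r; lra.
pose g h s := h^-1 *: (phi s (x + h *: w) - phi s x).
pose g' h s := h^-1 *: (X (phi s (x + h *: w)) - X (phi s x)).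
have /nearP[rB rB0 HB] := open_nbhs_nbhs (conj oB Bx).
have approx e : 0 < e -> exists2 h, 0 < h & forall s, `|s - t| < r ->
    [/\ is_derive s 1 (g h) (g' h s), `|g h s - 'd (phi s) x w| <= e &
        `|g' h s - 'd X (phi s x) ('d (phi s) x w)| <= e].
  move=> e0.
  pose w1 := `|w| + 1; have w10 : 0 < w1 by rewrite ltr_wpDl.
  pose Q := M * `|w| ^+ 2 + M * (M * `|w|) ^+ 2 + M * (M * `|w| ^+ 2) + 1.
  have Q0 : 0 < Q by rewrite ltr_wpDl// !addr_ge0// mulr_ge0 ?mulr_ge0 ?exprn_ge0 ?mulr_ge0// ltW.
  pose h := Num.min (Num.min (M^-1 / w1) (rB / w1)) (e / Q) / 2.
  have h0 : 0 < h by rewrite divr_gt0// !lt_min !divr_gt0 ?invr_gt0.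
  have hlt a : Num.min (Num.min (M^-1 / w1) (rB / w1)) (e / Q) <= a -> h < a.
    move=> ha; apply: lt_le_trans ha.
    rewrite /h ltr_pdivrMr// mulr_natr mulr2n ltrDl.
    by rewrite !lt_min !divr_gt0 ?invr_gt0.
  have hw a : h < a / w1 -> `|h *: w| < a.
    rewrite ltr_pdivlMr// normrZ gtr0_norm//; apply: le_lt_trans.
    by rewrite ler_pM2l// lerDl.
  have hM : `|h *: w| < M^-1 by apply/hw/hlt; rewrite !ge_min lexx.
  have hB : B (x + h *: w).
    apply: HB; rewrite addrAC subrr add0r; apply/hw/hlt.
    by rewrite !ge_min lexx orbT.
  have hQ : h * Q <= e by rewrite -ler_pdivlMr// ltW// hlt// ge_min lexx orbT.
  exists h => // s st; have sT := rT s st.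
  have [_ _ H3 H4] := HM s (ltW sT); have [_ H5] := dphi s (ltW sT).
  have [_ F1] := F _ hB; have [_ F2] := F _ Bx.
  have [_ D1] := F1 s (lt_trans sT Td); have [_ D2] := F2 s (lt_trans sT Td).
  have [_ H2 _ _] := HM s (ltW sT).
  have hh : h^-1 * h = 1 by rewrite mulVf ?gt_eqF.
  have G1 : `|g h s - 'd (phi s) x w| <= h * (M * `|w| ^+ 2).
    have := H5 _ hM; rewrite linearZ /= => H.
    have -> : g h s - 'd (phi s) x w = h^-1 *: (phi s (x + h *: w) - phi s x - h *: 'd (phi s) x w).
      by rewrite scalerBr scalerA hh scale1r.
    rewrite normrZ gtr0_norm ?invr_gt0// ler_pdivrMl//.
    apply: le_trans H _; rewrite normrZ gtr0_norm// le_eqVlt; apply/orP; left.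
    by apply/eqP; ring.
  split.
  - by apply: is_deriveZ; exact: is_deriveB.
  - apply: le_trans G1 _; apply: le_trans hQ; rewrite ler_pM2l// /Q -!addrA lerDl.
    by rewrite !addr_ge0// mulr_ge0 ?mulr_ge0 ?exprn_ge0 ?mulr_ge0// ltW.
  - have -> : g' h s - 'd X (phi s x) ('d (phi s) x w) =
        h^-1 *: (X (phi s (x + h *: w)) - X (phi s x)
                 - 'd X (phi s x) (phi s (x + h *: w) - phi s x))
        + 'd X (phi s x) (g h s - 'd (phi s) x w).
      have -> : 'd X (phi s x) (g h s - 'd (phi s) x w) =
          h^-1 *: 'd X (phi s x) (phi s (x + h *: w) - phi s x)
          - 'd X (phi s x) ('d (phi s) x w) by rewrite linearB linearZ.
      by rewrite (scalerBr h^-1 (X _ - _)) subrKA.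
    apply: le_trans (ler_normD _ _) _; apply: le_trans (lerD (lexx _) (H3 _)) _.
    rewrite normrZ [`|h^-1|]gtr0_norm ?invr_gt0//.
    have A1 : h^-1 * `|X (phi s (x + h *: w)) - X (phi s x)
                 - 'd X (phi s x) (phi s (x + h *: w) - phi s x)| <= h * (M * (M * `|w|) ^+ 2).
      rewrite ler_pdivrMl//; apply: le_trans (H4 _ hM) _.
      apply: (@le_trans _ _ (M * (M * `|h *: w|) ^+ 2)); last first.
        rewrite normrZ gtr0_norm// le_eqVlt; apply/orP; left.
        by apply/eqP; ring.
      rewrite ler_pM2l// ler_pXn2r ?nnegrE ?mulr_ge0 ?(ltW M0)//.
      exact: H2.
    have A2 : M * `|g h s - 'd (phi s) x w| <= M * (h * (M * `|w| ^+ 2)) by rewrite ler_pM2l.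
    apply: le_trans (lerD A1 A2) _; apply: le_trans hQ.
    have : 0 <= h * (M * `|w| ^+ 2) by rewrite mulr_ge0 ?(ltW h0)// mulr_ge0 ?exprn_ge0// ltW.
    by rewrite /Q; move: h0; lra.
have cq : {for t, continuous (fun s => 'd (phi s) x w)}.
  apply: (uniform_limit_continuous r0) => e /approx[h h0 H]; exists (g h); split.
    by have [] := H t; rewrite ?subrr ?normr0// => /is_derive_cont.
  by move=> s /H[].
have cphi : {for t, continuous (phi^~ x)}.
  by have [_ /(_ t td)[_ D2]] := F _ Bx; exact: is_derive_cont D2.
apply: (uniform_limit_derive r0 (p := fun s => 'd X (phi s x) ('d (phi s) x w))).
  by move=> e /approx[h h0 H]; exists (g h), (g' h).
have [_ /(_ t td)[Dt _]] := F _ Bx.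
have /CkSP[_ /Ck_pred TX] := C2X.
have cT : {for (phi t x, 'd (phi t) x w), continuous (tmap X)} by exact: (Ck_continuous TX).
have c1 : {for t, continuous (fun s => (phi s x, 'd (phi s) x w))}.
  by apply: cvg_pair; [exact: cphi|exact: cq].
have c2 := continuous_comp c1 cT.
have c3 : {for tmap X (phi t x, 'd (phi t) x w), continuous (snd : V * V -> V)}.
  exact: cvg_snd.
exact: (continuous_comp c2 c3).
Qed.

End Flow.

Lemma is_derive_pair (V W : normedModType R) (f : R -> V) (g : R -> W) (t : R) df dg :
  is_derive t 1 f df -> is_derive t 1 g dg ->
  is_derive t 1 (fun s => (f s, g s)) (df, dg).
Proof.
move=> /is_derive_diff[Df Ef] /is_derive_diff[Dg Eg].
have D := differentiable_pair Df Dg.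
have := @diff_is_derive R R _ _ t (1 : R) D.
by rewrite diff_pair// Ef Eg !scale1r.
Qed.

(** The linearised equation says exactly this. Iterating [flow_diff] then
    gives derivatives of all orders. *)
Lemma is_flow_tmap (V : normedModType R) (D B : set V) X del phi :
  complete_space V -> open D -> open B -> 0 < del -> Ck 2 D X ->
  is_flow D B X del phi ->
  is_flow (fst @^-1` D) (fst @^-1` B) (tmap X) del (fun t => tmap (phi t)).
Proof.
move=> cV oD oB d0 C2X F [x w] /= Bx; have [F0 Ft] := F x Bx; split.
  congr pair; first exact: F0.
  have E : \near x, id x = phi 0 x.
    by apply: filterS (open_nbhs_nbhs (conj oB Bx)) => y /F[].
  have [_ e] := near_eq_diff E (@linear_differentiable _ _ _ idfun x (fun=> cvg_id)).
  apply: etrans (congr1 (@^~ w) e) _.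
  exact: (congr1 (@^~ w) (@diff_lin _ _ _ idfun x (fun=> cvg_id))).
move=> t td; have [Dt Dd] := Ft t td; split=> //.
apply: is_derive_pair => //.
by have [_] := flow_diff cV oD oB C2X F Bx td; exact.
Qed.

Lemma flow_Ck k (V : normedModType R) (D B : set V) X del phi :
  complete_space V -> open D -> open B -> 0 < del -> Cinf D X ->
  is_flow D B X del phi -> forall t, `|t| < del -> Ck k B (phi t).
Proof.
elim: k V D B X phi => [|k IH] V D B X phi cV oD oB d0 CX F t td.
  move=> x Bx; apply: differentiable_continuous.
  by have [] := flow_diff cV oD oB (CX 2%N) F Bx td.
apply/CkSP; split=> [x Bx|]; first by have [] := flow_diff cV oD oB (CX 2%N) F Bx td.
have TX : Cinf (fst @^-1` D) (tmap X) by move=> j; have /CkSP[] := CX j.+1.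
exact: (IH _ _ _ _ _ (complete_prod cV cV) (open_fst oD) (open_fst oB) d0 TX
  (is_flow_tmap cV oD oB d0 (CX 2%N) F) t td).
Qed.

(** Joint smoothness in time and initial value follows from smoothness in the
    initial value alone: at time 1, the flow of the field (0, s X(y)) maps (s,
    y) to (s, phi s y). *)
Lemma flow_Cinf (V : normedModType R) (D B : set V) X del phi :
  complete_space V -> open D -> open B -> 0 < del -> Cinf D X ->
  is_flow D B X del phi ->
  Cinf [set p : R * V | `|p.1| < del / 2 /\ B p.2] (fun p => phi p.1 p.2).
Proof.
move=> cV oD oB d0 CX F.
pose B1 := [set p : R * V | `|p.1| < del / 2 /\ B p.2].
pose D1 := (snd : R * V -> V) @^-1` D.
have oB1 : open B1.
  apply: openI; last by apply: open_comp => // p _; exact: cvg_snd.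
  apply: (@open_comp _ _ (fun p : R * V => `|p.1|) [set x | x < del / 2]).
    by move=> p _; apply: cvg_norm; exact: cvg_fst.
  exact: open_lt.
have oD1 : open D1 by apply: open_comp => // p _; exact: cvg_snd.
pose Y (p : R * V) : R * V := (0, p.1 *: X p.2).
have CY : Cinf D1 Y.
  move=> k; apply: Ck_pair => //; first exact: Ck_cst.
  apply: Ck_scale => //; first exact: Ck_fst_op.
  exact: (Ck_comp oD1 oD _ (@Ck_snd_op _ k _ _ _) (CX k)).
pose psi (t : R) (p : R * V) : R * V := (p.1, phi (p.1 * t) p.2).
have Fpsi : is_flow D1 B1 Y 2 psi.
  move=> [s y] [/= sd By]; have [F0 Ft] := F y By; split.
    by rewrite /psi /= mulr0 F0.
  move=> t t2; have std : `|s * t| < del.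
    rewrite normrM; apply: (@le_lt_trans _ _ (`|s| * 2)).
      by rewrite ler_wpM2l// ltW.
    by rewrite -ltr_pdivlMr.
  have [Dt Dd] := Ft _ std; split=> //.
  suff D2 : is_derive t 1 (fun u => phi (s * u) y) (s *: X (phi (s * t) y)).
    exact: (is_derive_pair (is_derive_cst (s : R) t (1 : R)) D2).
  have [dp ep] := is_derive_diff Dd.
  have L := @is_derive_line R R V (phi^~ y) 0 s t.
  have E0 : 0 + t *: s = s * t by rewrite add0r mulrC.
  rewrite E0 in L; have := L dp; rewrite ep.
  have -> // : (fun u : R => phi (0 + u *: s) y) = (fun u => phi (s * u) y).
  by apply/funext => u; rewrite add0r mulrC.
have cRV : complete_space (R * V)%type by apply: complete_prod => //; exact: complete_R.
move=> k.
have t1 : `|1 : R| < 2 by rewrite normr1 ltr1n.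
have d2 : 0 < (2 : R) by rewrite ltr0n.
have := Ck_snd oB1 (flow_Ck k cRV oD1 oB1 d2 CY Fpsi t1).
by apply: eq_Ck => // -[s y] _; rewrite /psi /= mulr1.
Qed.

End FlowDifferentiability.

(** * Existence of solutions *)

Section PicardLindelof.
Context {R : realType}.

Lemma is_derive_mx (m n : nat) (F : R -> 'M[R]_(m, n)) (t : R) (D : 'M[R]_(m, n)) :
  (forall i j, is_derive t 1 (fun s => F s i j) (D i j)) -> is_derive t 1 F D.
Proof.
move=> H.
have dF : derivable F t 1 by apply/derivable_mxP => i j; have [] := H i j.
have := derivableP dF; rewrite derive_mx//.
rewrite (_ : \matrix_(i, j) _ = D)//; apply/matrixP => i j; rewrite mxE.
by have [_ ->] := H i j.
Qed.

Lemma primitive_real (f : R -> R) (a : R) : 0 < a -> continuous f ->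
  exists F : R -> R, F 0 = 0 /\ forall t : R, `|t| < a -> is_derive t 1 F (f t).
Proof.
move=> a0 cf.
pose F0 x := (\int[lebesgue_measure]_(t in `[(- a)%R, x]) f t)%R.
exists (fun x => F0 x - F0 0); split; first by rewrite subrr.
move=> t; rewrite ltr_norml => /andP[t1 t2].
have intf : lebesgue_measure.-integrable `[- a, a] (EFin \o f).
  apply: continuous_compact_integrable; first exact: segment_compact.
  exact: continuous_subspaceT.
have [dF EF] := continuous_FTC1_closed t2 intf t1 (cf t).
have D : is_derive t 1 F0 (f t) by rewrite -EF derive1E; exact: derivableP.
have := is_deriveB D (is_derive_cst (F0 0) t 1).
by rewrite subr0.
Qed.

Lemma primitive_rV n (f : R -> 'rV[R]_n) (a : R) : 0 < a -> continuous f ->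
  exists F : R -> 'rV[R]_n, F 0 = 0 /\ forall t : R, `|t| < a -> is_derive t 1 F (f t).
Proof.
move=> a0 cf.
have cfj j : continuous (fun s => f s 0 j).
  move=> s; apply: (@continuous_comp _ _ _ f (fun M : 'rV[R]_n => M 0 j)).
    exact: cf.
  exact: coord_continuous.
have [F HF] := choice (fun j => primitive_real a0 (cfj j)).
exists (fun t => \row_j F j t); split.
  by apply/rowP => j; rewrite !mxE; case: (HF j).
move=> t ta; apply: is_derive_mx => i j; rewrite ord1.
rewrite (_ : (fun s => _) = F j); first by case: (HF j) => _; exact.
by apply/funext => s; rewrite mxE.
Qed.

Lemma small_geometric (c e : R) : 0 < e -> exists k, c * 2^-1 ^+ k <= e.
Proof.
move=> e0.
have g0 : geometric c 2^-1 k @[k --> \oo] --> (0 : R).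
  by apply: cvg_geometric; rewrite gtr0_norm ?invf_lt1// ltr1n.
have [k _ /(_ k (leqnn k))] := cvgr_le _ g0 _ e0.
by exists k.
Qed.

Lemma geometric_limit n (u : nat -> 'rV[R]_n) (c : R) : 0 <= c ->
  (forall k, `|u k.+1 - u k| <= c * 2^-1 ^+ k) ->
  exists l, forall k, `|u k - l| <= 2 * c * 2^-1 ^+ k.
Proof.
move=> c0 H.
have e0 k : 0 <= c * 2^-1 ^+ k by rewrite mulr_ge0// exprn_ge0.
have D k m : `|u (k + m)%N - u k| <= 2 * c * 2^-1 ^+ k - 2 * c * 2^-1 ^+ (k + m).
  elim: m => [|m IH]; first by rewrite addn0 !subrr normr0.
  rewrite addnS -(subrKA (u (k + m)%N)); apply: le_trans (ler_normD _ _) _.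
  have := H (k + m)%N; rewrite exprS; move: IH; lra.
have D' k m : (k <= m)%N -> `|u m - u k| <= 2 * c * 2^-1 ^+ k.
  move=> km; have := D k (m - k)%N; rewrite subnKC// => /le_trans; apply.
  by have := e0 m; lra.
have /cvg_ex[l ul] : cvg (u @ \oo).
  apply: (@complete_rV R n); apply: cauchy_exP => e e_gt0.
  have e20 : 0 < e / 2 by rewrite divr_gt0.
  have [k ke] := small_geometric (2 * c) e20; exists (u k).
  exists k => // m /= km; rewrite -ball_normE /= distrC.
  by apply: le_lt_trans (le_trans (D' _ _ km) ke) _; lra.
exists l => k; apply/ler_addgt0Pr => e e_gt0.
have /cvgrPdist_le/(_ e e_gt0)[m _ Hm] := ul.
have := Hm (maxn k m) (leq_maxr _ _) => /= h1.
have h2 := D' k (maxn k m) (leq_maxl _ _).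
rewrite distrC -(subrKA (u (maxn k m))); apply: le_trans (ler_normD _ _) _.
by move: h1 h2; lra.
Qed.

(** Picard iteration on a time interval so short that the iteration contracts
    by 1/2; the radius r / 2 leaves room for the solutions to stay in the ball
    of radius r where X is Lipschitz. *)
Lemma picard_lindelof n (D : set 'rV[R]_n) (X : 'rV[R]_n -> 'rV[R]_n) (x0 : 'rV[R]_n) :
  open D -> Ck 1 D X -> D x0 ->
  exists del r : R, exists phi, [/\ 0 < del, 0 < r &
    is_flow D [set x | `|x - x0| < r] X del phi].
Proof.
move=> oD C1X Dx0.
have [r [L [r0 L0 HD HL]]] := C1_locally_lipschitz oD C1X Dx0.
pose Q := `|X x0| + L * r.
have Q0 : 0 < Q by rewrite ltr_wpDl// mulr_gt0.
have XQ y : `|y - x0| < r -> `|X y| <= Q.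
  move=> yr; rewrite -[X y](subrK (X x0)); apply: le_trans (ler_normD _ _) _.
  rewrite addrC lerD2l; apply: le_trans (HL y x0 yr _) _.
    by rewrite subrr normr0.
  by rewrite ler_pM2l// ltW.
pose del := Num.min (r / 2 / Q) (2 * L)^-1.
have del0 : 0 < del by rewrite lt_min !divr_gt0 ?invr_gt0 ?mulr_gt0.
have Qdel : Q * del <= r / 2 by rewrite mulrC -ler_pdivlMr// ge_min lexx.
have Ldel : L * del <= 2^-1.
  rewrite mulrC -ler_pdivlMr// -invfM mulrC; first by rewrite mulrC ge_min lexx orbT.
exists del, (r / 2).
suff : forall x, exists y : R -> 'rV[R]_n, `|x - x0| < r / 2 -> y 0 = x /\
    forall t : R, `|t| < del -> D (y t) /\ is_derive t 1 y (X (y t)).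
  move=> /choice[phi Hphi]; exists (fun t x => phi x t); split=> //.
    by rewrite divr_gt0.
move=> x.
have [xr|xr] := pselect (`|x - x0| < r / 2); last by exists (fun=> x).
suff [y Hy] : exists y : R -> 'rV[R]_n, y 0 = x /\
    forall t : R, `|t| < del -> D (y t) /\ is_derive t 1 y (X (y t)) by exists y.
(* Admissible curves stay in a cone with apex x and thereby in the ball around
   x0. *)
pose adm (y : R -> 'rV[R]_n) := forall t : R, `|t| <= del ->
  {for t, continuous y} /\ `|y t - x| <= Q * `|t|.
have admB y t : adm y -> `|t| <= del -> `|y t - x0| < r.
  move=> ay td; rewrite -(subrKA x); apply: le_lt_trans (ler_normD _ _) _.
  have [_ h] := ay t td.
  have : Q * `|t| <= Q * del by rewrite ler_pM2l.
  by move: h xr Qdel; lra.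
(* Composing with the retraction to the time interval makes the integrand
   continuous on the whole line. *)
pose clamp (s : R) := Num.max (- del) (Num.min del s).
have clampd s : `|clamp s| <= del.
  rewrite ler_norml le_max lexx /= ge_max ge_min lexx /= andbT.
  by rewrite -subr_ge0 opprK addr_ge0// ltW.
have clampE s : `|s| <= del -> clamp s = s.
  by rewrite ler_norml => /andP[s1 s2]; rewrite /clamp (min_r s2) (max_r s1).
have cclamp : continuous clamp.
  have c1 : continuous ((fun=> del) \min id : R -> R).
    by move=> s; apply: continuous_min; [exact: cst_continuous|exact: cvg_id].
  have c2 : continuous ((fun=> - del) \max ((fun=> del) \min id) : R -> R).
    by move=> s; apply: continuous_max; [exact: cst_continuous|exact: c1].
  exact: c2.
have step : forall y, exists z, adm y -> adm z /\
    forall t : R, `|t| <= del -> is_derive t 1 z (X (y t)).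
  move=> y; have [ay|ay] := pselect (adm y); last by exists y.
  pose f s := X (y (clamp s)).
  have cf : continuous f.
    move=> s; have [cy _] := ay _ (clampd s).
    have DX : D (y (clamp s)) by exact: (HD _ (admB _ _ ay (clampd s))).1.
    exact: (continuous_comp (continuous_comp (cclamp s) cy)
      (Ck_continuous C1X DX)).
  have del2 : 0 < 2 * del by rewrite mulr_gt0.
  have [F [F0 HF]] := primitive_rV del2 cf.
  have td2 (t : R) : `|t| <= del -> `|t| < 2 * del by move: del0; lra.
  have Dz (t : R) : `|t| < 2 * del -> is_derive t 1 (fun t => x + F t) (f t).
    by move=> h; have := HF t h => h1; rewrite -[f t]add0r; apply: is_deriveD.
  exists (fun t => x + F t) => _; split; last first.
    by move=> t td; have := Dz t (td2 t td); rewrite /f clampE.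
  move=> t td; split; first exact: is_derive_cont (Dz t (td2 t td)).
  have := @mean_value_ball R _ (fun t => x + F t) f 0 (2 * del) Q.
  move=> /(_ _ _ t (td2 t td))/wrap[||].
  - by move=> s; rewrite subr0; exact: Dz.
  - by move=> s _; apply: XQ; exact: admB.
  - by rewrite add0r F0 addr0.
have [T HT] := choice step.
pose y k := iter k T (fun=> x).
have ady k : adm (y k).
  elim: k => [|k IH]; last by have [] := HT _ IH.
  by move=> t _; split; [exact: cst_continuous|rewrite subrr normr0 mulr_ge0// ltW].
have dy k (t : R) : `|t| <= del -> is_derive t 1 (y k.+1) (X (y k t)).
  by have [_] := HT _ (ady k); exact.
have y0 k : y k 0 = x.
  have [|_] := ady k 0; first by rewrite normr0 ltW.
  by rewrite normr0 mulr0 normr_le0 subr_eq0 => /eqP.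
have contr k (t : R) : `|t| < del -> `|y k.+1 t - y k t| <= r / 2 * 2^-1 ^+ k.
  elim: k t => [|k IH] t td.
    have [_ h] := ady 1%N t (ltW td).
    rewrite expr0 mulr1; apply: le_trans h _; apply: le_trans Qdel.
    by rewrite ler_pM2l// ltW.
  have := @mean_value_ball R _ (fun t => y k.+2 t - y k.+1 t)
    (fun t => X (y k.+1 t) - X (y k t)) 0 del (L * (r / 2 * 2^-1 ^+ k)).
  move=> /(_ _ _ t td)/wrap[||].
  - move=> s; rewrite subr0 => /ltW sd; have D1 := dy k.+1 s sd.
    by have D2 := dy k s sd; exact: is_deriveB.
  - move=> s; rewrite subr0 => sd.
    apply: le_trans (HL _ _ (admB _ _ (ady _) (ltW sd)) (admB _ _ (ady _) (ltW sd))) _.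
    by rewrite ler_pM2l// IH.
  rewrite add0r !y0 subrr subr0 => /le_trans; apply.
  have r20 : 0 <= r / 2 * 2^-1 ^+ k by rewrite mulr_ge0 ?exprn_ge0// divr_ge0// ltW.
  apply: (@le_trans _ _ (L * del * (r / 2 * 2^-1 ^+ k))).
    by rewrite [leRHS]mulrAC ler_wpM2l ?(ltW td)// mulr_ge0// ltW.
  by rewrite exprS [leRHS]mulrCA ler_wpM2r.
have lim_ex (t : R) : exists l, `|t| < del -> forall k, `|y k t - l| <= 2 * (r / 2) * 2^-1 ^+ k.
  have [td|td] := pselect (`|t| < del); last by exists 0.
  have r20 : 0 <= r / 2 by rewrite divr_ge0// ltW.
  have [l Hl] := geometric_limit r20 (fun k => contr k t td).
  by exists l.
have [z Hz] := choice lim_ex.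
have small := small_geometric (2 * (r / 2)).
have zB (t : R) : `|t| < del -> `|z t - x0| < r.
  move=> td; have h : `|z t - x| <= Q * `|t|.
    apply/ler_addgt0Pr => e /small[k ke].
    have -> : z t - x = (y k t - x) - (y k t - z t).
      by rewrite subrBB subrr sub0r opprB.
    apply: le_trans (ler_normB _ _) _; apply: lerD.
      by have [] := ady k t (ltW td).
    exact: le_trans (Hz t td k) ke.
  rewrite -(subrKA x); apply: le_lt_trans (ler_normD _ _) _.
  have : Q * `|t| <= Q * del by rewrite ler_pM2l// ltW.
  by move: h xr Qdel; lra.
exists z; split.
  apply/eqP; rewrite -subr_eq0 -normr_le0; apply/ler_addgt0Pr => e /small[k ke].
  have := Hz 0 _ k; rewrite normr0 y0 distrC add0r => /(_ del0)/le_trans; exact.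
move=> t td; split; first exact: (HD _ (zB t td)).1.
pose rt := del - `|t|; have rt0 : 0 < rt by rewrite subr_gt0.
have rtd s : `|s - t| < rt -> `|s| < del.
  move=> st; have : `|s| <= `|s - t| + `|t| by rewrite -{1}(subrK t s) ler_normD.
  by move: st; rewrite /rt; lra.
have cz : {for t, continuous z}.
  apply: (uniform_limit_continuous rt0) => e /small[k ke]; exists (y k); split.
    by have [] := ady k t (ltW td).
  by move=> s /rtd sd; apply: le_trans (Hz s sd k) ke.
apply: (uniform_limit_derive rt0 (p := X \o z)).
  move=> e e_gt0.
  have e1 : 0 < e / (L + 1) by rewrite divr_gt0// addr_gt0.
  have [k ke] := small _ e1.
  have L1 : 1 <= L + 1 by rewrite lerDr ltW.
  have q0 : 0 <= 2 * (r / 2) * 2^-1 ^+ k.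
    by rewrite mulr_ge0 ?exprn_ge0// mulr_ge0// divr_ge0// ltW.
  have eL : e / (L + 1) <= e by rewrite ler_pdivrMr ?addr_gt0// ler_peMr// ltW.
  exists (y k.+1), (X \o y k) => s /rtd sd; split=> /=.
  - exact: dy (ltW sd).
  - apply: le_trans (Hz s sd k.+1) _; rewrite exprS.
    by move: ke q0 eL; lra.
  - apply: le_trans (HL _ _ (admB _ _ (ady _) (ltW sd)) (zB s sd)) _.
    apply: (@le_trans _ _ (L * (e / (L + 1)))).
      by rewrite ler_pM2l//; apply: le_trans (Hz s sd k) ke.
    by rewrite mulrA ler_pdivrMr ?addr_gt0// mulrC ler_pM2l// lerDl.
by apply: continuous_comp; [exact: cz|exact: (Ck_continuous C1X (HD _ (zB t td)).1)].
Qed.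

End PicardLindelof.

(** * Straightening of vector fields *)

Section FlowBox.
Context {R : realType}.

Lemma is_derive_affine_comp (V : normedModType R) (f : R -> V) (a b t : R) (d : V) :
  is_derive (a + b * t) 1 f d -> is_derive t 1 (fun u => f (a + b * u)) (b *: d).
Proof.
move=> Df; have [df ef] := is_derive_diff Df.
have L := @is_derive_line R R V f a b t.
have E0 : a + t *: b = a + b * t by rewrite [t *: b]mulrC.
rewrite E0 in L; have := L df; rewrite ef.
have -> // : (fun u : R => f (a + u *: b)) = (fun u => f (a + b * u)).
by apply/funext => u; rewrite [u *: b]mulrC.
Qed.

Lemma open_preimage_in (V W : normedModType R) (A : set V) (B : set W) (f : V -> W) :
  open A -> open B -> (forall x, A x -> {for x, continuous f}) ->
  open (A `&` f @^-1` B).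
Proof.
move=> oA oB cf; rewrite openE => x [Ax Bx].
apply: filterI; first exact: open_nbhs_nbhs.
exact: (cf x Ax B (open_nbhs_nbhs (conj oB Bx))).
Qed.

Lemma open_norm_lt (V W : normedModType R) (f : V -> W) (r : R) :
  Ck 0 setT f -> open [set x | `|f x| < r].
Proof.
move=> cf; apply: (@open_comp _ _ (fun x => `|f x|) [set x | x < r]).
  by move=> x _; apply: cvg_norm; exact: cf.
exact: open_lt.
Qed.

Lemma open_norm_ball (V : normedModType R) (x0 : V) (r : R) :
  open [set x | `|x - x0| < r].
Proof.
by apply: open_norm_lt; apply: Ck_sub_fun; [exact: openT|exact: Ck_id|exact: Ck_cst].
Qed.

Section FlowInverse.
Context {V : normedModType R}.
Implicit Types (D B : set V) (X : V -> V).

Lemma flow_opp_fwd D B X del phi (y : V) (s : R) : open D -> Ck 2 D X ->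
  is_flow D B X del phi -> B y -> 0 <= s -> s < del -> B (phi s y) ->
  phi (- s) (phi s y) = y.
Proof.
move=> oD C2X F By s0 sd Bs.
have C2N : Ck 2 D (fun y => - X y) by exact: Ck_opp.
have S1 : solves D (fun y => - X y) s (fun u => phi (s - u) y).
  move=> u /andP[u0 us]; have [_ Fy] := F y By.
  have [|Dt Dd] := Fy (s - u).
    by rewrite ger0_norm ?subr_ge0//; apply: le_lt_trans sd; rewrite lerBlDr lerDl.
  split=> //.
  have := @is_derive_affine_comp V (phi^~ y) s (-1) u (X (phi (s - u) y)).
  rewrite mulN1r scaleN1r => /(_ Dd).
  have -> // : (fun v => phi (s + -1 * v) y) = (fun v => phi (s - v) y).
  by apply/funext => v; rewrite mulN1r.
have S2 := is_flow_solves (is_flow_opp F) Bs sd.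
have [E2 _] := F _ Bs; have [E1 _] := F _ By.
have := ode_unique oD C2N S1 S2 _ (t := s).
rewrite oppr0 E2 addr0 subrr E1 s0 lexx; exact.
Qed.

(** The curve s - u |-> phi (s - u) y and the flow of - X from phi s y solve
    the same equation. *)
Lemma flow_opp D B X del phi (y : V) (s : R) : open D -> Ck 2 D X ->
  is_flow D B X del phi -> B y -> `|s| < del -> B (phi s y) ->
  phi (- s) (phi s y) = y.
Proof.
move=> oD C2X F By sd Bs; have [s0|s0] := leP 0 s.
  by apply: (flow_opp_fwd oD C2X F) => //; rewrite -(ger0_norm s0).
have C2N : Ck 2 D (fun y => - X y) by exact: Ck_opp.
have := flow_opp_fwd oD C2N (is_flow_opp F) By (s := - s).
rewrite !opprK; apply; rewrite ?oppr_ge0 ?(ltW s0)//.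
by rewrite -(ltr0_norm s0).
Qed.

End FlowInverse.

Definition cube n (e : R) : set 'rV[R]_n := [set z | forall i, `|z 0 i| < e].

Lemma cubeP n (e : R) (z : 'rV[R]_n) : 0 < e -> cube e z <-> `|z| < e.
Proof.
move=> e0; rewrite /Num.Def.normr /= mx_normrE; split.
  move=> ze; apply: bigmax_lt => // -[i j] _ /=; rewrite ord1; exact: ze.
move=> ze i; apply: le_lt_trans ze.
exact: (le_bigmax _ (fun i : 'I_1 * 'I_n => `|z i.1 i.2|) (ord0, i)).
Qed.

Lemma open_cube n (e : R) : 0 < e -> open (cube e : set 'rV[R]_n).
Proof.
move=> e0; have -> : (cube e : set 'rV[R]_n) = [set z | `|z| < e].
  by apply/seteqP; split=> z /(cubeP _ e0).
apply: (@open_comp _ _ (fun z : 'rV[R]_n => `|z|) [set x | x < e]); last exact: open_lt.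
by move=> z _; exact: norm_continuous.
Qed.

Definition set_first n (a : 'rV[R]_n.+1) (t : R) : 'rV[R]_n.+1 :=
  \row_j (if j == ord0 then t else a 0 j).

(** Flow for the time given by the first coordinate, starting on the
    hyperplane through x0 orthogonal to the k-th axis. As the k-th component
    of Y is 1, time is read off from the k-th coordinate, so the inverse is
    explicit and needs no inverse function theorem. The larger cube of
    half-width 2 e makes room for reparametrising closed segments of the flow
    lines. *)
Lemma flow_box n (D : set 'rV[R]_n.+1) (Y : 'rV[R]_n.+1 -> 'rV[R]_n.+1)
    (x0 : 'rV[R]_n.+1) (k : 'I_n.+1) :
  open D -> Cinf D Y -> D x0 -> (forall x, D x -> Y x 0 k = 1) ->
  exists (A : set 'rV[R]_n.+1) (Psi Theta : 'rV[R]_n.+1 -> 'rV[R]_n.+1) (e : R),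
    [/\ 0 < e, [/\ open A, A `<=` D & A x0],
        [/\ Cinf (cube (2 * e)) Psi /\ (forall z, cube (2 * e) z -> D (Psi z)),
            Cinf A Theta,
            forall z, cube e z -> A (Psi z) /\ Theta (Psi z) = z &
            forall x, A x -> cube e (Theta x) /\ Psi (Theta x) = x] &
        forall a (t : R), cube e a -> `|t| < 2 * e ->
          is_derive t 1 (fun u => Psi (set_first a u)) (Y (Psi (set_first a t)))].
Proof.
move=> oD CY Dx0 Yk.
have [del [r [phi [del0 r0 F]]]] := picard_lindelof oD (CY 1%N) Dx0.
set B := [set x | `|x - x0| < r] in F.
have oB : open B by exact: open_norm_ball.
have Bx0 : B x0 by rewrite /B /= subrr normr0.
have BD x : B x -> D x.
  move=> Bx; have [F0 Ft] := F x Bx.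
  by have [|] := Ft 0; rewrite ?normr0// F0.
pose U := [set p : R * 'rV[R]_n.+1 | `|p.1| < del / 2 /\ B p.2].
have Cphi : Cinf U (fun p => phi p.1 p.2).
  exact: (flow_Cinf (@complete_rV R n.+1) oD oB del0 CY F).
have oU : open U.
  apply: openI; last by apply: open_comp => // p _; exact: cvg_snd.
  by apply: open_norm_lt; exact: Ck_fst_op.
have d2 t : t < del / 2 -> t < del.
  move=> h; apply: lt_trans h _.
  by rewrite ltr_pdivrMr// mulr_natr mulr2n ltrDl.
have phik x t : B x -> `|t| < del -> phi t x 0 k = x 0 k + t.
  move=> Bx td; have [F0 Ft] := F x Bx.
  have := @mean_value_ball R R (fun t => phi t x 0 k - t) (fun=> 0) 0 del 0.
  move=> /(_ _ _ t td)/wrap[||].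
  - move=> s; rewrite subr0 => sd; have [Ds Dd] := Ft s sd.
    have Dk : is_derive s 1 (fun u => phi u x 0 k) 1.
      have [dp ep] := Dd; apply: DeriveDef; first by move/derivable_mxP: dp.
      by have := derive_mx dp; rewrite ep => /matrixP/(_ 0 k); rewrite mxE Yk.
    have := is_deriveB Dk (is_derive_id s (1 : R)).
    by rewrite subrr.
  - by move=> s _; rewrite normr0.
  rewrite add0r mul0r subr0 F0 normr_le0 => /eqP E.
  by apply/eqP; rewrite -subr_eq0 opprD addrA addrAC E.
(* The transposition tp lets the coordinates other than the first parametrise
   the hyperplane on which the k-th coordinate is constant. *)
pose tp := tperm ord0 k.
have tpK j : tp (tp j) = j by rewrite /tp tpermK.
have tp0 j : (tp j == ord0) = (j == k).
  by apply/eqP/eqP => [h|->]; rewrite /tp ?tpermR// -[j]tpK h /tp tpermL.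
have tpk j : (tp j == k) = (j == ord0).
  by apply/eqP/eqP => [h|->]; rewrite /tp ?tpermL// -[j]tpK h /tp tpermR.
pose sig (z : 'rV[R]_n.+1) : 'rV[R]_n.+1 := \row_j (if j == k then 0 else z 0 (tp j)).
pose Psi (z : 'rV[R]_n.+1) := phi (z 0 ord0) (x0 + sig z).
pose Theta (x : 'rV[R]_n.+1) : 'rV[R]_n.+1 := \row_j (if j == ord0 then x 0 k - x0 0 k
   else (phi (- (x 0 k - x0 0 k)) x - x0) 0 (tp j)).
pose inc (z : 'rV[R]_n.+1) := (z 0 ord0, x0 + sig z).
have Cinc : Cinf setT inc.
  move=> m; have oT : open (setT : set 'rV[R]_n.+1) by exact: openT.
  apply: Ck_pair => //; first by apply: Ck_coord => //; exact: Ck_id.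
  apply: Ck_add => //; first exact: Ck_cst.
  apply: Ck_mx => // i j.
  have C0 : Ck m setT (fun z : 'rV[R]_n.+1 => if j == k then 0 else z 0 (tp j)).
    by case: (j == k); [exact: Ck_cst|apply: Ck_coord => //; exact: Ck_id].
  by apply: eq_Ck C0 => // z _; rewrite mxE.
have cinc z : {for z, continuous inc} by exact: (Ck_continuous (Cinc 0%N)).
pose Z0 := inc @^-1` U.
have oZ0 : open Z0.
  by apply: open_comp => // z _; exact: cinc.
have CPsi : Cinf Z0 Psi.
  move=> m; have := Ck_comp oZ0 oU (fun z => id) _ (Cphi m).
  apply; apply: Ck_sub (Cinc m); exact: subsetT.
pose A1 := [set x : 'rV[R]_n.+1 | B x /\ `|x 0 k - x0 0 k| < del / 2].
have oA1 : open A1.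
  apply: openI => //.
  apply: (@open_norm_lt 'rV[R]_n.+1 R (fun x => x 0 k - x0 0 k) (del / 2)).
  apply: Ck_sub_fun; [exact: openT| |exact: Ck_cst].
  by apply: Ck_coord; [exact: openT|exact: Ck_id].
pose inc2 (x : 'rV[R]_n.+1) := (- (x 0 k - x0 0 k), x).
have CTheta : Cinf A1 Theta.
  move=> m; apply: Ck_mx => // i j.
  have C1 : Ck m A1 (fun x => x 0 k - x0 0 k).
    by apply: Ck_sub_fun => //; [apply: Ck_coord => //; exact: Ck_id|exact: Ck_cst].
  have C2 : Ck m A1 inc2.
    by apply: Ck_pair => //; [exact: Ck_opp|exact: Ck_id].
  have A1U : A1 `<=` inc2 @^-1` U by move=> x [Bx xk]; split=> //=; rewrite normrN.
  have C3 := Ck_comp oA1 oU A1U C2 (Cphi m).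
  have : Ck m A1 (fun x => if j == ord0 then x 0 k - x0 0 k
     else (phi (- (x 0 k - x0 0 k)) x - x0) 0 (tp j)).
    case: (j == ord0) => //; apply: Ck_coord => //.
    by apply: Ck_sub_fun => //; exact: Ck_cst.
  by apply: eq_Ck => // x _; rewrite [RHS]mxE.
pose Z1 := Z0 `&` Psi @^-1` A1.
have oZ1 : open Z1.
  by apply: open_preimage_in => //; exact: (Ck_continuous (CPsi 0%N)).
have sig0 : sig 0 = 0 by apply/rowP => j; rewrite !mxE; case: ifP.
have Psi0 : Psi 0 = x0.
  by rewrite /Psi mxE sig0 addr0; have [] := F x0 Bx0.
have A1x0 : A1 x0 by split=> //; rewrite subrr normr0 divr_gt0.
have Z10 : Z1 0.
  split; last by rewrite /= Psi0.
  by rewrite /Z0 /inc /= mxE sig0 addr0; split=> //=; rewrite normr0 divr_gt0.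
have /nearP[e0 e00 He0] := open_nbhs_nbhs (conj oZ1 Z10).
pose e := Num.min e0 (del / 2) / 2.
have e_gt0 : 0 < e by rewrite divr_gt0// lt_min e00 divr_gt0.
have e2_gt0 : 0 < 2 * e by rewrite mulr_gt0.
have ce2 (z : 'rV[R]_n.+1) : cube e z -> cube (2 * e) z.
  by move=> ze i; apply: lt_trans (ze i) _; rewrite mulr_natl mulr2n ltrDl.
have eZ z : cube (2 * e) z -> Z1 z.
  move=> /(cubeP _ e2_gt0) ze; apply: He0; rewrite subr0.
  by apply: lt_le_trans ze _; rewrite /e mulrC divfK// ge_min lexx.
have sigk z : sig z 0 k = 0 by rewrite mxE eqxx.
have ThPs z : Z1 z -> Theta (Psi z) = z.
  move=> [[/= z0 Bz] [Bp pk]].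
  have E1 : Psi z 0 k - x0 0 k = z 0 ord0.
    by rewrite /Psi phik ?d2// mxE sigk addr0 addrAC subrr add0r.
  have E2 : phi (- z 0 ord0) (Psi z) - x0 = sig z.
    rewrite /Psi (flow_opp oD (CY 2%N) F)//; last exact: d2.
    by rewrite addrAC subrr add0r.
  apply/rowP => j; rewrite mxE E1 E2; case: ifP => [/eqP->//|j0].
  by rewrite mxE tpk j0 tpK.
exists (A1 `&` Theta @^-1` cube e), Psi, Theta, e; split=> //.
- split.
  + by apply: open_preimage_in => //;
      [exact: open_cube|exact: (Ck_continuous (CTheta 0%N))].
  + by move=> x [[Bx _] _]; exact: BD.
  + split=> //=; rewrite -Psi0 ThPs// => i.
  by rewrite mxE normr0.
- split.
  + split; first by move=> m; apply: Ck_sub (CPsi m) => z /eZ[].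
    by move=> z /eZ[_ [Bz _]]; exact: BD.
  + by move=> m; apply: Ck_sub (CTheta m) => z [].
  + move=> z ze; have Zz := eZ z (ce2 z ze); have E := ThPs z Zz; split=> //.
    by split; [case: Zz|rewrite /= E].
  + move=> x [[Bx xk] Tx]; split=> //.
    set z := Theta x in Tx *; have [[/= z0 Bz] _] := eZ _ (ce2 _ Tx).
    have zE : z 0 ord0 = x 0 k - x0 0 k by rewrite mxE eqxx.
    have xkN : `|- z 0 ord0| < del by rewrite normrN zE d2.
    have sE : x0 + sig z = phi (- z 0 ord0) x.
      rewrite -[RHS](subrKC x0); congr (_ + _); apply/rowP => j; rewrite mxE.
      case: ifP => [/eqP->|jk].
        have Ek (N1 N2 : 'rV[R]_n.+1) : (N1 - N2) 0 k = N1 0 k - N2 0 k.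
          by rewrite !mxE.
        by rewrite Ek phik// zE; ring.
      by rewrite mxE tp0 jk tpK -zE.
    rewrite /Psi sE; rewrite sE in Bz.
    have := flow_opp oD (CY 2%N) F Bx xkN Bz.
    by rewrite opprK.
- move=> a t ae te.
  have ce : cube (2 * e) (set_first a t).
    by move=> i; rewrite mxE; case: ifP => // _; exact: ce2.
  have [[/= z0 Bz] _] := eZ _ ce.
  have sE u : sig (set_first a u) = sig (set_first a t).
    apply/rowP => j; rewrite !mxE; case: ifP => // jk.
    by rewrite tp0 jk.
  have fE u : set_first a u 0 ord0 = u by rewrite mxE eqxx.
  have [_ Ft] := F _ Bz; rewrite fE in z0.
  have [_ Dd] := Ft t (d2 _ z0).
  have -> : (fun u => Psi (set_first a u)) = phi^~ (x0 + sig (set_first a t)).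
    by apply/funext => u; rewrite /Psi fE sE.
  by rewrite /Psi fE.
Qed.

End FlowBox.

Section Reparametrization.
Context {R : realType}.

(** tau is the inverse of a primitive of 1 / h. *)
Lemma positive_ode_line (h : R -> R) (e : R) : 0 < e ->
  Cinf [set t : R | `|t| < 2 * e] h -> (forall t, `|t| < 2 * e -> 0 < h t) ->
  exists (J : set R) (tau : R -> R), [/\ open_interval J, Cinf J tau,
    forall u : R, J u -> `|tau u| < e /\ is_derive u 1 tau (h (tau u)) &
    forall t : R, `|t| < e -> exists2 u, J u & tau u = t].
Proof.
move=> e0 Ch h0.
have e20 : 0 < 2 * e by rewrite mulr_gt0.
have le2 (t : R) : `|t| <= e -> `|t| < 2 * e by move: e0; lra.
pose clamp (s : R) := Num.max (- e) (Num.min e s).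
have clampd s : `|clamp s| <= e.
  rewrite ler_norml le_max lexx /= ge_max ge_min lexx /= andbT.
  by rewrite -subr_ge0 opprK addr_ge0// ltW.
have clampE s : `|s| <= e -> clamp s = s.
  by rewrite ler_norml => /andP[s1 s2]; rewrite /clamp (min_r s2) (max_r s1).
have cclamp : continuous clamp.
  have c1 : continuous ((fun=> e) \min id : R -> R).
    by move=> s; apply: continuous_min; [exact: cst_continuous|exact: cvg_id].
  have c2 : continuous ((fun=> - e) \max ((fun=> e) \min id) : R -> R).
    by move=> s; apply: continuous_max; [exact: cst_continuous|exact: c1].
  exact: c2.
have oI : open [set t : R | `|t| < 2 * e].
  by apply: open_norm_lt; exact: Ck_id.
pose f s := (h (clamp s))^-1.
have f0 s : 0 < f s by rewrite invr_gt0 h0// le2.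
have cf : continuous f.
  move=> s; apply: cvgV; first by rewrite gt_eqF// h0// le2.
  apply: (continuous_comp (cclamp s)).
  exact: (Ck_continuous (Ch 0%N) (le2 _ (clampd s))).
have [S [_ HS]] := primitive_real e20 cf.
have incr (a b : R) : `|a| < 2 * e -> `|b| < 2 * e -> a < b -> S a < S b.
  move=> ae be ab.
  have abe x : x \in `[a, b] -> `|x| < 2 * e.
    rewrite in_itv /= => /andP[ax xb]; move: ae be; rewrite !ltr_norml => /andP[a1 a2] /andP[b1 b2].
    by rewrite (lt_le_trans a1)//= (le_lt_trans xb).
  have [c _] : exists2 c, c \in `]a, b[%R & S b - S a = f c * (b - a).
    apply: MVT => //.
      by move=> x xab; apply: HS; apply: abe; exact: subset_itv_oo_cc xab.
    apply: continuous_in_subspaceT => x; rewrite inE /= => xab.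
    by apply: is_derive_cont (HS x (abe x xab)).
  by move=> E; rewrite -subr_gt0 E mulr_gt0// subr_gt0.
have inj (a b : R) : `|a| < 2 * e -> `|b| < 2 * e -> S a = S b -> a = b.
  move=> ae be E; apply/eqP; rewrite eq_le !leNgt; apply/andP; split; apply/negP.
    by move=> /(incr _ _ be ae); rewrite E ltxx.
  by move=> /(incr _ _ ae be); rewrite E ltxx.
have eN : `|- e| < 2 * e by rewrite normrN le2// gtr0_norm.
have eP : `|e| < 2 * e by rewrite le2// gtr0_norm.
have mem (t : R) : `|t| < e -> S (- e) < S t < S e.
  move=> /[dup] /ltW/le2 t2; rewrite ltr_norml => /andP[t1 te].
  by rewrite !incr.
have surj u : exists t : R, S (- e) < u < S e -> `|t| < e /\ S t = u.
  have [uJ|uJ] := pselect (S (- e) < u < S e); last by exists 0.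
  have ee : - e <= e by rewrite -subr_ge0 opprK addr_ge0// ltW.
  have [| |t tI Et] := @IVT R S (- e) e u ee.
  - apply: continuous_in_subspaceT => x; rewrite inE /= in_itv /= => /andP[x1 x2].
    by apply: is_derive_cont (HS x (le2 _ _)); rewrite ler_norml x1.
  - have SS : S (- e) <= S e by case/andP: uJ => u1 u2; exact: ltW (lt_trans u1 u2).
    by rewrite (min_l SS) (max_r SS); case/andP: uJ => u1 u2; rewrite !ltW.
  exists t => _; split=> //; move: tI; rewrite in_itv /= => /andP[t1 t2].
  rewrite ltr_norml !lt_neqAle t1 t2 !andbT; apply/andP; split; apply/eqP => tE.
    by move: uJ; rewrite -Et -tE ltxx.
  by move: uJ; rewrite -Et tE ltxx andbF.
have [tau Htau] := choice surj.
pose J := [set u | S (- e) < u < S e].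
have JE : J = [set` `]S (- e), S e[ ].
  by apply/seteqP; split=> u; rewrite /J /= in_itv.
have oJ : open J by rewrite JE; exact: interval_open.
have tauS (t : R) : `|t| < e -> tau (S t) = t.
  move=> te; have [tau1 tau2] := Htau _ (mem t te).
  by apply: inj => //; apply: le2; exact: ltW.
have Dtau u : J u -> is_derive u 1 tau (h (tau u)).
  move=> Ju; have [te Et] := Htau u Ju.
  rewrite -{1}Et -[h _]invrK; apply: is_derive_inverse.
  - have : \forall s \near tau u, `|s| < e.
      have oe : open [set s : R | `|s| < e] by apply: open_norm_lt; exact: Ck_id.
      exact: (open_nbhs_nbhs (conj oe te)).
    by apply: filterS => s; exact: tauS.
  - have : \forall s \near tau u, `|s| < e.
      have oe : open [set s : R | `|s| < e] by apply: open_norm_lt; exact: Ck_id.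
      exact: (open_nbhs_nbhs (conj oe te)).
    by apply: filterS => s se; exact: is_derive_cont (HS s (le2 _ (ltW se))).
  - have := HS (tau u) (le2 _ (ltW te)); rewrite /f clampE//; exact: ltW.
  - by rewrite invr_neq0// gt_eqF// h0// le2// ltW.
exists J, tau; split.
- split=> //; first by rewrite JE; exact: interval_is_interval.
  by exists (S 0); apply: mem; rewrite normr0.
- pose B := [set q : (R * R) * R | `|q.2| < 2 * e].
  have oB : open B by apply: open_norm_lt; exact: Ck_snd_op.
  apply: (@Cinf_bootstrap R R R J tau B (fun q => q.1.2 * h q.2)) => //.
    move=> k; apply: Ck_mul => //.
      by apply: Ck_snd => //; exact: Ck_fst_op.
    exact: (Ck_comp oB oI (fun q => id) (@Ck_snd_op _ k _ _ _) (Ch k)).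
  move=> u Ju; have [dt et] := is_derive_diff (Dtau u Ju); split=> // w.
  split; last exact: et.
  by rewrite /B /= le2//; have [/ltW] := Htau u Ju.
- by move=> u Ju; split; [have [] := Htau u Ju|exact: Dtau].
- by move=> t te; exists (S t); [exact: mem|exact: tauS].
Qed.

End Reparametrization.

(** * Second derivatives and bump functions *)

Section Schwarz.
Context {R : realType}.
Implicit Types V W : normedModType R.

(** Apply the mean value inequality to t |-> f (p + s w + t s v) - f (p + t s
    v), whose derivative is the increment of s df(v) in the direction s w. *)
Lemma second_difference V W (f : V -> W) (p v w : V) (r : R) : 0 < r ->
  (forall x, `|x - p| < r -> differentiable f x) ->
  differentiable (fun x => 'd f x v) p ->
  forall e : R, 0 < e -> exists2 del : R, 0 < del & forall s : R, 0 < s -> s < del ->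
    `|f (p + s *: v + s *: w) - f (p + s *: v) - (f (p + s *: w) - f p)
      - s ^+ 2 *: 'd (fun x => 'd f x v) p w| <= e * s ^+ 2.
Proof.
move=> r0 df dh e e0.
set h := fun x => 'd f x v in dh *.
pose c := `|v| + `|w| + 1.
have c0 : 0 < c by rewrite ltr_wpDl// addr_ge0.
have e10 : 0 < e / (2 * c) by rewrite divr_gt0// mulr_gt0.
have /nearP[rho rho0 Hrho] := diff_epsilon dh e10.
pose del := Num.min r rho / c.
have del0 : 0 < del by rewrite divr_gt0// lt_min r0.
exists del => // s s0 sdel.
have sc : s * c < r /\ s * c < rho.
  have : s * c < Num.min r rho by rewrite -ltr_pdivlMr.
  by rewrite lt_min => /andP[].
have u1 (t : R) : 0 <= t <= 1 -> `|s *: w + t *: (s *: v)| < s * c.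
  move=> /andP[t0 t1]; apply: le_lt_trans (ler_normD _ _) _.
  rewrite !normrZ (gtr0_norm s0) (ger0_norm t0).
  have : t * (s * `|v|) <= s * `|v| by rewrite ler_piMl// mulr_ge0// ltW.
  by rewrite /c; move: s0; lra.
have u2 (t : R) : 0 <= t <= 1 -> `|t *: (s *: v)| < s * c.
  move=> /andP[t0 t1].
  rewrite !normrZ (gtr0_norm s0) (ger0_norm t0).
  have : t * (s * `|v|) <= s * `|v| by rewrite ler_piMl// mulr_ge0// ltW.
  by have : 0 <= s * `|w|; [rewrite mulr_ge0// ltW|]; rewrite /c; move: s0; lra.
have D1 (t : R) : 0 <= t <= 1 -> differentiable f (p + s *: w + t *: (s *: v)).
  move=> t01; apply: df; rewrite -(addrA p) addrAC subrr add0r.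
  exact: lt_trans (u1 t t01) sc.1.
have D2 (t : R) : 0 <= t <= 1 -> differentiable f (p + t *: (s *: v)).
  move=> t01; apply: df; rewrite addrAC subrr add0r.
  exact: lt_trans (u2 t t01) sc.1.
pose dd (t : R) := f (p + s *: w + t *: (s *: v)) - f (p + t *: (s *: v))
   - t *: (s ^+ 2 *: 'd h p w).
pose dd' (t : R) := 'd f (p + s *: w + t *: (s *: v)) (s *: v)
   - 'd f (p + t *: (s *: v)) (s *: v) - s ^+ 2 *: 'd h p w.
have := @mean_value_le R W dd dd' 1 (e * s ^+ 2).
move=> /(_ _ _ 1)/wrap[||].
- move=> t t01; have E1 := is_derive_line (D1 t t01); have E2 := is_derive_line (D2 t t01).
  have E3 : is_derive t 1 (fun t : R => t *: (s ^+ 2 *: 'd h p w)) (s ^+ 2 *: 'd h p w).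
    apply: near_is_derive => a a0; exists 1 => // u _.
    by rewrite -scalerBl subrr normr0 mulr_ge0// ltW.
  by apply: is_deriveB; exact: is_deriveB.
- move=> t t01.
  have hE x : 'd f x (s *: v) = s *: h x by rewrite linearZ.
  have -> : dd' t = s *: ((h (p + (s *: w + t *: (s *: v))) - h p - 'd h p (s *: w + t *: (s *: v)))
     - (h (p + t *: (s *: v)) - h p - 'd h p (t *: (s *: v)))).
    rewrite /dd' !hE -(addrA p) subrBB (subrBB (h _) (h p) (h (p + t *: _))) subrr subr0.
    have -> : 'd h p (s *: w + t *: (s *: v)) - 'd h p (t *: (s *: v)) = s *: 'd h p w.
      by rewrite -linearB addrK linearZ.
    have -> // (a b d : W) : s *: (a - b - s *: d) = s *: a - s *: b - s ^+ 2 *: d.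
    by rewrite 2!scalerBr scalerA -expr2.
  rewrite normrZ (gtr0_norm s0).
  have B1 := Hrho (s *: w + t *: (s *: v)); rewrite subr0 in B1.
  have B2 := Hrho (t *: (s *: v)); rewrite subr0 in B2.
  have {}B1 := B1 (lt_trans (u1 t t01) sc.2).
  have {}B2 := B2 (lt_trans (u2 t t01) sc.2).
  apply: (@le_trans _ _ (s * (e / (2 * c) * (s * c) + e / (2 * c) * (s * c)))).
    rewrite ler_pM2l//; apply: le_trans (ler_normB _ _) _; apply: lerD.
      by apply: le_trans B1 _; rewrite ler_pM2l// ltW// u1.
    by apply: le_trans B2 _; rewrite ler_pM2l// ltW// u2.
  rewrite le_eqVlt; apply/orP; left; apply/eqP; field.
  by rewrite gt_eqF.
rewrite ler01 lexx mulr1 => /(_ isT); apply: le_trans.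
rewrite /dd !scale1r !scale0r !addr0 subr0.
rewrite (addrAC p (s *: v)).
by rewrite [X in _ <= `|X|]addrAC.
Qed.

(** Up to the scale s^2 both sides are limits of the same second difference,
    which is symmetric in v and w. *)
Lemma diff_diff_sym V W (A : set V) (f : V -> W) (p v w : V) :
  open A -> Ck 2 A f -> A p ->
  'd (fun x => 'd f x v) p w = 'd (fun x => 'd f x w) p v.
Proof.
move=> oA /CkSP[df /CkSP[dT _]] Ap.
have /nearP[r r0 Hr] := open_nbhs_nbhs (conj oA Ap).
have dfr x : `|x - p| < r -> differentiable f x by move=> /Hr/df.
have dh u : differentiable (fun x => 'd f x u) p.
  have Cu : Ck 1 setT (fun x : V => (x, u)).
    by apply: Ck_pair; [exact: openT|exact: Ck_id|exact: Ck_cst].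
  have /CkSP[d1 _] := Cu.
  have d2 := differentiable_comp (d1 p I) (dT (p, u) Ap).
  have /CkSP[d3 _] := @Ck_snd_op R 1 W W setT.
  exact: (differentiable_comp d2 (d3 _ I)).
apply/eqP; rewrite -subr_eq0 -normr_le0; apply/ler_addgt0Pr => e e0; rewrite add0r.
have e20 : 0 < e / 2 by rewrite divr_gt0.
have [d1 d10 H1] := second_difference w r0 dfr (dh v) e20.
have [d2 d20 H2] := second_difference v r0 dfr (dh w) e20.
pose s := Num.min d1 d2 / 2.
have m0 : 0 < Num.min d1 d2 by rewrite lt_min d10.
have s0 : 0 < s by rewrite divr_gt0.
have sm : s < Num.min d1 d2 by rewrite ltr_pdivrMr// mulr_natr mulr2n ltrDl.
have m1 : Num.min d1 d2 <= d1 by rewrite ge_min lexx.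
have m2 : Num.min d1 d2 <= d2 by rewrite ge_min lexx orbT.
have {}H1 := H1 s s0 (lt_le_trans sm m1).
have {}H2 := H2 s s0 (lt_le_trans sm m2).
have s20 : 0 < s ^+ 2 by rewrite exprn_gt0.
rewrite -(ler_pM2l s20) -[X in X * `|_| <= _]gtr0_norm// -normrZ scalerBr.
rewrite (addrAC p (s *: w)) subrBB in H2.
rewrite -(subrKA (f (p + s *: v + s *: w) - f (p + s *: v) - (f (p + s *: w) - f p))).
apply: le_trans (ler_normD _ _) _; rewrite distrC.
by move: H1 H2; lra.
Qed.

End Schwarz.

Section Bump.
Context {R : realType}.

(** The functions t^-m exp (- 1/t), extended by zero. The parameter m makes
    the family closed under differentiation up to linear combinations. *)
Definition flat (m : nat) (t : R) : R :=
  if 0 < t then t^-1 ^+ m * expR (- t^-1) else 0.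

(** From exp (1/t) >= (1/t)^(m + 2) / (m + 2)!. The quadratic bound gives the
    derivative at 0. *)
Lemma flat_le (m : nat) (t : R) : 0 <= flat m t <= (m.+2)`!%:R * t ^+ 2.
Proof.
rewrite /flat; have [t0|t0] := ltP 0 t; last first.
  by rewrite lexx/= mulr_ge0 ?sqr_ge0 ?ler0n.
have i0 : 0 < t^-1 by rewrite invr_gt0.
apply/andP; split; first by rewrite mulr_ge0 ?expR_ge0// exprn_ge0// ltW.
rewrite expRN ler_pdivrMr ?expR_gt0//.
have H := expR_ge1Dxn m.+1 (ltW i0).
have c0 : 0 < ((m.+2)`!%:R : R) by rewrite ltr0n fact_gt0.
apply: (@le_trans _ _ ((m.+2)`!%:R * t ^+ 2 * (t^-1 ^+ m.+2 / (m.+2)`!%:R))).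
  rewrite le_eqVlt; apply/orP; left; apply/eqP.
  by rewrite !exprS; field; rewrite !gt_eqF.
have q0 : 0 <= (m.+2)`!%:R * t ^+ 2 by apply: mulr_ge0; [exact: ltW|exact: sqr_ge0].
by apply: ler_wpM2l => //; apply: le_trans H; rewrite lerDr.
Qed.

Lemma is_derive_flat (m : nat) (t : R) :
  is_derive t 1 (flat m) (flat m.+2 t - m%:R * flat m.+1 t).
Proof.
have [t0|t0] := ltP 0 t; last first.
  have -> : flat m.+2 t - m%:R * flat m.+1 t = 0.
    by rewrite /flat ltNge t0 /= mulr0 subr0.
  have ft : flat m t = 0 by rewrite /flat ltNge t0.
  apply: near_is_derive => e e0.
  pose c : R := (m.+2)`!%:R.
  have c0 : 0 < c by rewrite ltr0n fact_gt0.
  exists (e / c); rewrite ?divr_gt0// => s st.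
  rewrite ft subr0 scaler0 subr0; have /andP[f0 fs] := flat_le m s.
  rewrite ger0_norm//; have [s0|s0] := ltP 0 s; last first.
    by rewrite {1}/flat ltNge s0 /= mulr_ge0// ltW.
  have ss : s <= `|s - t| by rewrite ler_normr lerBrDr gerDl t0.
  apply: le_trans fs _; rewrite -/c.
  have h : c * `|s - t| <= e by rewrite mulrC -ler_pdivlMr// ltW.
  apply: (@le_trans _ _ (c * `|s - t| * `|s - t|)).
    by rewrite -mulrA -expr2 ler_pM2l// ler_pXn2r ?nnegrE// ltW.
  by rewrite ler_wpM2r.
have tn0 : t != 0 by rewrite gt_eqF.
have Dinv : is_derive t 1 (fun s : R => s^-1) (- (t^-1 ^+ 2)).
  have [d e] : differentiable (GRing.inv : R -> R) t /\ 'd (GRing.inv : R -> R) t 1 = - (t^-1 ^+ 2).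
    split; first exact: differentiable_Rinv.
    by rewrite diff_Rinv// exprVn scaler1.
  by rewrite -e; exact: diff_is_derive.
have Dexp : is_derive t 1 (fun s : R => expR (- s^-1)) (expR (- t^-1) * (t^-1 ^+ 2)).
  have DN : is_derive t 1 (fun s : R => - s^-1) (t^-1 ^+ 2).
    by have := is_deriveN Dinv; rewrite opprK.
  exact: (@is_derive1_comp R expR (fun s => - s^-1) t _ _ (is_derive_expR _) DN).
have Dpow : is_derive t 1 (fun s : R => s^-1 ^+ m) (- (m%:R * t^-1 ^+ m.+1)).
  have := is_deriveX m Dinv; case: m => [|m].
    by move=> _; rewrite mul0r oppr0; apply: near_is_derive => e e0; exists 1 => // s _;
      rewrite !expr0 scaler0 subrr subr0 normr0 mulr_ge0// ltW.
  rewrite /= => D; rewrite (_ : - _ = (m.+1%:R * t^-1 ^+ m) *: (- (t^-1 ^+ 2)))//.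
    by have -> : (fun s : R => s^-1 ^+ m.+1) = (fun s : R => s^-1) ^+ m.+1 by rewrite exprfctE.
  by rewrite /GRing.scale /= mulrN -mulrA -exprD addn2.
have DM := is_deriveM Dpow Dexp.
have nF : \near t, ((fun s : R => s^-1 ^+ m) * (fun s : R => expR (- s^-1))) t = flat m t.
  have : \forall s \near t, 0 < s by exact: (open_nbhs_nbhs (conj (@open_gt R 0) t0)).
  by apply: filterS => s s0; rewrite /flat s0.
have := near_eq_is_derive nF DM.
rewrite (_ : _ + _ = flat m.+2 t - m%:R * flat m.+1 t)//.
by rewrite /flat t0 /GRing.scale /= !exprS; ring.
Qed.

Lemma Cinf_flat (m : nat) : Cinf setT (flat m).
Proof.
move=> k; elim: k m => [|k IH] m.
  by move=> t _; exact: is_derive_cont (is_derive_flat m t).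
apply/CkSP; split=> [t _|]; first by have [] := is_derive_diff (is_derive_flat m t).
have oT : open (fst @^-1` setT : set (R * R)) by apply: open_fst; exact: openT.
have C1 j : Ck k (fst @^-1` setT) (fun p : R * R => flat j p.1).
  exact: (Ck_on_fst R openT (IH j)).
have := Ck_pair oT (C1 m) (Ck_mul oT (@Ck_snd_op R k R R _)
  (Ck_sub_fun oT (C1 m.+2) (Ck_mul oT (@Ck_cst R k _ _ _ (m%:R : R)) (C1 m.+1)))).
apply: eq_Ck => // -[t w] _ /=; congr pair.
by have [_ ->] := is_derive_diff (is_derive_flat m t).
Qed.

(** A product over the coordinates, so that the support is a coordinate box.
    *)
Lemma bump_function n (x0 : 'rV[R]_n) (r : R) : 0 < r ->
  exists b : 'rV[R]_n -> R, [/\ Cinf setT b, b x0 = 1 &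
    forall x, b x != 0 -> forall i, `|x 0 i - x0 0 i| < r].
Proof.
move=> r0.
pose g (x : 'rV[R]_n) := \prod_i flat 0 (r ^+ 2 - (x 0 i - x0 0 i) ^+ 2).
have Cg k : Ck k setT g.
  have oT : open (setT : set 'rV[R]_n) by exact: openT.
  apply: Ck_prod => // i.
  have C1 : Ck k setT (fun x : 'rV[R]_n => x 0 i - x0 0 i).
    by apply: Ck_sub_fun => //; [apply: Ck_coord => //; exact: Ck_id|exact: Ck_cst].
  have C2 : Ck k setT (fun x : 'rV[R]_n => r ^+ 2 - (x 0 i - x0 0 i) * (x 0 i - x0 0 i)).
    by apply: Ck_sub_fun => //; [exact: Ck_cst|exact: Ck_mul].
  exact: (Ck_comp oT openT (fun=> fun=> I) C2 (Cinf_flat 0 k)).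
have g0 : g x0 != 0.
  rewrite /g; apply/prodf_neq0 => i _; rewrite subrr expr0n subr0 /flat exprn_gt0//.
  by rewrite mul1r gt_eqF// expR_gt0.
exists (fun x => (g x0)^-1 * g x); split.
- by move=> k; apply: Ck_mul; [exact: openT|exact: Ck_cst|exact: Cg].
- by rewrite mulVf.
- move=> x; rewrite mulf_eq0 negb_or => /andP[_ /prodf_neq0 H] i.
  have := H i isT; rewrite /flat; case: ifP => [|_]; last by rewrite eqxx.
  rewrite subr_gt0 -real_normK ?num_real// => h _.
  by rewrite ltr_pXn2r in h; rewrite ?nnegrE// ltW.
Qed.

End Bump.

(** * Coordinate expressions on manifolds *)

Section Charts.
Variable R : realType.

Lemma is_derive_chain (V W : normedModType R) (f : V -> W) (y : R -> V) (t : R)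
    (y' : V) : is_derive t 1 y y' -> differentiable f (y t) ->
  is_derive t 1 (fun s => f (y s)) ('d f (y t) y').
Proof.
move=> /is_derive_diff[dy Ey] df.
have <- : 'd (f \o y) t 1 = 'd f (y t) y'.
  by rewrite (diff_comp dy df) -[y' in RHS]scale1r -Ey.
exact/diff_is_derive/differentiable_comp.
Qed.

Lemma diff_at_scale (V W : normedModType R) (f : V -> W) (x v : V) (k : R) :
  'd f x (k *: v) = k *: 'd f x v.
Proof. by rewrite linearZ. Qed.

Lemma Ck_diff_at k (V W Z : normedModType R) (B : set Z) (A : set V)
    (f : V -> W) (x w : Z -> V) : open B -> open A -> Ck k.+1 A f ->
  B `<=` x @^-1` A -> Ck k B x -> Ck k B w ->
  Ck k B (fun z => 'd f (x z) (w z)).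
Proof.
move=> oB oA Cf BA Cx Cw.
have C : Ck k B (fun z => (x z, w z)) by exact: Ck_pair.
have [_ Cd] := (CkSP _ _ _).1 Cf.
have := @Ck_comp _ k _ _ _ B _ _ _ oB (open_fst oA) _ C Cd.
move=> /(_ BA)/(Ck_snd oB); exact.
Qed.

Section OnManifold.
Variables (n : nat) (M : manifold R n).
Implicit Types b c : mchart M.

Lemma cinvK (T : topologicalType) (c : chart R T n) x : (c @` cdom c) x ->
  cdom c (cinv c x) /\ c (cinv c x) = x.
Proof. by move=> [p cp <-]; rewrite cmapK. Qed.

Lemma open_chart_image (T : topologicalType) (c : chart R T n) (S : set T) :
  open S -> open (c @` (cdom c `&` S)).
Proof.
move=> oS; rewrite openE => _ [p [cp Sp] <-].
have Ip : (c @` cdom c) (c p) by exists p.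
have ci := cinv_continuous Ip.
have nS : nbhs (cinv c (c p)) S by rewrite cmapK //; exact: open_nbhs_nbhs.
have nI : nbhs (c p) (c @` cdom c).
  by apply: open_nbhs_nbhs; split => //; exact: cimg_open.
apply: filterS2 nI (ci _ nS) => _ [q cq <-] /=; rewrite cmapK // => Sq.
by exists q.
Qed.

End OnManifold.

Lemma open_locdom (S T : topologicalType) m n (F : S -> T) (b : chart R S m)
    (c : chart R T n) : continuous F -> open (locdom F b c).
Proof.
move=> cF; apply: open_chart_image; apply: open_comp; last exact: cdom_open.
by move=> x _; exact: cF.
Qed.

Lemma locdomP (S T : topologicalType) m n (F : S -> T) (b : chart R S m)
    (c : chart R T n) x : locdom F b c x <->
  (b @` cdom b) x /\ cdom c (F (cinv b x)).
Proof.
split=> [[p [bp cp] <-]|[[p bp <-]]].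
  by rewrite cmapK //; split => //; exists p.
by rewrite cmapK // => cp; exists p.
Qed.

Lemma smooth_map_id n (M : manifold R n) : smooth_map (@id M).
Proof. by split=> [x//|b c ab ac]; exact: (atlas_compatible ab ac).1. Qed.

Lemma Cinf_loc m n (N : manifold R m) (M : manifold R n) (F : N -> M)
    (b : mchart N) (c : mchart M) : smooth_map F -> atlas b -> atlas c ->
  Cinf (locdom F b c) (loc F b c).
Proof. by move=> [cF sF] ab ac; apply: smooth_on_Cinf; [exact: open_locdom|exact: sF]. Qed.

Lemma differentiable_loc m n (N : manifold R m) (M : manifold R n) (F : N -> M)
    (b : mchart N) (c : mchart M) x : smooth_map F -> atlas b -> atlas c ->
  locdom F b c x -> differentiable (loc F b c) x.
Proof. by move=> sF ab ac Lx; have [+ _] := (CkSP _ _ _).1 (Cinf_loc sF ab ac 1%N); exact. Qed.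

Lemma locdom_chart m n (N : manifold R m) (M : manifold R n) (F : N -> M) q
    (b : mchart N) (c : mchart M) : chart_at q b -> chart_at (F q) c ->
  locdom F b c (b q).
Proof. by move=> [_ bq] [_ cq]; exists q. Qed.

(** Both sides are the differential of one composition of coordinate
    expressions. *)
Lemma diff_loc_trans m n p (L : manifold R m) (N : manifold R n) (M : manifold R p)
    (G : L -> N) (F : N -> M) (q : L) (a : mchart L) (b : mchart N) (c : mchart M) w :
  smooth_map G -> smooth_map F ->
  chart_at q a -> chart_at (G q) b -> chart_at (F (G q)) c ->
  'd (loc (F \o G) a c) (a q) w = 'd (loc F b c) (b (G q)) ('d (loc G a b) (a q) w).
Proof.
move=> sG sF qa qb qc; have [[aa aq] [[ab bq] [ac cq]]] := (qa, (qb, qc)).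
have Lq := locdom_chart qa qb.
have E : loc G a b (a q) = b (G q) by rewrite /loc cmapK.
have dG := differentiable_loc sG aa ab Lq.
have dF : differentiable (loc F b c) (loc G a b (a q)).
  by rewrite E; apply: differentiable_loc => //; exact: locdom_chart.
have nE : \forall x \near a q, (loc F b c \o loc G a b) x = loc (F \o G) a c x.
  have := open_nbhs_nbhs (conj (open_locdom sG.1) Lq).
  apply: filterS => x /locdomP[_ bx].
  by rewrite /loc /= cmapK.
have [_ ->] := near_eq_diff nE (differentiable_comp dG dF).
rewrite -[in RHS]E.
rewrite (diff_comp dG dF).
reflexivity.
Qed.

Lemma diff_id_loc n (M : manifold R n) (p : M) (c : mchart M) w : chart_at p c ->
  'd (loc (@id M) c c) (c p) w = w.
Proof.
move=> [ac cp].
have nE : \forall x \near c p, id x = loc (@id M) c c x.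
  have /open_nbhs_nbhs : open_nbhs (c p) (c @` cdom c).
    by split; [exact: cimg_open|exists p].
  by apply: filterS => x /cinvK[_ e]; rewrite /loc e.
have [_ ->] := near_eq_diff nE (@ex_diff _ _ _ _ _ _ _ (is_diff_id (c p))).
by rewrite diff_val.
Qed.

Lemma diff_loc_id_trans m n (N : manifold R m) (M : manifold R n) (F : N -> M)
    (q : N) (b : mchart N) (c c' : mchart M) w : smooth_map F ->
  chart_at q b -> chart_at (F q) c -> chart_at (F q) c' ->
  'd (loc F b c') (b q) w = 'd (loc id c c') (c (F q)) ('d (loc F b c) (b q) w).
Proof.
by move=> sF qb qc qc'; exact: (diff_loc_trans w sF (smooth_map_id M) qb qc qc').
Qed.

(** The opposite change of charts is a left inverse. *)
Lemma diff_transition_inj n (M : manifold R n) (p : M) (b c : mchart M) w :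
  chart_at p b -> chart_at p c -> 'd (loc (@id M) b c) (b p) w = 0 -> w = 0.
Proof.
move=> pb pc e; rewrite -(diff_id_loc w pb).
apply: (eq_trans (diff_loc_id_trans w (smooth_map_id M) pb pc pb)).
have d0 u : u = 0 -> 'd (loc (@id M) c b) (c p) u = 0 by move=> ->; exact: linear0.
exact: d0.
Qed.

Section CoordinateCurve.
Variables (m n : nat) (N : manifold R m) (M : manifold R n) (F : N -> M).
Variables (b : mchart N) (I : set R) (x : R -> 'rV[R]_m).
Hypotheses (sF : smooth_map F) (ab : atlas b) (oI : open I) (Cx : Cinf I x).
Hypothesis xb : forall t, I t -> (b @` cdom b) (x t).

Lemma coordinate_curve_near t (c : mchart M) : I t ->
  atlas c -> cdom c (F (cinv b (x t))) ->
  \forall s \near t, I s /\ locdom F b c (x s).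
Proof.
move=> It ac ct.
have ct' : {for t, continuous x} by exact: (Ck_continuous (Cx 0%N)).
have Lt : locdom F b c (x t) by apply/locdomP; split => //; exact: xb.
have := ct' _ (open_nbhs_nbhs (conj (open_locdom sF.1) Lt)).
by apply: filterS2 (open_nbhs_nbhs (conj oI It)).
Qed.

Lemma smooth_coordinate_curve : smooth_curve I (fun t => F (cinv b (x t))).
Proof.
have cont t : I t -> {for t, continuous (fun t => F (cinv b (x t)))}.
  move=> It; have ct' : {for t, continuous x} by exact: (Ck_continuous (Cx 0%N)).
  apply: (@continuous_comp _ _ _ (fun s => cinv b (x s)) F) => [|]; last exact: sF.1.
  apply: (@continuous_comp _ _ _ x (cinv b)) => //; exact/cinv_continuous/xb.
split=> // c ac.
have oA : open (I `&` (fun t => F (cinv b (x t))) @^-1` cdom c).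
  rewrite openE => t [It ct]; apply: filterS (coordinate_curve_near It ac ct).
  by move=> s [Is /locdomP[_ cs]].
apply: Cinf_smooth_on => // k.
apply: (@Ck_comp _ k _ _ _ _ _ x (loc F b c) oA (@open_locdom _ _ _ _ _ b c sF.1)).
- by move=> t [It ct]; apply/locdomP; split => //; exact: xb.
- by apply: Ck_sub (Cx k) => t [].
- exact: Cinf_loc.
Qed.

Lemma is_derive_coordinate_curve t x' (c : mchart M) : I t -> is_derive t 1 x x' ->
  atlas c -> cdom c (F (cinv b (x t))) ->
  is_derive t 1 (fun s => c (F (cinv b (x s)))) ('d (loc F b c) (x t) x').
Proof.
move=> It dx ac ct; apply: (is_derive_chain (f := loc F b c)) => //.
by apply: differentiable_loc => //; apply/locdomP; split => //; exact: xb.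
Qed.

Lemma velocity_coordinate_curve t x' (c : mchart M) : I t -> is_derive t 1 x x' ->
  atlas c -> cdom c (F (cinv b (x t))) ->
  velocity (fun s => F (cinv b (x s))) t c = 'd (loc F b c) (x t) x'.
Proof.
move=> It dx ac ct; rewrite /velocity derive1E.
by have [_ ->] := is_derive_coordinate_curve It dx ac ct.
Qed.

End CoordinateCurve.

(** A product of segments. *)
Lemma compact_coordinate_box n (y : 'rV[R]_n) (r : R) :
  compact [set x : 'rV[R]_n | forall i, `|x 0 i - y 0 i| <= r].
Proof.
have := @rV_compact _ n (fun i => `[y 0 i - r, y 0 i + r]%classic : set R).
move=> /(_ (fun i => @segment_compact _ _ _)).
congr compact; apply/seteqP; split => x h i; have := h i.
  by rewrite /= in_itv /= ler_distl.
by rewrite /= in_itv /= ler_distl.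
Qed.

Section Extension.
Variables (n : nat) (M : manifold R n).

(** A vector at p spreads to a field with constant components in the chart c.
    A bump function extends it by zero: its support is compact, hence closed
    because M is Hausdorff, so each point has a neighbourhood inside the chart
    or one off the support. *)
Lemma vfield_through (p : M) (c : mchart M) (a : 'rV[R]_n) : chart_at p c ->
  exists X : vfield M, X p c = a.
Proof.
move=> pc; have [ac cp] := pc.
have Ip : nbhs (c p) (c @` cdom c).
  by apply: open_nbhs_nbhs; split; [exact: cimg_open|exists p].
have [r0 r00 hr0] := (nearP _ _).1 Ip.
pose r := r0 / 2.
have r_gt0 : 0 < r by rewrite /r; lra.
have [f [Cf fp fr]] := bump_function (c p) r_gt0.
pose K0 : set 'rV[R]_n := [set x | forall i, `|x 0 i - c p 0 i| <= r].
have K0I x : K0 x -> (c @` cdom c) x.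
  move=> kx; apply: hr0; have := (cubeP (x - c p) r00).1; apply=> i.
  by rewrite !mxE; have := kx i; rewrite /r; lra.
have clK : closed (cinv c @` K0).
  apply: compact_closed; first exact: mspace_hausdorff.
  apply: continuous_compact; last exact: compact_coordinate_box.
  apply: continuous_in_subspaceT => x /set_mem kx; exact/cinv_continuous/K0I.
pose X (q : M) (c' : mchart M) : 'rV[R]_n :=
  if `[< cdom c q >] then f (c q) *: 'd (loc (@id M) c c') (c q) a else 0.
have Xin q c' : cdom c q -> X q c' = f (c q) *: 'd (loc (@id M) c c') (c q) a.
  by move=> cq; rewrite /X; case: asboolP.
(* X vanishes off the compact set also at points of the chart; this is what
   makes it smooth across the boundary. *)
have Xout q c' : ~ (cinv c @` K0) q -> X q c' = 0.
  rewrite /X; case: asboolP => // cq nK.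
  have [-> | /fr h] := eqVneq (f (c q)) 0; first by rewrite scale0r.
  by case: nK; exists (c q); [move=> i; exact/ltW/h|rewrite cmapK].
have Xt q : tangent q (X q).
  move=> b1 c1 qb qc; rewrite /X; case: asboolP => [cq|_]; last by rewrite linear0.
  apply: (eq_trans _ (esym (diff_at_scale _ _ _ _))); congr (_ *: _).
  exact: (diff_loc_id_trans a (smooth_map_id M)).
have Xs (b1 c1 : mchart M) : atlas b1 -> atlas c1 ->
    smooth_on (locdom (fun p : M => p) b1 c1) (fun x => X (cinv b1 x) c1).
  move=> ab1 ac1; have oL : open (locdom (@id M) b1 c1) by apply: open_locdom => ?.
  apply: Cinf_smooth_on => // k; apply: Ck_local => // x Lx.
  have /locdomP[Ix c1x] := Lx.
  have [b1x ex] := cinvK Ix.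
  have [cx|ncx] := pselect (cdom c (cinv b1 x)).
    have oB : open (b1 @` (cdom b1 `&` (cdom c `&` cdom c1))).
      by apply: open_chart_image; apply: openI; exact: cdom_open.
    exists (b1 @` (cdom b1 `&` (cdom c `&` cdom c1))); split=> //.
      by exists (cinv b1 x).
    apply: (@eq_Ck _ k _ _ _ (fun y => f (loc (@id M) b1 c y) *:
        'd (loc (@id M) c c1) (loc (@id M) b1 c y) a)) => //.
      by move=> _ [q [bq [cq c1q]] <-]; rewrite /loc /= cmapK // Xin.
    have Cc : Ck k (b1 @` (cdom b1 `&` (cdom c `&` cdom c1))) (loc (@id M) b1 c).
      apply: Ck_sub (Cinf_loc (smooth_map_id M) ab1 ac k) => _ [q [bq [cq _]] <-].
      by exists q.
    apply: Ck_scale => //; first exact: (Ck_comp oB openT (fun _ _ => I) Cc (Cf k)).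
    have oT : open (locdom (@id M) c c1) by apply: open_locdom => ?.
    apply: (Ck_diff_at oB oT (Cinf_loc (smooth_map_id M) ac ac1 k.+1)) => //.
    - by move=> _ [q [bq [cq c1q]] <-]; rewrite /= /loc /= cmapK //; exists q.
    - exact: Ck_cst.
  have oB : open (b1 @` (cdom b1 `&` ~` (cinv c @` K0))).
    by apply: open_chart_image; exact: closed_openC.
  exists (b1 @` (cdom b1 `&` ~` (cinv c @` K0))); split=> //.
    exists (cinv b1 x) => //; split=> // -[y /K0I/cinvK[cy _] e].
    by apply: ncx; rewrite -e.
  apply: (@eq_Ck _ k _ _ _ (cst 0)) => //; last exact: Ck_cst.
  by move=> _ [q [bq nK] <-]; rewrite cmapK // Xout.
exists (VFieldAlong Xt Xs); rewrite /= Xin // fp scale1r.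
exact: diff_id_loc.
Qed.

Lemma concircular_pointwise (g : metric M) (V : vfield M) : concircular g V ->
  exists f : M -> R, forall (p : M) (c : mchart M), chart_at p c -> forall a,
    'd (fun x => V (cinv c x) c) (c p) a + christoffel_form g p c a (V p c)
    = f p *: a.
Proof.
move=> [f _ h]; exists f => p c pc a.
by have [X <-] := vfield_through a pc; exact: h.
Qed.

End Extension.

End Charts.

(** * Derivatives along curves of bilinear expressions *)

Section MatrixCurves.
Variable R : realType.

Lemma is_derive_coord (m n : nat) (F : R -> 'M[R]_(m, n)) (t : R) (D : 'M[R]_(m, n)) i j :
  is_derive t 1 F D -> is_derive t 1 (fun s => F s i j) (D i j).
Proof.
move=> [dF <-]; rewrite derive_mx // mxE; apply: derivableP.
by move/derivable_mxP : dF; exact.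
Qed.

Lemma is_derive_bigsum (V : normedModType R) (I : Type) (r : seq I) (F : I -> R -> V)
    (D : I -> V) (t : R) : (forall i, is_derive t 1 (F i) (D i)) ->
  is_derive t 1 (fun s => \sum_(i <- r) F i s) (\sum_(i <- r) D i).
Proof.
move=> dF; elim: r => [|i r IH].
  rewrite big_nil; under eq_fun do rewrite big_nil; exact: is_derive_cst.
rewrite big_cons; under eq_fun do rewrite big_cons.
exact: is_deriveD.
Qed.

Lemma is_derive_prod_real (a b : R -> R) (t a' b' : R) :
  is_derive t 1 a a' -> is_derive t 1 b b' ->
  is_derive t 1 (fun s => a s * b s) (a' * b t + a t * b').
Proof.
move=> da db; have := is_deriveM da db; congr is_derive.
by rewrite addrC; congr (_ + _); rewrite mulrC.
Qed.

Lemma is_derive_mulmx (m n p : nat) (A : R -> 'M[R]_(m, n)) (B : R -> 'M[R]_(n, p))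
    (t : R) A' B' : is_derive t 1 A A' -> is_derive t 1 B B' ->
  is_derive t 1 (fun s => A s *m B s) (A' *m B t + A t *m B').
Proof.
move=> dA dB; apply: is_derive_mx => i j; rewrite !mxE -big_split /=.
under eq_fun do rewrite mxE.
apply: is_derive_bigsum => k.
by apply: is_derive_prod_real; exact: is_derive_coord.
Qed.

Lemma is_derive_trmx (m n : nat) (A : R -> 'M[R]_(m, n)) (t : R) A' :
  is_derive t 1 A A' -> is_derive t 1 (fun s => (A s)^T) A'^T.
Proof.
move=> dA; apply: is_derive_mx => i j; rewrite mxE.
under eq_fun do rewrite mxE; exact: is_derive_coord.
Qed.

Lemma is_derive_bilin n (G : R -> 'M[R]_n) (a b : R -> 'rV[R]_n) (t : R) G' a' b' :
  is_derive t 1 G G' -> is_derive t 1 a a' -> is_derive t 1 b b' ->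
  is_derive t 1 (fun s => bilin (G s) (a s) (b s))
    (bilin (G t) a' (b t) + bilin G' (a t) (b t) + bilin (G t) (a t) b').
Proof.
move=> dG da db.
have := is_derive_coord 0 0
  (is_derive_mulmx (is_derive_mulmx da dG) (is_derive_trmx db)).
by rewrite mulmxDl [X in is_derive _ _ _ X]mxE [X in X + _]mxE.
Qed.

Lemma bilinDl n (G : 'M[R]_n) u v w : bilin G (u + v) w = bilin G u w + bilin G v w.
Proof. by rewrite /bilin !mulmxDl mxE. Qed.

Lemma bilinDr n (G : 'M[R]_n) u v w : bilin G w (u + v) = bilin G w u + bilin G w v.
Proof. by rewrite /bilin linearD mulmxDr mxE. Qed.

Lemma bilinZl n (G : 'M[R]_n) k u w : bilin G (k *: u) w = k * bilin G u w.
Proof. by rewrite /bilin -!scalemxAl mxE. Qed.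

Lemma bilinZr n (G : 'M[R]_n) k u w : bilin G w (k *: u) = k * bilin G w u.
Proof. by rewrite /bilin linearZ /= -scalemxAr mxE. Qed.

Lemma bilin0l n (G : 'M[R]_n) u : bilin G 0 u = 0.
Proof. by rewrite /bilin !mul0mx mxE. Qed.

Lemma bilinC n (G : 'M[R]_n) u v : G^T = G -> bilin G u v = bilin G v u.
Proof.
move=> sG; rewrite /bilin -[in LHS](trmxK (u *m G *m v^T)) mxE.
by rewrite !trmx_mul trmxK sG mulmxA.
Qed.

(** The rows of J span the hyperplane orthogonal to U because they lie in it
    and both spaces have dimension n. *)
Lemma orthogonal_in_rowspace n (J : 'M[R]_(n, n.+1)) (G : 'M[R]_n.+1) (U X : 'rV[R]_n.+1) :
  row_free J -> bilin G U U != 0 -> G^T = G -> (forall w, bilin G U (w *m J) = 0) ->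
  bilin G U X = 0 -> exists z, z *m J = X.
Proof.
move=> fJ U0 sG UJ UX.
pose C := G *m U^T : 'M[R]_(n.+1, 1).
have ortho (Y : 'rV[R]_n.+1) : bilin G U Y = 0 -> Y *m C = 0.
  move=> h; apply/matrixP => i j; rewrite !ord1 [RHS]mxE -h bilinC //.
  by rewrite /bilin /C mulmxA.
have JK : (J <= kermx C)%MS.
  apply/row_subP => i; apply/sub_kermxP; apply: ortho.
  by rewrite rowE; exact: UJ.
have XK : (X <= kermx C)%MS by apply/sub_kermxP/ortho.
have rC : \rank C = 1%N.
  apply/eqP; rewrite eqn_leq rank_leq_col lt0n mxrank_eq0.
  apply: contra U0 => /eqP C0; rewrite /bilin -mulmxA -/C C0 mulmx0 mxE.
  exact: eqxx.
have eJK : (J == kermx C)%MS.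
  rewrite -(mxrank_leqif_eq JK) mxrank_ker rC subn1 /=.
  by move: fJ; rewrite /row_free.
have : (X <= J)%MS by move/eqmxP : eJK => ->.
by move=> /submxP[z ->]; exists z.
Qed.

Definition jacobian (m n : nat) (f : 'rV[R]_m -> 'rV[R]_n) (x : 'rV[R]_m) : 'M[R]_(m, n) :=
  \matrix_(i, j) 'd f x (delta_mx 0 i) 0 j.

Lemma mul_jacobian m n (f : 'rV[R]_m -> 'rV[R]_n) x w : 'd f x w = w *m jacobian f x.
Proof.
rewrite diff_delta; apply/matrixP => i j; rewrite ord1 summxE mxE.
by apply: eq_bigr => k _; rewrite !mxE.
Qed.

Lemma Ck_jacobian m n (A : set 'rV[R]_m) (f : 'rV[R]_m -> 'rV[R]_n) : open A ->
  Cinf A f -> Cinf A (jacobian f).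
Proof.
move=> oA Cf k; apply: Ck_mx => // i j; under eq_fun do rewrite mxE.
apply: Ck_coord => //; apply: (Ck_diff_at oA oA (Cf k.+1)) => //; [exact: Ck_id|exact: Ck_cst].
Qed.

Lemma row_free_jacobian m n (f : 'rV[R]_m -> 'rV[R]_n) x :
  (forall w, 'd f x w = 0 -> w = 0) -> row_free (jacobian f x).
Proof.
move=> inj; rewrite -kermx_eq0; apply/eqP/row_matrixP => i; rewrite row0.
by apply: inj; rewrite mul_jacobian -row_mul mulmx_ker row0.
Qed.

End MatrixCurves.

Section Covariant.
Variables (R : realType) (n : nat) (M : manifold R n) (g : metric M).
Variables (p : M) (c : mchart M).
Hypothesis pc : chart_at p c.
Local Notation Gam := (christoffel_form g p c).

Lemma christoffel_formC u v : Gam u v = Gam v u.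
Proof.
apply/matrixP => i k; rewrite !mxE exchange_big /=.
apply: eq_bigr => j _; apply: eq_bigr => l _.
by rewrite (christoffel_sym g _ _ _ pc) mulrAC.
Qed.

(** The connection form applied to u, acting on row vectors from the right. *)
Definition christoffel_mx (u : 'rV[R]_n) : 'M[R]_n :=
  \matrix_(j, k) \sum_i christoffel g p c k i j * u 0 i.

Lemma christoffel_formE u v : Gam u v = v *m christoffel_mx u.
Proof.
apply/matrixP => a k; rewrite !mxE exchange_big /=; apply: eq_bigr => j _.
by rewrite !mxE mulr_sumr ord1; apply: eq_bigr => i _; rewrite mulrC.
Qed.

Lemma christoffel_formZl k u v : Gam (k *: u) v = k *: Gam u v.
Proof.
apply/matrixP => a l; rewrite !mxE mulr_sumr; apply: eq_bigr => i _.
rewrite mulr_sumr; apply: eq_bigr => j _; rewrite !mxE; ring.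
Qed.

Lemma christoffel_formZr k u v : Gam u (k *: v) = k *: Gam u v.
Proof. by rewrite !christoffel_formE scalemxAl. Qed.

Lemma christoffel_formBr u v w : Gam u (v - w) = Gam u v - Gam u w.
Proof. by rewrite !christoffel_formE mulmxBl. Qed.

(** The compatibility of the Christoffel symbols with the metric, contracted
    with the velocity y'. *)
Lemma is_derive_metric_mx (y : R -> 'rV[R]_n) (t : R) y' :
  y t = c p -> is_derive t 1 y y' ->
  is_derive t 1 (fun s => g (cinv c (y s)) c)
    (christoffel_mx y' *m g p c + g p c *m (christoffel_mx y')^T).
Proof.
move=> yt dy; have [ac cp] := pc.
have oI : open (c @` cdom c) by exact: cimg_open.
have Ip : (c @` cdom c) (c p) by exists p.
have Cg : Cinf (c @` cdom c) (fun x => g (cinv c x) c).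
  by apply: smooth_on_Cinf => //; exact: gmx_smooth.
apply: is_derive_mx => i j.
have dg : differentiable (fun x => g (cinv c x) c i j) (y t).
  by have [+ _] := (CkSP _ _ _).1 (Ck_coord i j oI (Cg 1%N)); apply; rewrite yt.
have := is_derive_chain dy dg; congr is_derive.
rewrite diff_delta yt !mxE.
transitivity (\sum_k y' 0 k * dmetric g p c k i j).
  by apply: eq_bigr => k _; rewrite /dmetric deriveE // -yt.
under eq_bigr do rewrite (christoffel_metric g _ _ _ pc) mulr_sumr.
rewrite exchange_big -big_split /=; apply: eq_bigr => l _.
rewrite !mxE mulr_suml mulr_sumr -big_split /=; apply: eq_bigr => k _; ring.
Qed.

(** The product rule for a metric connection. The curve is given by its
    coordinates y, and a and b are components of vector fields along it. *)
Lemma is_derive_metric (y : R -> 'rV[R]_n) (a b : R -> 'rV[R]_n) (t : R) y' a' b' :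
  y t = c p -> is_derive t 1 y y' -> is_derive t 1 a a' -> is_derive t 1 b b' ->
  is_derive t 1 (fun s => bilin (g (cinv c (y s)) c) (a s) (b s))
    (bilin (g p c) (a' + Gam y' (a t)) (b t) + bilin (g p c) (a t) (b' + Gam y' (b t))).
Proof.
move=> yt dy da db.
have := is_derive_bilin (is_derive_metric_mx yt dy) da db; congr is_derive.
have -> : cinv c (y t) = p by rewrite yt cmapK //; case: pc.
rewrite bilinDl bilinDr -!addrA; congr (_ + _).
rewrite !christoffel_formE /bilin mulmxDr mulmxDl mxE -addrA; congr (_ + _).
  by rewrite !mulmxA.
by rewrite addrC trmx_mul !mulmxA.
Qed.

End Covariant.

Lemma differentiable_Ck (R : realType) (V W : normedModType R) (A : set V) (f : V -> W) x :
  Cinf A f -> A x -> differentiable f x.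
Proof. by move=> Cf Ax; have [+ _] := (CkSP _ _ _).1 (Cf 1%N); exact. Qed.

Lemma diff_sub_scale (R : realType) (V W : normedModType R) (f h : V -> W) x w (k : R) :
  differentiable f x -> differentiable h x ->
  'd (fun y => f y - k *: h y) x w = 'd f x w - k *: 'd h x w.
Proof.
move=> df dh; have dkh : differentiable (k \*: h) x by exact: differentiableZ.
have E := congr1 (fun h => h w) (diffB df dkh).
apply: (eq_trans E).
have E2 := congr1 (fun h => h w) (diffZ k dh).
exact: (congr1 (fun u => 'd f x w - u) E2).
Qed.

(** * The second fundamental form of the hypersurface *)

Section Hypersurface.
Variables (R : realType) (n : nat) (M : manifold R n.+1) (g : metric M) (V : vfield M).
Variables (N : manifold R n) (i : N -> M) (U : vfield_along i) (theta : R) (f : M -> R).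
Hypotheses (im : immersion i) (normU : unit_normal g U).
Hypothesis angle : forall (q : N) (c : mchart M), chart_at (i q) c ->
  bilin (g (i q) c) (U q c) (V (i q) c) = theta.
Hypothesis nablaV : forall (p : M) (c : mchart M), chart_at p c -> forall a,
  'd (fun x => V (cinv c x) c) (c p) a + christoffel_form g p c a (V p c) = f p *: a.

Section InCharts.
Variables (b : mchart N) (c : mchart M).
Hypotheses (ab : atlas b) (ac : atlas c).
Local Notation L := (locdom i b c).
Local Notation F := (loc i b c).
Local Notation G x := (g (i (cinv b x)) c).

Definition normal_loc (x : 'rV[R]_n) : 'rV[R]_n.+1 := U (cinv b x) c.
Definition axis_loc (x : 'rV[R]_n) : 'rV[R]_n.+1 := V (i (cinv b x)) c.
Definition axis_tangent_loc (x : 'rV[R]_n) : 'rV[R]_n.+1 := axis_loc x - theta *: normal_loc x.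

(** The covariant derivative of a vector field along N, with components a, in
    the direction of the tangent vector of N with components w. *)
Definition covariant (a : 'rV[R]_n -> 'rV[R]_n.+1) (x w : 'rV[R]_n) : 'rV[R]_n.+1 :=
  'd a x w + christoffel_form g (i (cinv b x)) c ('d F x w) (a x).

Local Notation nu := normal_loc.
Local Notation tau := axis_tangent_loc.

Lemma open_immersion_locdom : open L. Proof. exact: open_locdom im.1.1. Qed.

Lemma locdom_charts x : L x ->
  [/\ chart_at (cinv b x) b, chart_at (i (cinv b x)) c, b (cinv b x) = x &
      cinv c (F x) = i (cinv b x)].
Proof. by move=> /locdomP[/cinvK[bx ex] cx]; split=> //; rewrite /loc cmapK. Qed.

Lemma diff_immersion_inj x w : L x -> 'd F x w = 0 -> w = 0.
Proof.
move=> /locdom_charts[qb pc ex _] e; apply: (im.2 _ _ _ qb pc).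
by rewrite ex.
Qed.

Lemma Cinf_immersion : Cinf L F. Proof. exact: Cinf_loc im.1 ab ac. Qed.

Lemma Cinf_normal : Cinf L nu.
Proof. by apply: smooth_on_Cinf; [exact: open_immersion_locdom|exact: vf_smooth]. Qed.

Lemma axis_locE x : L x -> V (cinv c (F x)) c = axis_loc x.
Proof. by move=> /locdom_charts[_ _ _ e]; rewrite e. Qed.

Lemma Cinf_axis_chart : Cinf (locdom (@id M) c c) (fun y => V (cinv c y) c).
Proof. by apply: smooth_on_Cinf; [apply: open_locdom => ?|exact: vf_smooth]. Qed.

Lemma immersion_in_chart x : L x -> locdom (@id M) c c (F x).
Proof.
move=> /locdom_charts[_ [_ cx] _ e]; apply/locdomP; rewrite e; split=> //.
by exists (i (cinv b x)).
Qed.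

Lemma Cinf_axis : Cinf L axis_loc.
Proof.
move=> k; apply: (eq_Ck open_immersion_locdom axis_locE).
have oI : open (locdom (@id M) c c) by apply: open_locdom => ?.
exact: (Ck_comp open_immersion_locdom oI immersion_in_chart (Cinf_immersion k) (Cinf_axis_chart k)).
Qed.

Lemma Cinf_axis_tangent : Cinf L tau.
Proof.
move=> k; apply: Ck_sub_fun; [exact: open_immersion_locdom|exact: Cinf_axis|].
by apply: Ck_scale; [exact: open_immersion_locdom|exact: Ck_cst|exact: Cinf_normal].
Qed.

Lemma Cinf_metric : Cinf L (fun x => G x).
Proof.
have oI : open (c @` cdom c) by exact: cimg_open.
have Cg : Cinf (c @` cdom c) (fun x => g (cinv c x) c).
  by apply: smooth_on_Cinf => //; exact: gmx_smooth.
move=> k; apply: (@eq_Ck _ k _ _ _ (fun x => g (cinv c (F x)) c)); first exact: open_immersion_locdom.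
  by move=> x /locdom_charts[_ _ _ ->].
apply: (Ck_comp open_immersion_locdom oI _ (Cinf_immersion k) (Cg k)).
by move=> x /locdom_charts[_ [_ cx] _ _]; exists (i (cinv b x)).
Qed.

Lemma covariant_scale a x (k : R) w : covariant a x (k *: w) = k *: covariant a x w.
Proof.
apply: (eq_trans (congr2 +%R (diff_at_scale a x w k)
  (congr1 (christoffel_form g (i (cinv b x)) c ^~ (a x)) (diff_at_scale F x w k)))).
have algebra (A B C : 'rV[R]_n.+1) :
    k *: A + christoffel_form g (i (cinv b x)) c (k *: B) C =
    k *: (A + christoffel_form g (i (cinv b x)) c B C).
  by rewrite christoffel_formZl scalerDr.
exact: algebra.
Qed.

(** The product rule [is_derive_metric] along the coordinate line in direction
    w, for a pair of fields with constant inner product. *)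
Lemma covariant_metric (a d : 'rV[R]_n -> 'rV[R]_n.+1) (k : R) x w : L x ->
  differentiable a x -> differentiable d x ->
  (forall y, L y -> bilin (G y) (a y) (d y) = k) ->
  bilin (G x) (covariant a x w) (d x) + bilin (G x) (a x) (covariant d x w) = 0.
Proof.
move=> Lx da dd const.
have [qb pc ex eF] := locdom_charts Lx.
have x0 : x + (0 : R) *: w = x by rewrite scale0r addr0.
have line (W : normedModType R) (h : 'rV[R]_n -> W) : differentiable h x ->
    is_derive (0 : R) 1 (fun s : R => h (x + s *: w)) ('d h x w).
  by move=> dh; have := @is_derive_line _ _ _ h x w 0; rewrite x0; exact.
have dF : differentiable F x by exact: differentiable_Ck Cinf_immersion Lx.
have e0 : F (x + (0 : R) *: w) = c (i (cinv b x)) by rewrite x0.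
have := is_derive_metric g pc e0 (line _ _ dF) (line _ _ da) (line _ _ dd).
rewrite x0 => -[_ <-].
transitivity ('D_1 (cst k : R -> R) (0 : R)); last by rewrite derive_cst.
apply: near_eq_derive.
have cl : {for (0 : R), continuous (fun s : R => x + s *: w)}.
  exact: (is_derive_cont (line _ id (@ex_diff _ _ _ _ _ _ _ (is_diff_id x)))).
have nL : \forall s \near (0 : R), L (x + s *: w).
  by have := cl L; rewrite x0 => /(_ (open_nbhs_nbhs (conj open_immersion_locdom Lx))).
apply: filterS nL => s Ls; have [_ _ _ eFs] := locdom_charts Ls.
by rewrite eFs const.
Qed.

Lemma covariant_axis x w : L x -> covariant axis_loc x w = f (i (cinv b x)) *: 'd F x w.
Proof.
move=> Lx; have [qb pc ex eF] := locdom_charts Lx.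
rewrite -(nablaV pc) /covariant; congr (_ + _).
have dF : differentiable F x by exact: differentiable_Ck Cinf_immersion Lx.
have dV : differentiable (fun y => V (cinv c y) c) (F x).
  exact: differentiable_Ck Cinf_axis_chart (immersion_in_chart Lx).
have nE : \forall y \near x, ((fun y => V (cinv c y) c) \o F) y = axis_loc y.
  have := open_nbhs_nbhs (conj open_immersion_locdom Lx); apply: filterS => y; exact: axis_locE.
have [_ /(congr1 (fun h => h w)) E] := near_eq_diff nE (differentiable_comp dF dV).
apply: (eq_trans E).
apply: (eq_trans (congr1 (fun h => h w) (diff_comp dF dV))).
reflexivity.
Qed.

Lemma covariant_axis_tangent x w : L x ->
  covariant tau x w = covariant axis_loc x w - theta *: covariant nu x w.
Proof.
move=> Lx; have [qb pc ex eF] := locdom_charts Lx.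
have da : differentiable axis_loc x by exact: differentiable_Ck Cinf_axis Lx.
have du : differentiable nu x by exact: differentiable_Ck Cinf_normal Lx.
have E : 'd tau x w = 'd axis_loc x w - theta *: 'd nu x w.
  exact: (diff_sub_scale w theta da du).
apply: (eq_trans (congr1 (+%R^~ (christoffel_form g _ c ('d F x w) (tau x))) E)).
have algebra (A B X a u : 'rV[R]_n.+1) : A - theta *: B
    + christoffel_form g (i (cinv b x)) c X (a - theta *: u) =
    A + christoffel_form g (i (cinv b x)) c X a
    - theta *: (B + christoffel_form g (i (cinv b x)) c X u).
  by rewrite christoffel_formBr christoffel_formZr scalerDr opprD addrACA.
exact: algebra.
Qed.

Lemma normal_orthogonal x w : L x -> bilin (G x) (nu x) ('d F x w) = 0.
Proof.
move=> /locdom_charts[qb pc ex eF]; have [_ /(_ w)] := normU qb pc.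
by rewrite ex.
Qed.

Lemma orthogonal_tangent x X : L x -> bilin (G x) (nu x) X = 0 ->
  exists z, 'd F x z = X.
Proof.
move=> Lx UX; have [qb pc ex eF] := locdom_charts Lx.
have fJ : row_free (jacobian F x).
  by apply: row_free_jacobian => w; exact: diff_immersion_inj.
have UU : bilin (G x) (nu x) (nu x) != 0.
  by have [-> _] := normU qb pc; exact: oner_neq0.
have [z ez] := orthogonal_in_rowspace fJ UU (gmx_sym g pc)
  (fun w => etrans (congr1 _ (esym (mul_jacobian _ _ _))) (normal_orthogonal w Lx)) UX.
by exists z; rewrite mul_jacobian.
Qed.

Lemma axis_tangentE x : L x -> tau x = tangential g V U (cinv b x) c.
Proof. by move=> /locdom_charts[qb pc ex eF]; rewrite /tangential angle. Qed.

Lemma axis_tangent_orthogonal x : L x -> bilin (G x) (nu x) (tau x) = 0.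
Proof.
move=> Lx; have [qb pc ex eF] := locdom_charts Lx.
rewrite /axis_tangent_loc -scaleNr bilinDr bilinZr angle //.
by have [-> _] := normU qb pc; rewrite mulr1 subrr.
Qed.

(** Deriving <U, dF z> = 0 along w, both sides become minus the inner product
    of U with a second covariant derivative of the immersion, which is
    symmetric since second derivatives commute and the Christoffel symbols are
    symmetric. *)
Lemma shape_symmetric x w z : L x ->
  bilin (G x) (covariant nu x w) ('d F x z) = bilin (G x) (covariant nu x z) ('d F x w).
Proof.
move=> Lx; have [qb pc ex eF] := locdom_charts Lx.
have du : differentiable nu x by exact: differentiable_Ck Cinf_normal Lx.
have dd v : differentiable (fun y => 'd F y v) x.
  apply: differentiable_Ck Lx => k.
  apply: (Ck_diff_at open_immersion_locdom open_immersion_locdom (Cinf_immersion k.+1)) => //; [exact: Ck_id|exact: Ck_cst].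
have rule v u := covariant_metric u Lx du (dd v) (fun y Ly => normal_orthogonal v Ly).
have /eqP := rule z w; rewrite addr_eq0 => /eqP ->.
have /eqP := rule w z; rewrite addr_eq0 => /eqP ->.
congr (- bilin _ _ _).
exact: (congr2 +%R (diff_diff_sym _ _ open_immersion_locdom (Cinf_immersion 2%N) Lx) (christoffel_formC g pc _ _)).
Qed.

(** The derivative of U along the tangential part of the axis is tangent,
    being orthogonal to U. Its inner product with itself is by symmetry the
    inner product of the tangential part of the axis with a derivative of U,
    which vanishes because both <U, U> and <U, V> are constant and the
    derivative of V is tangent. *)
Lemma covariant_normal_axis x z : L x -> 'd F x z = tau x -> covariant nu x z = 0.
Proof.
move=> Lx ez; have [qb pc ex eF] := locdom_charts Lx.
have sG := gmx_sym g pc.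
have du : differentiable nu x by exact: differentiable_Ck Cinf_normal Lx.
have da : differentiable axis_loc x by exact: differentiable_Ck Cinf_axis Lx.
have cU w : bilin (G x) (nu x) (covariant nu x w) = 0.
  have := @covariant_metric nu nu 1 x w Lx du du.
  have h y : L y -> bilin (G y) (nu y) (nu y) = 1.
    by move=> /locdom_charts[qb' pc' _ _]; have [-> _] := normU qb' pc'.
  by move=> /(_ h); rewrite [X in X + _]bilinC // => H; lra.
have cV w : bilin (G x) (covariant nu x w) (axis_loc x) = 0.
  have h y : L y -> bilin (G y) (nu y) (axis_loc y) = theta.
    by move=> /locdom_charts[_ pc' _ _]; exact: angle.
  have := @covariant_metric nu axis_loc theta x w Lx du da h.
  by rewrite covariant_axis // bilinZr normal_orthogonal // mulr0 addr0.
have [y ey] := orthogonal_tangent Lx (cU z).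
apply/eqP/negPn/negP => nz; have := gmx_pos g pc nz.
rewrite -[X in bilin _ _ X]ey shape_symmetric // ez /axis_tangent_loc.
rewrite -scaleNr bilinDr bilinZr cV [X in _ * X]bilinC // cU mulr0 addr0.
by rewrite ltxx.
Qed.

Lemma covariant_tangential x z : L x -> 'd F x z = tau x ->
  covariant tau x z = f (i (cinv b x)) *: tau x.
Proof.
move=> Lx ez; rewrite covariant_axis_tangent // covariant_axis // ez.
by rewrite covariant_normal_axis // scaler0 subr0.
Qed.

End InCharts.

End Hypersurface.

Lemma is_derive_inv_sqrt (R : realType) (rho : R -> R) (t c e : R) : 0 < rho t ->
  is_derive t 1 rho (2 * c * rho t) ->
  is_derive t 1 (fun s => e / Num.sqrt (rho s)) (- c * (e / Num.sqrt (rho t))).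
Proof.
move=> r0 dr; have s0 : 0 < Num.sqrt (rho t) by rewrite sqrtr_gt0.
have [dq Eq] := is_derive_diff (is_derive1_sqrt r0).
have := is_derive_chain dr dq; rewrite Eq => ds.
have n0 : Num.sqrt (rho t) != 0 by rewrite gt_eqF.
have [di Ei] : differentiable (fun s : R => s^-1) (Num.sqrt (rho t)) /\
    forall h : R, 'd (fun s : R => s^-1) (Num.sqrt (rho t)) h
     = h *: (- (Num.sqrt (rho t)) ^- 2).
  apply: is_derive_diff.
  have := @is_deriveV _ id (Num.sqrt (rho t)) 1 1 n0 (is_derive_id _ _).
  by rewrite /GRing.scale /= mulr1.
have := is_derive_chain ds di; rewrite Ei => dv.
have := is_derive_prod_real (is_derive_cst e t 1) dv; congr is_derive.
rewrite mul0r add0r /cst /GRing.scale /= -[in 2 * c * rho t](sqr_sqrtr (ltW r0)).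
by field.
Qed.

Lemma is_derive_scale_curve (R : realType) (W : normedModType R) (m : R -> R) (a : R -> W)
    (t m' : R) (a' : W) : is_derive t 1 m m' -> is_derive t 1 a a' ->
  is_derive t 1 (fun s => m s *: a s) (m t *: a' + m' *: a t).
Proof.
move=> dm da; have [ds Es] := diff_scale (m t, a t).
have := is_derive_chain (is_derive_pair dm da) ds; congr is_derive.
by rewrite Es.
Qed.

Section Geodesics.
Variables (R : realType) (n : nat) (M : manifold R n.+1) (g : metric M) (V : vfield M).
Variables (N : manifold R n) (i : N -> M) (U : vfield_along i) (theta : R) (f : M -> R).
Hypotheses (im : immersion i) (normU : unit_normal g U).
Hypothesis angle : forall (q : N) (c : mchart M), chart_at (i q) c ->
  bilin (g (i q) c) (U q c) (V (i q) c) = theta.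
Hypothesis nablaV : forall (p : M) (c : mchart M), chart_at p c -> forall a,
  'd (fun x => V (cinv c x) c) (c p) a + christoffel_form g p c a (V p c) = f p *: a.
Hypothesis tangential_neq0 : forall (q : N) (c : mchart M), chart_at (i q) c ->
  tangential g V U q c != 0.
Variables (b : mchart N) (ab : atlas b).
Local Notation tau := (axis_tangent_loc V U theta b).
Local Notation speed2 x c := (bilin (g (i (cinv b x)) c) (tau c x) (tau c x)).

Lemma axis_tangent_pos (c : mchart M) x : atlas c -> locdom i b c x -> 0 < speed2 x c.
Proof.
move=> ac Lx; have [qb pc ex eF] := locdom_charts ab ac Lx.
apply: gmx_pos => //; rewrite (axis_tangentE angle ab ac Lx).
exact: tangential_neq0.
Qed.

(** Normalising the tangential part of the axis makes its integral curves
    geodesics: in the derivative of tau / |tau| along the curve, the term f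
    from tau cancels against the one from |tau|, as the derivative of |tau|^2
    is 2 f |tau|^2 times the speed factor. The sign of e allows for integral
    curves that run backwards. *)
Lemma geodesic_axis_tangent (I : set R) (x x' : R -> 'rV[R]_n) (e : R) : open I ->
  Cinf I x -> (forall t, I t -> (b @` cdom b) (x t)) ->
  (forall t, I t -> is_derive t 1 x (x' t)) -> e != 0 ->
  (forall t (c : mchart M), I t -> chart_at (i (cinv b (x t))) c ->
     'd (loc i b c) (x t) (x' t) = (e / Num.sqrt (speed2 (x t) c)) *: tau c (x t)) ->
  geodesic g I (fun t => i (cinv b (x t))).
Proof.
move=> oI Cx xb dx e0 vel; split; first exact: (smooth_coordinate_curve im.1 ab).
move=> t c It pc; have [ac ct] := pc.
pose p := i (cinv b (x t)).
have near_t := coordinate_curve_near im.1 oI Cx xb It ac ct.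
have Lt : locdom i b c (x t) by apply/locdomP; split => //; exact: xb.
have [_ _ _ eF] := locdom_charts ab ac Lt.
pose y s := loc i b c (x s).
pose a s := tau c (x s).
pose rho s := bilin (g (cinv c (y s)) c) (a s) (a s).
pose m s := e / Num.sqrt (rho s).
have rho_t : rho t = speed2 (x t) c by rewrite /rho eF.
have rho0 : 0 < rho t by rewrite rho_t; exact: axis_tangent_pos.
have m0 : m t != 0 by rewrite mulf_neq0 // invr_neq0 // gt_eqF // sqrtr_gt0.
have Y' : 'd (loc i b c) (x t) (x' t) = m t *: a t by rewrite vel // /m rho_t.
have dy : is_derive t 1 y (m t *: a t).
  rewrite -Y'; apply: (is_derive_chain (dx _ It)).
  exact: differentiable_Ck (Cinf_immersion im ab ac) Lt.
pose a' := 'd (tau c) (x t) (x' t).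
have da : is_derive t 1 a a'.
  apply: (is_derive_chain (dx _ It)).
  exact: differentiable_Ck (Cinf_axis_tangent V U theta im ab ac) Lt.
have cov : a' + christoffel_form g p c (m t *: a t) (a t) = (m t * f p) *: a t.
  have z0 : 'd (loc i b c) (x t) ((m t)^-1 *: x' t) = a t.
    by rewrite diff_at_scale Y' scalerA mulVf // scale1r.
  have C : covariant g i b c (tau c) (x t) (x' t) = (m t * f p) *: a t.
    have ex : x' t = m t *: ((m t)^-1 *: x' t) by rewrite scalerA mulfV // scale1r.
    apply: (eq_trans (congr1 (covariant g i b c (tau c) (x t)) ex)).
    apply: (eq_trans (covariant_scale _ _ _ _ _ _ _ _)).
    rewrite -scalerA; congr (_ *: _).
    exact: (covariant_tangential im normU angle nablaV ab ac Lt z0).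
  exact: (eq_trans (congr1 (fun u => a' + christoffel_form g p c u (a t)) (esym Y')) C).
have yt : y t = c p by [].
have drho := is_derive_metric g pc yt dy da da.
have dm : is_derive t 1 m (- (m t * f p) * m t).
  apply: is_derive_inv_sqrt => //; move: drho; congr is_derive.
  rewrite cov bilinZl bilinZr /rho eF -/p -/(a t); ring.
have dW : is_derive t 1 (fun s => m s *: a s)
    (m t *: a' + (- (m t * f p) * m t) *: a t).
  exact: is_derive_scale_curve.
rewrite /acceleration.
have nE : \forall s \near t, m s *: a s = velocity (fun t => i (cinv b (x t))) s c.
  apply: filterS near_t => s [Is Ls]; have [_ pcs _ eFs] := locdom_charts ab ac Ls.
  rewrite (velocity_coordinate_curve im.1 ab xb Is (dx _ Is) ac pcs.2) vel //.
  by rewrite /m /rho eFs.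
rewrite -(nbhs_singleton nE) derive1E.
rewrite -(near_eq_derive _ nE).
have [_ ->] := dW.
rewrite christoffel_formZr addrAC -scalerDr cov scalerA -scalerDl.
rewrite (_ : _ + _ = 0) ?scale0r //; ring.
Qed.

End Geodesics.

(** * The foliation by integral curves of the axis *)

Section Foliation.
Variables (R : realType) (n : nat) (M : manifold R n.+1) (g : metric M) (V : vfield M).
Variables (N : manifold R n) (i : N -> M) (U : vfield_along i) (theta : R).
Hypotheses (im : immersion i) (normU : unit_normal g U).
Hypothesis angle : forall (q : N) (c : mchart M), chart_at (i q) c ->
  bilin (g (i q) c) (U q c) (V (i q) c) = theta.
Variables (b : mchart N) (ab : atlas b).
Local Notation tau := (axis_tangent_loc V U theta b).
Local Notation speed2 x c := (bilin (g (i (cinv b x)) c) (tau c x) (tau c x)).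

(** Needed because the direction field is constructed in one chart of M, while
    the geodesic equation concerns all of them. *)
Lemma axis_tangent_trans (c c' : mchart M) x : atlas c -> atlas c' ->
  locdom i b c x -> locdom i b c' x ->
  tau c' x = 'd (loc id c c') (c (i (cinv b x))) (tau c x) /\ speed2 x c' = speed2 x c.
Proof.
move=> ac ac' Lx Lx'.
have [qb pc ex eF] := locdom_charts ab ac Lx.
have [_ pc' _ _] := locdom_charts ab ac' Lx'.
have E : tau c' x = 'd (loc id c c') (c (i (cinv b x))) (tau c x).
  have EV := vf_tangent V pc pc'; have EU := vf_tangent U pc pc'.
  have dlin (W1 W2 : normedModType R) (h : W1 -> W2) y u v (k : R) :
    'd h y (u - k *: v) = 'd h y u - k *: 'd h y v by rewrite linearB linearZ.
  apply: (eq_trans _ (esym (dlin _ _ _ _ _ _ _))).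
  exact: (congr2 (fun u v => u - theta *: v) EV EU).
split=> //; rewrite (gmx_tensor g pc pc').
exact: (congr2 (bilin _) E E).
Qed.

(** Solving for the preimage of the tangential part of the axis under the
    injective differential: K inverts the Jacobian matrix at x0, so the
    product with K stays invertible nearby. *)
Lemma axis_tangent_pullback (c : mchart M) x0 : atlas c -> locdom i b c x0 ->
  exists (D : set 'rV[R]_n) (T : 'rV[R]_n -> 'rV[R]_n),
    [/\ open D, D x0, D `<=` locdom i b c, Cinf D T &
        forall x, D x -> 'd (loc i b c) x (T x) = tau c x].
Proof.
move=> ac L0; pose L := locdom i b c; pose F := loc i b c.
have oL : open L by exact: open_locdom im.1.1.
pose J := jacobian F.
have fJ x : L x -> row_free (J x).
  by move=> Lx; apply: row_free_jacobian => w; exact: (diff_immersion_inj im ab ac Lx).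
have /row_freeP[K JK] := fJ x0 L0.
have CJ : Cinf L (fun x => J x *m K).
  move=> k; apply: Ck_mulmx => //; last exact: Ck_cst.
  exact: (Ck_jacobian oL (Cinf_immersion im ab ac)).
pose D := L `&` (fun x => \det (J x *m K)) @^-1` [set t : R | t != 0].
have oD : open D.
  exact: (open_preimage_in oL (@open_neq0 R) (Ck_continuous (Ck_det oL (CJ 0%N)))).
have DL : D `<=` L by move=> x [].
exists D, (fun x => tau c x *m K *m invmx (J x *m K)); split=> //.
- by split=> //=; rewrite JK det1 oner_neq0.
- move=> k; apply: Ck_mulmx => //.
    apply: Ck_mulmx => //; last exact: Ck_cst.
    exact: Ck_sub DL (Cinf_axis_tangent V U theta im ab ac k).
  apply: Ck_invmx => //; last exact: Ck_sub DL (CJ k).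
  by move=> x [_ d0]; rewrite unitmxE unitfE.
- move=> x [Lx d0].
  have [z ez] := orthogonal_tangent im normU ab ac Lx
    (axis_tangent_orthogonal normU angle ab ac Lx).
  have zJ : z *m J x = tau c x by rewrite -mul_jacobian.
  have -> : tau c x *m K *m invmx (J x *m K) = z.
    by rewrite -zJ -(mulmxA z) mulmxK // unitmxE unitfE.
  exact: ez.
Qed.

End Foliation.

Section DirectionField.
Variables (R : realType) (n : nat) (M : manifold R n.+2) (g : metric M) (V : vfield M).
Variables (N : manifold R n.+1) (i : N -> M) (U : vfield_along i) (theta : R).
Hypotheses (im : immersion i) (normU : unit_normal g U).
Hypothesis angle : forall (q : N) (c : mchart M), chart_at (i q) c ->
  bilin (g (i q) c) (U q c) (V (i q) c) = theta.
Hypothesis tangential_neq0 : forall (q : N) (c : mchart M), chart_at (i q) c ->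
  tangential g V U q c != 0.
Variables (b : mchart N) (ab : atlas b).
Local Notation tau := (axis_tangent_loc V U theta b).
Local Notation speed2 x c := (bilin (g (i (cinv b x)) c) (tau c x) (tau c x)).

(** Y is the direction of the axis, scaled to have k-th component 1 as the
    straightening requires, and h turns it into plus or minus the unit vector;
    the sign e makes h positive, so that h is the velocity of a
    reparametrisation. *)
Lemma direction_field (c : mchart M) x0 : atlas c -> locdom i b c x0 ->
  exists (D : set 'rV[R]_n.+1) (Y : 'rV[R]_n.+1 -> 'rV[R]_n.+1)
      (h : 'rV[R]_n.+1 -> R) (k : 'I_n.+1) (e : R),
    [/\ [/\ open D, D x0 & D `<=` locdom i b c], Cinf D Y /\ Cinf D h, e != 0,
        forall x, D x -> Y x 0 k = 1 /\ 0 < h x &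
        forall x, D x -> 'd (loc i b c) x (h x *: Y x) =
          (e / Num.sqrt (speed2 x c)) *: tau c x].
Proof.
move=> ac L0.
have [D0 [T [oD0 D0x D0L CT TE]]] := axis_tangent_pullback im normU angle ab ac L0.
have pos x : D0 x -> 0 < speed2 x c.
  move=> Dx; exact: (axis_tangent_pos angle tangential_neq0 ab ac (D0L _ Dx)).
have [k Tk] : exists k, T x0 0 k != 0.
  apply/rV0Pn/eqP => T0; have := pos _ D0x.
  have -> : tau c x0 = 0 by rewrite -(TE _ D0x) T0; exact: linear0.
  by rewrite bilin0l ltxx.
pose e := Num.sg (T x0 0 k).
have e0 : e != 0 by rewrite sgr_eq0.
have Ce j : Cinf D0 (fun x => T x 0 j) by move=> m; exact: Ck_coord.
have CeT : Cinf D0 (fun x => e * T x 0 k).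
  by move=> m; apply: Ck_mul => //; [exact: Ck_cst|exact: Ce].
pose D := D0 `&` (fun x => e * T x 0 k) @^-1` [set t : R | 0 < t].
have oD : open D.
  exact: (open_preimage_in oD0 (@open_gt _ 0) (Ck_continuous (CeT 0%N))).
have DD0 : D `<=` D0 by move=> x [].
have Tk0 x : D x -> T x 0 k != 0.
  by move=> [_ /= p]; apply: contraTneq p => ->; rewrite mulr0 ltxx.
have Cs : Cinf D0 (fun x => speed2 x c).
  move=> m; rewrite /bilin; apply: Ck_coord => //.
  have Ct := Ck_sub D0L (Cinf_axis_tangent V U theta im ab ac m).
  apply: Ck_mulmx => //; last first.
    by apply: Ck_mx => // p q; under eq_fun do rewrite mxE; exact: Ck_coord.
  by apply: Ck_mulmx => //; exact: Ck_sub D0L (Cinf_metric g im ab ac m).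
exists D, (fun x => (T x 0 k)^-1 *: T x),
  (fun x => e * T x 0 k * (Num.sqrt (speed2 x c))^-1), k, e; split=> //.
- by split=> //; [split=> //=; rewrite /e -normrEsg normr_gt0|move=> x /DD0/D0L].
- split=> m.
    apply: Ck_scale => //; last exact: Ck_sub DD0 (CT m).
    by apply: Ck_inv => //; exact: Ck_sub DD0 (Ce k m).
  apply: Ck_mul => //; first exact: Ck_sub DD0 (CeT m).
  apply: Ck_inv => //.
    by move=> x /DD0/pos p; rewrite gt_eqF // sqrtr_gt0.
  by apply: Ck_sqrt => //; [move=> x /DD0/pos|exact: Ck_sub DD0 (Cs m)].
- move=> x Dx; split; first by rewrite mxE mulVf // Tk0.
  by case: Dx => D0x' p; rewrite mulr_gt0 // invr_gt0 sqrtr_gt0 pos.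
- move=> x Dx; rewrite scalerA diff_at_scale (TE _ (DD0 _ Dx)); congr (_ *: _).
  by field; rewrite (Tk0 _ Dx) gt_eqF // sqrtr_gt0 pos //; exact: DD0.
Qed.

End DirectionField.

(** Compatibility with the other charts holds since Psi and Theta are smooth;
    maximality of the atlas then provides the chart. *)
Lemma cube_chart (R : realType) n (N : manifold R n) (b : mchart N) (A : set 'rV[R]_n)
    (Psi Theta : 'rV[R]_n -> 'rV[R]_n) (e : R) :
  0 < e -> atlas b -> open A -> A `<=` b @` cdom b ->
  Cinf (cube e) Psi -> Cinf A Theta ->
  (forall z, cube e z -> A (Psi z) /\ Theta (Psi z) = z) ->
  (forall x, A x -> cube e (Theta x) /\ Psi (Theta x) = x) ->
  exists c : mchart N, [/\ atlas c, cdom c = [set p | cdom b p /\ A (b p)],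
    forall p, c p = Theta (b p), forall z, cinv c z = cinv b (Psi z) &
    c @` cdom c = cube e].
Proof.
move=> e0 ab oA Ab CP CT PA TA.
pose dom := [set p : N | cdom b p /\ A (b p)].
have odom : open dom.
  rewrite openE => p [bp Ap].
  have nb := open_nbhs_nbhs (conj (cdom_open b) bp).
  have := cmap_continuous bp (open_nbhs_nbhs (conj oA Ap)).
  by apply: filterS2 nb.
have img : (fun p => Theta (b p)) @` dom = cube e.
  apply/seteqP; split=> [_ [p [bp Ap] <-]|z Cz]; first by have [] := TA _ Ap.
  have [Az Ez] := PA _ Cz; have [bq eq] := cinvK (Ab _ Az).
  by exists (cinv b (Psi z)); [split=> //; rewrite eq|rewrite eq].
have oimg : open ((fun p => Theta (b p)) @` dom) by rewrite img; exact: open_cube.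
have K p : dom p -> cinv b (Psi (Theta (b p))) = p.
  by move=> [bp Ap]; have [_ ->] := TA _ Ap; rewrite cmapK.
have cm p : dom p -> {for p, continuous (fun p => Theta (b p))}.
  move=> [bp Ap]; apply: (@continuous_comp _ _ _ b Theta); first exact: cmap_continuous.
  exact: (Ck_continuous (CT 0%N)).
have ci x : ((fun p => Theta (b p)) @` dom) x ->
    {for x, continuous (fun z => cinv b (Psi z))}.
  rewrite img => Cx; apply: (@continuous_comp _ _ _ Psi (cinv b)).
    exact: (Ck_continuous (CP 0%N)).
  by apply: cinv_continuous; apply: Ab; have [] := PA _ Cx.
pose c : mchart N := Chart odom oimg K cm ci.
have imgc : c @` cdom c = cube e by exact: img.
exists c; split=> //; apply: atlas_maximal => d ad.
have oid (b1 b2 : mchart N) : open (locdom (@id N) b1 b2) by apply: open_locdom => ?.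
split; apply: Cinf_smooth_on => // k.
  apply: (@Ck_comp _ k _ _ _ _ _ Psi (loc id b d) (oid c d) (oid b d)).
  - move=> z /locdomP[]; rewrite imgc => Cz dz; apply/locdomP; split=> //.
    by apply: Ab; have [] := PA _ Cz.
  - by apply: Ck_sub (CP k) => z /locdomP[]; rewrite imgc.
  - exact: Cinf_loc (smooth_map_id N) ab ad k.
apply: (@Ck_comp _ k _ _ _ _ _ (loc id d b) Theta (oid d c) oA).
- by move=> y /locdomP[_ []].
- apply: Ck_sub (Cinf_loc (smooth_map_id N) ad ab k) => y /locdomP[Iy [by_ _]].
  by apply/locdomP.
- exact: CT.
Qed.

Lemma slice_set_first (R : realType) n (N : manifold R n.+1) (c : mchart N) a p :
  slice c a p <-> cdom c p /\ c p = set_first a (c p 0 ord0).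
Proof.
split=> -[cp h]; split=> //.
  apply/matrixP => j k; rewrite ord1 mxE; case: eqVneq => [->//|k0].
  by apply: h; apply: contra k0 => /eqP k0; apply/eqP/val_inj.
move=> k k0; rewrite h mxE; case: eqVneq => // k0'.
by move: k0; rewrite k0'.
Qed.

(** The leaves lie in the domain of c and each is exactly one slice, so the
    single chart c is flat around all points. *)
Lemma slices_foliation (R : realType) n (N : manifold R n) (c : mchart N) (e : R) :
  atlas c -> c @` cdom c = cube e ->
  (forall a, cube e a -> exists (I : set R) (gam : R -> N),
    regular_curve I gam /\ gam @` I = slice c a) ->
  foliation_by_curves (cdom c) (slice c @` cube e).
Proof.
move=> ac img leaf; split.
- split.
  + apply/seteqP; split=> [p [_ [a _ <-]] [] //|p cp].
    by exists (slice c (c p)); [exists (c p) => //; rewrite -img; exists p|].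
  + move=> _ _ [a _ <-] [a' _ <-] [p [[_ h] [_ h']]].
    apply/seteqP; split=> q [cq hq]; split=> // k k0; rewrite hq //.
      by rewrite -h // h'.
    by rewrite -h' // h.
  + move=> _ [a Ca <-]; move: Ca; rewrite -img => -[p cp <-]; by exists p.
- by move=> _ [a Ca <-]; exact: leaf.
- move=> p cp; exists c; split=> //.
    exists (const_mx (- e)), (const_mx e); rewrite img.
    by apply/seteqP; split=> x h k; have := h k; rewrite !mxE ltr_norml.
  move=> _ [a Ca <-]; exists [set a]; first exact: countable1.
  rewrite bigcup_set1; apply/seteqP; split=> [q [//]|q h]; split=> //; by case: h.
Qed.

Lemma Ck_set_first (R : realType) n k (A : set R) (a : 'rV[R]_n.+1) : open A ->
  Ck k A (set_first a).
Proof.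
move=> oA; apply: Ck_mx => // p j; under eq_fun do rewrite mxE.
by case: (j == ord0); [exact: Ck_id|exact: Ck_cst].
Qed.

Lemma diff_transition_inj_at (R : realType) n (M : manifold R n) (b c : mchart M) x w :
  atlas b -> atlas c -> (b @` cdom b) x -> cdom c (cinv b x) ->
  'd (loc (@id M) b c) x w = 0 -> w = 0.
Proof.
move=> ab ac [p bp <-]; rewrite cmapK // => cp.
by apply: diff_transition_inj; split.
Qed.

Lemma cube_set_first (R : realType) n (e e' : R) (a : 'rV[R]_n.+1) (t : R) :
  cube e a -> e <= e' -> `|t| < e' -> cube e' (set_first a t).
Proof.
move=> Ca ee ht j; rewrite mxE; case: eqVneq => // _.
exact: lt_le_trans (Ca j) ee.
Qed.

(** The leaves are the slices of a chart that straightens the direction field.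
    Along a slice, the reparametrisation by [positive_ode_line] runs with unit
    speed, and one parametrisation shows both that the slice is a regular
    curve and that its image in M is a geodesic. *)
Lemma concircular_hypersurface_ruled (R : realType) (n : nat)
    (M : manifold R n.+2) (g : metric M) (V : vfield M)
    (N : manifold R n.+1) (i : N -> M) (U : vfield_along i) :
  concircular g V -> nontrivial_concircular_hypersurface g V U -> locally_ruled g i.
Proof.
move=> /concircular_pointwise[f nablaV] [im normU tangential_neq0 [theta angle]] q.
have [b ab bq] := atlas_cover q.
have [c0 ac0 c0q] := atlas_cover (i q).
have L0 : locdom i b c0 (b q) by exists q.
have [D [Y [h [k [e' [[oD Dq DL] [CY Ch] e'0 Y1 vel0]]]]]] :=
  direction_field im normU angle tangential_neq0 ab ac0 L0.
have Y1' x : D x -> Y x 0 k = 1 by move=> /Y1[].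
have [A [Psi [Chi [e [e0 [oA AD Aq] [[CP PD] CT PA TA] flow]]]]] := flow_box oD CY Dq Y1'.
have e2 : 0 < 2 * e by lra.
have le2 : e <= 2 * e by lra.
have sub2 : cube e `<=` (cube (2 * e) : set 'rV[R]_n.+1).
  by move=> z hz j; exact: lt_le_trans (hz j) le2.
have Ab : A `<=` b @` cdom b by move=> x /AD/DL/locdomP[].
have [c [ac domc cE cinvE imgc]] :=
  cube_chart e0 ab oA Ab (fun k => Ck_sub sub2 (CP k)) CT PA TA.
have cq : cdom c q by rewrite domc.
exists (cdom c); split=> //; first exact: cdom_open.
have leaf a : cube e a -> exists (I : set R) (gam : R -> N),
    [/\ regular_curve I gam, gam @` I = slice c a & geodesic g I (i \o gam)].
  move=> Ca; pose x (t : R) := Psi (set_first a t).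
  have oI2 : open [set t : R | `|t| < 2 * e].
    by apply: open_norm_lt; exact: (@Ck_id _ _ _ setT).
  have Cx : Cinf [set t : R | `|t| < 2 * e] x.
    have sub : [set t : R | `|t| < 2 * e] `<=` set_first a @^-1` cube (2 * e).
      by move=> t ht; exact: cube_set_first Ca le2 ht.
    by move=> m; exact: (Ck_comp oI2 (open_cube e2) sub (Ck_set_first m a oI2) (CP m)).
  have xD t : `|t| < 2 * e -> D (x t).
    by move=> ht; apply: PD; exact: cube_set_first Ca le2 ht.
  have [J [tau [oJ Ctau dtau tauJ]]] := positive_ode_line e0
    (fun m => Ck_comp oI2 oD xD (Cx m) (Ch m)) (fun t ht => (Y1 _ (xD t ht)).2).
  have [opJ _ _] := oJ.
  pose X u := x (tau u).
  have te u : J u -> `|tau u| < 2 * e.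
    by move=> Ju; have [h1 _] := dtau _ Ju; exact: lt_le_trans h1 le2.
  have CX : Cinf J X by move=> m; exact: (Ck_comp opJ oI2 te (Ctau m) (Cx m)).
  have XA u : J u -> A (X u) /\ Chi (X u) = set_first a (tau u).
    by move=> Ju; apply: PA; have [h1 _] := dtau _ Ju; exact: cube_set_first Ca (lexx _) h1.
  have XD u : J u -> D (X u) by move=> /XA[/AD].
  have Xb u : J u -> (b @` cdom b) (X u) by move=> /XA[/Ab].
  have dX u : J u -> is_derive u 1 X (h (X u) *: Y (X u)).
    move=> Ju; have [_ dt] := dtau _ Ju.
    have dx := flow a (tau u) Ca (te _ Ju).
    have [dd E] := is_derive_diff dx.
    by have := is_derive_chain dt dd; rewrite E.
  have Lc0 u : J u -> locdom i b c0 (X u) by move=> /XD/DL.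
  (* In the chart b the k-th coordinate of the velocity is h, which is
     positive. *)
  exists J, (fun u => cinv b (X u)); split.
  - split=> //; first exact: (smooth_coordinate_curve (smooth_map_id N) ab opJ CX Xb).
    move=> u d Ju ud.
    have -> := velocity_coordinate_curve (smooth_map_id N) ab Xb Ju (dX _ Ju) ud.1 ud.2.
    apply/eqP => v0.
    have : h (X u) *: Y (X u) = 0.
      exact: (diff_transition_inj_at ab ud.1 (Xb _ Ju) ud.2 v0).
    have [Yk hk] := Y1 _ (XD _ Ju).
    move=> /(congr1 (fun v : 'rV[R]_n.+1 => v 0 k)); rewrite !mxE Yk mulr1 => h0.
    by rewrite h0 ltxx in hk.
  - apply/seteqP; split=> [_ [u Ju <-]|p /slice_set_first[cp ep]].
      have [bX eX] := cinvK (Xb _ Ju); have [AX TX] := XA _ Ju.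
      apply/slice_set_first; rewrite domc cE eX TX; split; first by split=> //=; rewrite eX.
      by congr set_first; rewrite mxE eqxx.
    have Cp : cube e (c p) by rewrite -imgc; exists p.
    have [u Ju eu] := tauJ _ (Cp ord0).
    exists u => //; rewrite /X /x eu -ep -cinvE; exact: cmapK.
  - apply: (geodesic_axis_tangent im normU angle nablaV tangential_neq0 ab opJ CX Xb dX e'0).
    move=> u d Ju pd; have [ad _] := pd.
    have Ld : locdom i b d (X u) by apply/locdomP; split; [exact: Xb|exact: pd.2].
    have [qb pc ex eF] := locdom_charts ab ac0 (Lc0 _ Ju).
    have [-> ->] := axis_tangent_trans g V U theta ab ac0 ad (Lc0 _ Ju) Ld.
    apply: (eq_trans _ (diff_at_scale _ _ _ _)).
    have T := diff_loc_id_trans (h (X u) *: Y (X u)) im.1 qb pc pd.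
    rewrite ex in T; apply: (eq_trans T).
    exact: (congr1 _ (vel0 _ (XD _ Ju))).
exists (slice c @` cube e).
  by apply: slices_foliation => // a /leaf[J [gam [rg ig _]]]; exists J, gam.
by move=> _ [a Ca <-]; exact: leaf.
Qed.

Theorem theorem4p9 (R : realType) (n : nat)
    (M : manifold R n.+1) (g : metric M) (V : vfield M)
    (N : manifold R n) (i : N -> M) (U : vfield_along i) :
  complete_metric g ->
  concircular g V ->
  nontrivial_concircular_hypersurface g V U ->
  locally_ruled g i.
Proof.
(* On a zero-dimensional N the tangential part of the axis would be zero. *)
case: n M g V N i U => [|n] M g V N i U _; last exact: concircular_hypersurface_ruled.
move=> _ [im normU tangential_neq0 [theta angle]] q.
have [b ab bq] := atlas_cover q.
have [c ac cq] := atlas_cover (i q).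
have Lq : locdom i b c (b q) by exists q.
have [z ez] := orthogonal_tangent im normU ab ac Lq
  (axis_tangent_orthogonal normU angle ab ac Lq).
have [qb pc _ _] := locdom_charts ab ac Lq.
have := tangential_neq0 _ _ pc; rewrite -(axis_tangentE angle ab ac Lq) -ez.
have -> : z = 0 by apply/matrixP => p [].
by rewrite linear0 eqxx.
Qed.
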